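(* Let $n\geq 1$, let $\xi_1,\dots,\xi_n\in\mathbb{T}$ be distinct, let $\eta_1,\dots,\eta_n\in\mathbb{T}$ and $\rho_1,\dots,\rho_n\ge0$, and suppose that the Pick matrix of the corresponding Problem $\partial NP\mathcal{S}$ is positive definite. Let $\tau,\sigma\in\mathbb{T}$ be distinct from $\xi_1,\dots,\xi_n$ and $\eta_1,\dots,\eta_n$ respectively. There exist $$s_1,\dots,s_n\in\mathbb{R}\cup\{\infty\},\qquad t_1,\dots,t_n>0,\qquad y_1,\dots,y_n\in\mathbb{R}\cup\{\infty\}$$ such that the general solution of Problem $\partial NP\mathcal{S}$ is $\varphi=C_\sigma^{-1}\circ f_1\circ C_\tau$ where the functions $f_{n+1},\dots,f_1\in\mathcal{P}$ are given recursively by: (1) $f_{n+1}$ is any function in $\mathcal{P}$ that is meromorphic at $C_\tau(\xi_1),\dots,C_\tau(\xi_n)$ and satisfies $f_{n+1}(C_\tau(\xi_j))\neq y_j$ for $j=1,\dots,n$; (2) $f_k$ is the augmentation of $f_{k+1}$ at $C_\tau(\xi_k)$ by $s_k,t_k$, for $k=n,\dots,1$. (That is, the set of solutions is exactly the set of functions $\varphi$ obtained in this way.)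
   Context: $\mathbb{D}$ is the open unit disc, $\mathbb{T}$ the unit circle, $\Pi=\{z\in\mathbb{C}:\operatorname{Im} z>0\}$. The Schur class $\mathcal{S}$ is the set of functions analytic and bounded by $1$ (in modulus) on $\mathbb{D}$. The Pick class $\mathcal{P}$ is the set of functions analytic and with non-negative imaginary part in $\Pi$. A function in either class is analytic (meromorphic) at a boundary point if it extends analytically (meromorphically) to a neighbourhood of that point; its value at a pole is $\infty$. For $\varphi$ differentiable and non-zero at $\xi\in\mathbb{T}$, $(A\varphi)(\xi)=\operatorname{Re}\frac{\xi\varphi'(\xi)}{\varphi(\xi)}$ (the rate of change of the argument of $\varphi(e^{it})$ with respect to $t$). Problem $\partial NP\mathcal{S}$: find all $\varphi\in\mathcal{S}$, analytic at $\xi_1,\dots,\xi_n$, with $\varphi(\xi_j)=\eta_j$ and $(A\varphi)(\xi_j)=\rho_j$ for $j=1,\dots,n$; these are the solutions. Its Pick matrix is $M=[m_{ij}]_{i,j=1}^n$ with $m_{jj}=\rho_j$ and $m_{ij}=\frac{1-\bar\eta_i\eta_j}{1-\bar\xi_i\xi_j}$ for $i\ne j$. For $\tau\in\mathbb{T}$, $C_\tau$ is the Cayley transform $C_\tau(\lambda)=i\,\frac{\tau+\lambda}{\tau-\lambda}$, which maps $\mathbb{D}$ to $\Pi$ and $\mathbb{T}$ to $\mathbb{R}\cup\{\infty\}$. Augmentation: for $g\in\mathcal{P}$ meromorphic at $x\in\mathbb{R}$, $a_0\in\mathbb{R}\cup\{\infty\}$ and $a_1>0$, the augmentation of $g$ at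 $x$ by $a_0,a_1$ is the function $f$ on $\Pi$ given by $$\frac{1}{f(z)-a_0}=\frac{1}{a_1(z-x)}-g(z)\ \text{ if } a_0\in\mathbb{R},\qquad f(z)=g(z)-\frac{1}{a_1(z-x)}\ \text{ if } a_0=\infty .$$ *)

(* Defs.v *)
From Stdlib Require Import Reals Lra Lia.
From Coquelicot Require Export Coquelicot.
Open Scope R_scope.
Open Scope C_scope.

(** Functions on a domain [U] of the complex plane are total functions [C -> C]
    of which only the values on [U] matter.  Families indexed by [1..n] are
    functions on [nat] of which only the values at [1..n] matter.  The extended
    real line R u {oo} is [option R] and the Riemann sphere is [option C], with
    [None] as the point at infinity. *)

Definition unit_disc (z : C) : Prop := (Cmod z < 1)%R.
Definition unit_circle (z : C) : Prop := Cmod z = 1%R.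
Definition upper_half_plane (z : C) : Prop := (0 < Im z)%R.

(** [F] is the sum of a power series centred at [z0] on some disc about [z0]. *)
Definition analytic_at (F : C -> C) (z0 : C) : Prop :=
  exists (a : nat -> C) (r : R), (0 < r)%R /\
    forall z, (Cmod (z - z0) < r)%R -> is_pseries a (z - z0) (F z).

Definition analytic_on (U : C -> Prop) (f : C -> C) : Prop :=
  forall z, U z -> analytic_at f z.

Definition schur_class (phi : C -> C) : Prop :=
  analytic_on unit_disc phi /\ forall z, unit_disc z -> (Cmod (phi z) <= 1)%R.

Definition pick_class (f : C -> C) : Prop :=
  analytic_on upper_half_plane f /\
  forall z, upper_half_plane z -> (0 <= Im (f z))%R.

(** [F] extends [f : U -> C] analytically to a neighbourhood of [z0], typically
    a boundary point of [U]. *)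
Definition analytic_extension
    (U : C -> Prop) (f : C -> C) (z0 : C) (F : C -> C) : Prop :=
  analytic_at F z0 /\
  exists r : R, (0 < r)%R /\
    forall z, U z -> (Cmod (z - z0) < r)%R -> F z = f z.

(** A meromorphic extension, on a small enough neighbourhood, has no pole other
    than [z0], so it is analytic there up to a power of [z - z0]. *)
Definition meromorphic_at (U : C -> Prop) (f : C -> C) (z0 : C) : Prop :=
  exists (m : nat) (G : C -> C),
    analytic_extension U (fun z => (z - z0) ^ m * f z) z0 G.

(** [v] is the value at [z0] of the meromorphic extension of [f : U -> C];
    [None] is the value at a pole. *)
Definition has_value_at
    (U : C -> Prop) (f : C -> C) (z0 : C) (v : option C) : Prop :=
  match v with
  | Some w => exists F, analytic_extension U f z0 F /\ F z0 = w
  | None => exists (m : nat) (G : C -> C), (1 <= m)%nat /\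
      analytic_extension U (fun z => (z - z0) ^ m * f z) z0 G /\
      G z0 <> 0
  end.

(** The rate of change of the argument of [phi] along the unit circle. *)
Definition phasar_derivative (phi : C -> C) (xi : C) : R :=
  Re (xi * C_derive phi xi / phi xi).

Definition boundary_NP_solution
    (n : nat) (xi eta : nat -> C) (rho : nat -> R) (phi : C -> C) : Prop :=
  schur_class phi /\
  forall j, (1 <= j <= n)%nat ->
    exists F, analytic_extension unit_disc phi (xi j) F /\
      F (xi j) = eta j /\ phasar_derivative F (xi j) = rho j.

Definition pick_matrix (xi eta : nat -> C) (rho : nat -> R) (i j : nat) : C :=
  if Nat.eqb i j then RtoC (rho j)
  else (1 - Cconj (eta i) * eta j) / (1 - Cconj (xi i) * xi j).

Definition positive_definite (n : nat) (m : nat -> nat -> C) : Prop :=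
  (forall i j, (1 <= i <= n)%nat -> (1 <= j <= n)%nat ->
     m j i = Cconj (m i j)) /\
  forall c : nat -> C, (exists i, (1 <= i <= n)%nat /\ c i <> 0) ->
    (0 < Re (sum_n_m (fun i =>
               sum_n_m (fun j => (Cconj (c i) * m i j * c j)%C) 1 n) 1 n))%R.

Definition cayley (tau z : C) : C := Ci * (tau + z) / (tau - z).

Definition cayley_inv (sigma w : C) : C := sigma * (w - Ci) / (w + Ci).

Lemma Ci_neq_0 : Ci <> 0.
Proof. intros H; injection H; lra. Qed.

Lemma cayley_invK (sigma w : C) :
  sigma <> 0 -> w + Ci <> 0 -> cayley sigma (cayley_inv sigma w) = w.
Proof.
intros Hs Hw; unfold cayley, cayley_inv.
assert (H2 : (2 : C) <> 0) by (intros H; injection H; lra).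
pose proof Ci_neq_0 as Hi.
replace (sigma + sigma * (w - Ci) / (w + Ci))
  with (2 * sigma * w / (w + Ci)) by (field; exact Hw).
replace (sigma - sigma * (w - Ci) / (w + Ci))
  with (2 * sigma * Ci / (w + Ci)) by (field; exact Hw).
field; auto.
Qed.

Lemma cayleyK (sigma z : C) :
  sigma <> 0 -> z <> sigma -> cayley_inv sigma (cayley sigma z) = z.
Proof.
intros Hs Hz; unfold cayley, cayley_inv.
assert (H2 : (2 : C) <> 0) by (intros H; injection H; lra).
pose proof Ci_neq_0 as Hi.
assert (Hd : sigma - z <> 0).
{ intros H; apply Hz; replace z with (sigma - (sigma - z)) by ring.
  rewrite H; ring. }
replace (Ci * (sigma + z) / (sigma - z) - Ci)
  with (2 * Ci * z / (sigma - z)) by (field; exact Hd).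
replace (Ci * (sigma + z) / (sigma - z) + Ci)
  with (2 * Ci * sigma / (sigma - z)) by (field; exact Hd).
field; auto.
Qed.

(** [f] is the augmentation of [g] at the real point [x] by [a0, a1]. *)
Definition is_augmentation
    (g : C -> C) (x : C) (a0 : option R) (a1 : R) (f : C -> C) : Prop :=
  pick_class g /\ Im x = 0%R /\ meromorphic_at upper_half_plane g x /\
  (0 < a1)%R /\
  forall z, upper_half_plane z ->
    match a0 with
    | Some a => f z <> RtoC a /\
                1 / (f z - RtoC a) = 1 / (RtoC a1 * (z - x)) - g z
    | None => f z = g z - 1 / (RtoC a1 * (z - x))
    end.

(* Main.v *)
(** Cayley transforms carry the problem to the upper half-plane, where the data
    become real nodes, values in the projective real line and positive slopes.
    After a real Moebius map the value at the first node is infinity, and Julia's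
    lemma says that the pole there can be removed without leaving the Pick class;
    the removal is exactly the inverse of an augmentation.  It turns the
    interpolation conditions at the remaining nodes into conditions of the same
    kind whose Pick matrix is a Schur complement of the old one, hence still
    positive definite, while the condition at the removed node becomes the
    requirement that the reduced function have no pole there.  Further steps act on
    values at that node by real Moebius maps, so in the end this requirement
    reads [f_{n+1}(x_j) <> y_j]. *)

Require Import Defs.
From Stdlib Require Import Reals Lra Lia Classical ClassicalEpsilon Wf_nat.
From Coquelicot Require Import Coquelicot.
Open Scope R_scope.
Open Scope C_scope.

(** * Series and power series *)

(** Nothing is known about a Pick function on the real line away from the nodes, so no maximum
    principle up to the boundary applies directly. Once a pole is cancelled, what remains is a lower
    bound: the imaginary part is at least minus a Poisson kernel concentrated at the node. That
    kernel tends to zero at every other boundary point and at infinity, and at the node the function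
    has become analytic; this suffices for an interior-minimum argument on a large rectangle. Values
    may become infinite at any stage, so a germ is a pair (P, Q) without common zero, its value a
    homogeneous vector and its slope a Wronskian. Unimodular maps preserve the Wronskian, adding a
    function s changes it by q^2 s', and poles need no separate treatment. Positivity of the Pick
    matrix enters through its pivots: the pivot of each Schur complement is the slope at the next
    node, and its sign makes t_k positive. The parameters s_k, t_k, y_j are computed from the data
    alone, so one choice serves all solutions. Analyticity means a local power series, so zeros,
    quotients and derivatives are read off coefficients; no contour integral occurs. *)

Definition csum (a : nat -> C) (n : nat) : C := sum_n a n.
Definition rsum (a : nat -> R) (n : nat) : R := sum_n a n.
Definition cseries (a : nat -> C) (l : C) : Prop :=
  @is_series C_AbsRing C_NormedModule a l.

Definition clim (u : nat -> C) (l : C) : Prop :=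
  forall eps : R, (0 < eps)%R ->
    exists N, forall n, (N <= n)%nat -> (Cmod (u n - l) < eps)%R.

Lemma cseries_clim (a : nat -> C) (l : C) : cseries a l <-> clim (csum a) l.
Proof.
pose proof (@filterlim_locally_ball_norm C_AbsRing nat C_NormedModule eventually _
  (csum a) l) as E.
split.
- intros H eps He.
  destruct (proj1 E H (mkposreal eps He)) as [N HN].
  exists N; intros n Hn; exact (HN n Hn).
- intros H; apply E; intros eps.
  destruct (H eps (cond_pos eps)) as [N HN].
  exists N; intros n Hn; exact (HN n Hn).
Qed.

Lemma csum_0 (a : nat -> C) : csum a 0 = a 0%nat.
Proof. apply sum_O. Qed.

Lemma csum_S (a : nat -> C) (n : nat) : csum a (S n) = csum a n + a (S n).
Proof. apply (sum_Sn (G := C_AbelianMonoid)). Qed.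

Lemma rsum_0 (a : nat -> R) : rsum a 0 = a 0%nat.
Proof. apply sum_O. Qed.

Lemma rsum_S (a : nat -> R) (n : nat) : rsum a (S n) = (rsum a n + a (S n))%R.
Proof. apply (sum_Sn (G := R_AbelianMonoid)). Qed.

Lemma rsum_le (a b : nat -> R) (n : nat) :
  (forall k, (k <= n)%nat -> (a k <= b k)%R) -> (rsum a n <= rsum b n)%R.
Proof.
induction n as [|n IH]; intros H.
- rewrite !rsum_0; auto.
- rewrite !rsum_S; apply Rplus_le_compat; auto.
Qed.

Lemma rsum_scal (c : R) (a : nat -> R) (n : nat) :
  rsum (fun k => (c * a k)%R) n = (c * rsum a n)%R.
Proof.
induction n as [|n IH]; [rewrite !rsum_0 | rewrite !rsum_S, IH]; ring.
Qed.

Lemma Cmod_csum (a : nat -> C) (n : nat) :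
  (Cmod (csum a n) <= rsum (fun k => Cmod (a k)) n)%R.
Proof.
induction n as [|n IH].
- rewrite csum_0, rsum_0; apply Rle_refl.
- rewrite csum_S, rsum_S; eapply Rle_trans; [apply Cmod_triangle|]; lra.
Qed.

Lemma clim_unique (u : nat -> C) (l m : C) : clim u l -> clim u m -> l = m.
Proof.
intros Hl Hm; apply NNPP; intros Hne.
assert (Hd : (0 < Cmod (l - m))%R).
{ apply Cmod_gt_0; intros E; apply Hne.
  replace l with (l - m + m) by ring; rewrite E; ring. }
destruct (Hl (Cmod (l - m) / 2)%R ltac:(lra)) as [N HN].
destruct (Hm (Cmod (l - m) / 2)%R ltac:(lra)) as [N' HN'].
specialize (HN (N + N')%nat ltac:(lia)); specialize (HN' (N + N')%nat ltac:(lia)).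
pose proof (Cmod_triangle (- (u (N + N')%nat - l)) (u (N + N')%nat - m)) as H.
rewrite Cmod_opp in H.
replace (- (u (N + N')%nat - l) + (u (N + N')%nat - m)) with (l - m) in H by ring.
lra.
Qed.

Lemma clim_ext (u v : nat -> C) (l : C) :
  (forall n, u n = v n) -> clim u l -> clim v l.
Proof.
intros E H eps He; destruct (H eps He) as [N HN]; exists N; intros n Hn.
rewrite <- E; auto.
Qed.

Lemma clim_plus (u v : nat -> C) (l m : C) :
  clim u l -> clim v m -> clim (fun n => u n + v n) (l + m).
Proof.
intros Hu Hv eps He.
destruct (Hu (eps / 2)%R ltac:(lra)) as [N HN].
destruct (Hv (eps / 2)%R ltac:(lra)) as [N' HN'].
exists (N + N')%nat; intros n Hn.
specialize (HN n ltac:(lia)); specialize (HN' n ltac:(lia)).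
replace (u n + v n - (l + m)) with ((u n - l) + (v n - m)) by ring.
eapply Rle_lt_trans; [apply Cmod_triangle|]; lra.
Qed.

Lemma cseries_ext (a b : nat -> C) (l : C) :
  (forall n, a n = b n) -> cseries a l -> cseries b l.
Proof. exact (@is_series_ext C_AbsRing C_NormedModule a b l). Qed.

Lemma cseries_plus (a b : nat -> C) (l m : C) :
  cseries a l -> cseries b m -> cseries (fun n => a n + b n) (l + m).
Proof. intros Ha Hb; exact (is_series_plus _ _ _ _ Ha Hb). Qed.

Lemma cseries_scal (c : C) (a : nat -> C) (l : C) :
  cseries a l -> cseries (fun n => c * a n) (c * l).
Proof. intros Ha; exact (is_series_scal c _ _ Ha). Qed.

Lemma cseries_unique (a : nat -> C) (l m : C) : cseries a l -> cseries a m -> l = m.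
Proof. rewrite !cseries_clim; apply clim_unique. Qed.

Lemma cseries_zero_tail (N : nat) (a : nat -> C) (l : C) :
  (forall n, (N < n)%nat -> a n = 0) -> csum a N = l -> cseries a l.
Proof.
intros Ha <-; apply cseries_clim; intros eps He; exists N; intros n Hn.
assert (E : csum a n = csum a N).
{ induction Hn as [|m Hm IH]; [reflexivity|].
  rewrite csum_S, IH, Ha by lia; ring. }
rewrite E; replace (csum a N - csum a N) with (RtoC 0) by ring.
rewrite Cmod_0; exact He.
Qed.

Lemma cseries_le (a : nat -> C) (l : C) (M : R) :
  cseries a l -> (forall n, (rsum (fun k => Cmod (a k)) n <= M)%R) -> (Cmod l <= M)%R.
Proof.
intros Hl HM; apply Rnot_lt_le; intros Hlt.
destruct (proj1 (cseries_clim _ _) Hl (Cmod l - M)%R ltac:(lra)) as [N HN].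
specialize (HN N ltac:(lia)).
pose proof (Cmod_triangle (- (csum a N - l)) (csum a N)) as H.
replace (- (csum a N - l) + csum a N) with l in H by ring.
rewrite Cmod_opp in H.
pose proof (Cmod_csum a N); specialize (HM N); lra.
Qed.

Lemma ex_series_bounded (S : nat -> R) (T : R) :
  (forall n, (0 <= S n)%R) -> (forall n, (rsum S n <= T)%R) -> ex_series S.
Proof.
intros H0 HT.
destruct (ex_finite_lim_seq_incr (rsum S) T) as [l Hl]; auto.
- intros n; rewrite rsum_S; specialize (H0 (Datatypes.S n)); lra.
- exists l; exact Hl.
Qed.

Lemma ex_cseries_abs (a : nat -> C) (M : R) :
  (forall n, (rsum (fun k => Cmod (a k)) n <= M)%R) -> exists l, cseries a l.
Proof.
intros HM.
destruct (@ex_series_le C_AbsRing C_CompleteNormedModule a (fun k => Cmod (a k))) as [l Hl].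
- intros n; apply Rle_refl.
- apply ex_series_bounded with M; [intros n; apply Cmod_ge_0 | exact HM].
- exists l; exact Hl.
Qed.

(** Dominated convergence for series (Tannery): a Cauchy tail of [S] bounds the terms past [N]
    uniformly in [K], and only a finite sum of null sequences is left. *)
Lemma cseries_tannery (u : nat -> nat -> C) (S : nat -> R) (l : nat -> C) :
  ex_series S -> (forall K n, (Cmod (u K n) <= S n)%R) ->
  (forall n, clim (fun K => u K n) 0) ->
  (forall K, cseries (u K) (l K)) -> clim l 0.
Proof.
intros HS Hu Hlim Hl eps He.
destruct (Cauchy_ex_series (K := R_AbsRing) (V := R_CompleteNormedModule) S HS
  (mkposreal (eps / 4)%R ltac:(lra))) as [N HN]; simpl in HN.
assert (Hfin : clim (fun K => csum (u K) N) 0).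
{ clear HN; induction N as [|N IH].
  - apply clim_ext with (fun K => u K 0%nat); [|apply Hlim].
    intros K; rewrite csum_0; reflexivity.
  - apply clim_ext with (fun K => csum (u K) N + u K (Datatypes.S N)).
    { intros K; rewrite csum_S; reflexivity. }
    replace (RtoC 0) with (RtoC 0 + RtoC 0) by ring.
    apply clim_plus; auto. }
destruct (Hfin (eps / 4)%R ltac:(lra)) as [K0 HK0].
exists K0; intros K HK; specialize (HK0 K HK).
destruct (proj1 (cseries_clim _ _) (Hl K) (eps / 4)%R ltac:(lra)) as [m Hm].
specialize (Hm (Datatypes.S N + m)%nat ltac:(lia)).
assert (Htail : forall p, (Cmod (csum (u K) (Datatypes.S N + p) - csum (u K) N)
    <= sum_n_m S (Datatypes.S N) (Datatypes.S N + p))%R).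
{ induction p as [|p IH].
  - replace (Datatypes.S N + 0)%nat with (Datatypes.S N) by lia.
    rewrite csum_S, sum_n_n.
    replace (csum (u K) N + u K (Datatypes.S N) - csum (u K) N)
      with (u K (Datatypes.S N)) by ring; apply Hu.
  - rewrite Nat.add_succ_r, csum_S, sum_n_Sm by lia.
    replace (csum (u K) (Datatypes.S N + p) + u K (Datatypes.S (Datatypes.S N + p)) - csum (u K) N)
      with ((csum (u K) (Datatypes.S N + p) - csum (u K) N) + u K (Datatypes.S (Datatypes.S N + p)))
      by ring.
    eapply Rle_trans; [apply Cmod_triangle|].
    unfold plus; simpl; apply Rplus_le_compat; [exact IH | apply Hu]. }
specialize (Htail m).
assert (HC := HN (Datatypes.S N) (Datatypes.S N + m)%nat ltac:(lia) ltac:(lia)).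
set (p := (Datatypes.S N + m)%nat) in *.
apply Rabs_def2 in HC; destruct HC as [HC _].
replace (l K - 0) with (- (csum (u K) p - l K) + (csum (u K) p - csum (u K) N) + (csum (u K) N - 0))
  by ring.
eapply Rle_lt_trans; [apply Cmod_triangle|].
eapply Rle_lt_trans; [apply Rplus_le_compat_r, Cmod_triangle|].
pose proof (Rle_lt_trans _ _ _ Htail HC); rewrite Cmod_opp; lra.
Qed.

(** Interchange of summation for rows [b n] of norm at most [S n]. Both the Cauchy product and the
    substitution of one power series into another reduce to it. *)
Lemma double_series (b : nat -> nat -> C) (S : nat -> R) (T : R) (A B : nat -> C) :
  (forall n K, (rsum (fun k => Cmod (b n k)) K <= S n)%R) ->
  (forall N, (rsum S N <= T)%R) ->
  (forall n, cseries (b n) (A n)) ->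
  (forall k, cseries (fun n => b n k) (B k)) ->
  exists l, cseries A l /\ cseries B l.
Proof.
intros HS HT HA HB.
assert (HAS : forall n, (Cmod (A n) <= S n)%R).
{ intros n; apply cseries_le with (b n); auto. }
assert (S0 : forall n, (0 <= S n)%R).
{ intros n; eapply Rle_trans; [apply Cmod_ge_0 | apply HAS]. }
assert (exS : ex_series S) by (apply ex_series_bounded with T; auto).
destruct (ex_cseries_abs A T) as [l Hl].
{ intros n; eapply Rle_trans; [|apply (HT n)]; apply rsum_le; auto. }
exists l; split; [exact Hl|].
assert (Hcol : forall K, cseries (fun n => csum (b n) K) (csum B K)).
{ induction K as [|K IH].
  - rewrite csum_0; eapply cseries_ext; [|apply (HB 0%nat)].
    intros n; rewrite csum_0; reflexivity.
  - rewrite csum_S.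
    eapply cseries_ext; [|apply (cseries_plus _ _ _ _ IH (HB (Datatypes.S K)))].
    intros n; cbv beta; rewrite csum_S; reflexivity. }
(* The remainders of the rows after the index [K] tend to zero row by row and are dominated by
   [2 * S n]. *)
assert (G : clim (fun K => l + (- (1)) * csum B K) 0).
{ apply cseries_tannery with
    (u := fun K n => A n + (- (1)) * csum (b n) K) (S := fun n => (2 * S n)%R).
  - destruct exS as [T' HT']; exists (2 * T')%R.
    apply (is_series_scal (K := R_AbsRing) (V := R_NormedModule) 2%R S T' HT').
  - intros K n.
    eapply Rle_trans; [apply Cmod_triangle|]; rewrite Cmod_mult, Cmod_m1.
    pose proof (Cmod_csum (b n) K) as H; specialize (HS n K); specialize (HAS n); lra.
  - intros n eps He.
    destruct (proj1 (cseries_clim _ _) (HA n) eps He) as [N HN].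
    exists N; intros K HK; specialize (HN K HK).
    rewrite <- Cmod_opp.
    replace (- (A n + - (1) * csum (b n) K - 0)) with (csum (b n) K - A n) by ring; exact HN.
  - intros K; apply (cseries_plus _ _ _ _ Hl (cseries_scal _ _ _ (Hcol K))). }
apply cseries_clim; intros eps He.
destruct (G eps He) as [N HN].
exists N; intros K HK; specialize (HN K HK).
rewrite <- Cmod_opp.
replace (- (csum B K - l)) with (l + - (1) * csum B K - 0) by ring; exact HN.
Qed.
(** [a] is the sequence of Taylor coefficients of [F] at [0], with weighted l^1
    norm at most [M] on the disc of radius [r].  These norms are submultiplicative,
    which is what makes products and compositions converge. *)
Definition psn (r M : R) (a : nat -> C) (F : C -> C) : Prop :=
  (forall n, (rsum (fun k => (Cmod (a k) * r ^ k)%R) n <= M)%R) /\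
  forall h, (Cmod h <= r)%R -> cseries (fun k => a k * h ^ k) (F h).

Definition conv (a b : nat -> C) (k : nat) : C :=
  csum (fun i => a i * b (k - i)%nat) k.

Fixpoint conv_pow (a : nat -> C) (n : nat) : nat -> C :=
  match n with
  | 0%nat => fun k => if Nat.eqb k 0 then 1 else 0
  | S m => conv a (conv_pow a m)
  end.

(** * Products, powers and composition of power series *)

Lemma rsum_ext (a b : nat -> R) (n : nat) :
  (forall k, (k <= n)%nat -> a k = b k) -> rsum a n = rsum b n.
Proof.
intros H; apply Rle_antisym; apply rsum_le; intros k Hk; rewrite (H k Hk); apply Rle_refl.
Qed.

Lemma rsum_plus (a b : nat -> R) (n : nat) :
  rsum (fun k => (a k + b k)%R) n = (rsum a n + rsum b n)%R.
Proof. induction n as [|n IH]; [rewrite !rsum_0 | rewrite !rsum_S, IH]; ring. Qed.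

Lemma rsum_nonneg (a : nat -> R) (n : nat) :
  (forall k, (0 <= a k)%R) -> (0 <= rsum a n)%R.
Proof.
intros H; induction n as [|n IH]; [rewrite rsum_0; auto | rewrite rsum_S].
specialize (H (S n)); lra.
Qed.

Lemma csum_scal_r (c : C) (a : nat -> C) (n : nat) :
  csum (fun k => a k * c) n = csum a n * c.
Proof. induction n as [|n IH]; [rewrite !csum_0 | rewrite !csum_S, IH]; ring. Qed.

Lemma csum_ext (a b : nat -> C) (n : nat) :
  (forall k, (k <= n)%nat -> a k = b k) -> csum a n = csum b n.
Proof.
induction n as [|n IH]; intros H; [rewrite !csum_0; auto|].
rewrite !csum_S, IH, H; auto.
Qed.

Lemma rsum_conv (x y : nat -> R) (n : nat) :
  rsum (fun k => rsum (fun i => (x i * y (k - i)%nat)%R) k) n =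
  rsum (fun i => (x i * rsum y (n - i))%R) n.
Proof.
induction n as [|n IH].
- rewrite !rsum_0; simpl; rewrite ?rsum_0; ring.
- rewrite (rsum_S (fun k => rsum _ k)), IH, !rsum_S, Nat.sub_diag, rsum_0.
  rewrite (rsum_ext (fun i => (x i * rsum y (S n - i))%R)
    (fun i => (x i * rsum y (n - i) + x i * y (S n - i)%nat)%R)), rsum_plus; [ring|].
  intros i Hi; rewrite Nat.sub_succ_l, rsum_S by lia; ring.
Qed.

Lemma cseries_shift (c : nat -> C) (l : C) (n : nat) :
  cseries c l -> cseries (fun k => if Nat.leb n k then c (k - n)%nat else 0) l.
Proof.
intros H; induction n as [|n IH].
- eapply cseries_ext; [|exact H]; intros k; simpl; rewrite Nat.sub_0_r; reflexivity.
- apply (is_series_decr_1 (V := C_NormedModule)).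
  replace (plus (l : C_NormedModule) (opp _)) with l
    by (unfold plus, opp; simpl; ring).
  exact IH.
Qed.

Lemma psn_nonneg (r M : R) (a : nat -> C) (F : C -> C) : psn r M a F -> (0 <= M)%R.
Proof.
intros [H _]; specialize (H 0%nat); rewrite rsum_0 in H.
pose proof (Cmod_ge_0 (a 0%nat)); simpl in H; lra.
Qed.

Lemma Cmod_conv_le (r : R) (a b : nat -> C) (k : nat) : (0 <= r)%R ->
  (Cmod (conv a b k) * r ^ k <=
   rsum (fun i => (Cmod (a i) * r ^ i) * (Cmod (b (k - i)%nat) * r ^ (k - i)))%R k)%R.
Proof.
intros Hr.
eapply Rle_trans; [apply Rmult_le_compat_r; [apply pow_le, Hr | apply Cmod_csum]|].
rewrite Rmult_comm, <- rsum_scal; apply rsum_le; intros i Hi.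
rewrite Cmod_mult; apply Req_le.
replace k with (i + (k - i))%nat at 1 by lia; rewrite pow_add; ring.
Qed.

Lemma psn_mult (r M N : R) (a b : nat -> C) (F G : C -> C) : (0 <= r)%R ->
  psn r M a F -> psn r N b G -> psn r (M * N) (conv a b) (fun h => F h * G h).
Proof.
intros Hr Ha Hb.
pose proof (psn_nonneg _ _ _ _ Hb) as HN0.
destruct Ha as [HM HF], Hb as [HN HG].
assert (x0 : forall (c : nat -> C) k, (0 <= Cmod (c k) * r ^ k)%R).
{ intros c k; apply Rmult_le_pos; [apply Cmod_ge_0 | apply pow_le, Hr]. }
split.
- intros n.
  eapply Rle_trans; [apply rsum_le; intros k _; apply Cmod_conv_le, Hr|].
  rewrite (rsum_conv (fun i => Cmod (a i) * r ^ i)%R (fun i => Cmod (b i) * r ^ i)%R).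
  eapply Rle_trans; [apply rsum_le; intros i _;
    apply Rmult_le_compat_l; [apply x0 | apply HN]|].
  rewrite (rsum_ext _ (fun i => N * (Cmod (a i) * r ^ i))%R) by (intros; ring).
  rewrite rsum_scal, Rmult_comm; apply Rmult_le_compat_r; auto.
- intros h Hh.
  (* Row [n] is a_n h^n times the series of [G] moved [n] places to the right, so that column [k] is
     a finite sum, the k-th term of the Cauchy product. *)
  destruct (double_series
    (fun n k => if Nat.leb n k then a n * h ^ n * (b (k - n)%nat * h ^ (k - n)) else 0)
    (fun n => N * (Cmod (a n) * r ^ n))%R (N * M)
    (fun n => a n * h ^ n * G h) (fun k => conv a b k * h ^ k)) as [l [HA HB]].
  + intros n K.
    assert (Hn : (Cmod (a n * h ^ n) <= Cmod (a n) * r ^ n)%R).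
    { rewrite Cmod_mult, Cmod_pow; apply Rmult_le_compat_l; [apply Cmod_ge_0|].
      apply pow_incr; split; [apply Cmod_ge_0 | exact Hh]. }
    apply Rle_trans with (rsum (fun k => (Cmod (a n) * r ^ n) *
      (if Nat.leb n k then Cmod (b (k - n)%nat) * r ^ (k - n) else 0))%R K).
    * apply rsum_le; intros k _; destruct (Nat.leb n k).
      -- rewrite Cmod_mult; apply Rmult_le_compat; try apply Cmod_ge_0; auto.
         rewrite Cmod_mult, Cmod_pow; apply Rmult_le_compat_l; [apply Cmod_ge_0|].
         apply pow_incr; split; [apply Cmod_ge_0 | exact Hh].
      -- rewrite Cmod_0; lra.
    * rewrite rsum_scal, Rmult_comm; apply Rmult_le_compat_r; [apply x0|].
      destruct (Nat.le_gt_cases n K) as [HnK|HnK].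
      -- eapply Rle_trans; [|apply (HN (K - n)%nat)]; apply Req_le.
         assert (E : forall m, rsum (fun k => if Nat.leb n k
            then (Cmod (b (k - n)%nat) * r ^ (k - n))%R else 0%R) (n + m)%nat =
            rsum (fun k => (Cmod (b k) * r ^ k)%R) m).
         { induction m as [|m IH].
           - rewrite Nat.add_0_r, rsum_0. destruct n as [|n].
             + rewrite rsum_0; reflexivity.
             + rewrite rsum_S, Nat.leb_refl, Nat.sub_diag.
               rewrite (rsum_ext _ (fun _ => 0 * 0)%R), rsum_scal; [ring|].
               intros k Hk; destruct (Nat.leb_spec (S n) k); [lia|ring].
           - rewrite Nat.add_succ_r, !rsum_S, IH.
             destruct (Nat.leb_spec n (S (n + m))); [|lia].
             replace (S (n + m) - n)%nat with (S m) by lia; reflexivity. }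
         replace K with (n + (K - n))%nat at 1 by lia; apply E.
      -- rewrite (rsum_ext _ (fun _ => 0 * 0)%R), rsum_scal; [lra|].
         intros k Hk; destruct (Nat.leb_spec n k); [lia|ring].
  + intros n; rewrite rsum_scal; apply Rmult_le_compat_l; auto.
  + intros n; apply (cseries_shift (fun k => a n * h ^ n * (b k * h ^ k))).
    apply (cseries_scal (a n * h ^ n)), HG, Hh.
  + intros k.
    apply (cseries_zero_tail k).
    * intros n Hn; destruct (Nat.leb_spec n k); [lia|reflexivity].
    * unfold conv; rewrite <- csum_scal_r; apply csum_ext; intros n Hn.
      destruct (Nat.leb_spec n k); [|lia].
      assert (E : h ^ k = h ^ n * h ^ (k - n))
        by (rewrite <- Cpow_add_r; f_equal; lia).
      rewrite E; ring.
  + replace (F h * G h) with l; [exact HB|].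
    apply (cseries_unique _ _ _ HA).
    rewrite Cmult_comm.
    eapply cseries_ext; [|apply (cseries_scal (G h)), (HF h Hh)].
    intros n; cbv beta; ring.
Qed.

Lemma psn_const (r : R) (c : C) :
  psn r (Cmod c) (fun k => if Nat.eqb k 0 then c else 0) (fun _ => c).
Proof.
split.
- intros n; induction n as [|n IH].
  + rewrite rsum_0; simpl; lra.
  + rewrite rsum_S; simpl Nat.eqb; cbv iota; rewrite Cmod_0; lra.
- intros h _.
  apply (cseries_zero_tail 0); [|rewrite csum_0; simpl; ring].
  intros n Hn; destruct n; [lia|]; simpl Nat.eqb; cbv iota; ring.
Qed.

Lemma psn_id (r : R) : (0 <= r)%R ->
  psn r r (fun k => if Nat.eqb k 1 then 1 else 0) (fun h => h).
Proof.
intros Hr; split.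
- intros n.
  assert (E : forall n, rsum (fun k => Cmod (if Nat.eqb k 1 then 1 else 0) * r ^ k)%R (S n) = r).
  { intros m; induction m as [|m IH].
    - rewrite rsum_S, rsum_0; simpl; rewrite Cmod_0, Cmod_1; ring.
    - rewrite rsum_S, IH; simpl Nat.eqb; cbv iota; rewrite Cmod_0; ring. }
  destruct n; [rewrite rsum_0; simpl; rewrite Cmod_0; lra | rewrite E; lra].
- intros h _.
  apply (cseries_zero_tail 1); [|rewrite csum_S, csum_0; simpl; ring].
  intros n Hn.
  destruct (Nat.eqb_spec n 1); [lia|ring].
Qed.

Lemma psn_plus (r M N : R) (a b : nat -> C) (F G : C -> C) : (0 <= r)%R ->
  psn r M a F -> psn r N b G ->
  psn r (M + N) (fun k => a k + b k) (fun h => F h + G h).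
Proof.
intros Hr [HM HF] [HN HG]; split.
- intros n; apply Rle_trans with
    (rsum (fun k => Cmod (a k) * r ^ k + Cmod (b k) * r ^ k)%R n).
  + apply rsum_le; intros k _; rewrite <- Rmult_plus_distr_r.
    apply Rmult_le_compat_r; [apply pow_le, Hr | apply Cmod_triangle].
  + rewrite rsum_plus; apply Rplus_le_compat; auto.
- intros h Hh; eapply cseries_ext; [|apply (cseries_plus _ _ _ _ (HF h Hh) (HG h Hh))].
  intros k; cbv beta; ring.
Qed.

Lemma psn_pow (r M : R) (a : nat -> C) (F : C -> C) (n : nat) : (0 <= r)%R ->
  psn r M a F -> psn r (M ^ n) (conv_pow a n) (fun h => F h ^ n).
Proof.
intros Hr H; induction n as [|n IH]; simpl.
- pose proof (psn_const r 1) as H1; rewrite Cmod_1 in H1; exact H1.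
- apply psn_mult; auto.
Qed.

Lemma psn_bound (r M : R) (a : nat -> C) (F : C -> C) (h : C) : (0 <= r)%R ->
  psn r M a F -> (Cmod h <= r)%R -> (Cmod (F h) <= M)%R.
Proof.
intros Hr [HM HF] Hh; apply cseries_le with (1 := HF h Hh); intros n.
eapply Rle_trans; [|apply (HM n)]; apply rsum_le; intros k _.
rewrite Cmod_mult, Cmod_pow; apply Rmult_le_compat_l; [apply Cmod_ge_0|].
apply pow_incr; split; [apply Cmod_ge_0 | exact Hh].
Qed.

(** By submultiplicativity the series of a_n w^n has norm at most |a_n| M'^n, which is summable
    because [M' <= rho]; interchanging the sums collects the powers of [h]. Only the existence of
    the coefficients [c] matters. *)
Lemma psn_comp (rho r M M' : R) (a u : nat -> C) (F w : C -> C) :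
  (0 < r)%R -> (M' <= rho)%R -> psn rho M a F -> psn r M' u w ->
  exists c, forall h, (Cmod h <= r)%R -> cseries (fun k => c k * h ^ k) (F (w h)).
Proof.
intros Hr HMr HF Hw.
pose proof (psn_nonneg _ _ _ _ Hw) as HM'0.
pose proof (fun n => psn_pow r M' u w n ltac:(lra) Hw) as Hp.
assert (Ha : forall n, (rsum (fun n => Cmod (a n) * M' ^ n)%R n <= M)%R).
{ intros n; eapply Rle_trans; [|apply (proj1 HF n)]; apply rsum_le; intros k _.
  apply Rmult_le_compat_l; [apply Cmod_ge_0 | apply pow_incr; lra]. }
assert (Hterm : forall n k, (Cmod (conv_pow u n k) * r ^ k <= M' ^ n)%R).
{ intros n k; eapply Rle_trans; [|apply (proj1 (Hp n) k)].
  destruct k; [rewrite rsum_0; apply Rle_refl|].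
  rewrite rsum_S.
  assert (0 <= rsum (fun k => Cmod (conv_pow u n k) * r ^ k)%R k)%R; [|lra].
  apply rsum_nonneg; intros j; apply Rmult_le_pos; [apply Cmod_ge_0 | apply pow_le; lra]. }
assert (Hex : forall k, exists l, cseries (fun n => a n * conv_pow u n k) l).
{ intros k; apply ex_cseries_abs with (M / r ^ k)%R; intros n.
  assert (Hrk : (0 < r ^ k)%R) by (apply pow_lt, Hr).
  apply Rmult_le_reg_r with (r ^ k)%R; [exact Hrk|].
  unfold Rdiv; rewrite Rmult_assoc, Rinv_l, Rmult_1_r, Rmult_comm by lra.
  rewrite <- rsum_scal; eapply Rle_trans; [|apply (Ha n)].
  apply rsum_le; intros j _; rewrite Cmod_mult.
  replace (r ^ k * (Cmod (a j) * Cmod (conv_pow u j k)))%R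
    with (Cmod (a j) * (Cmod (conv_pow u j k) * r ^ k))%R by ring.
  apply Rmult_le_compat_l; [apply Cmod_ge_0 | apply Hterm]. }
set (c := fun k => proj1_sig (constructive_indefinite_description _ (Hex k))).
assert (Hc : forall k, cseries (fun n => a n * conv_pow u n k) (c k)).
{ intros k; apply (proj2_sig (constructive_indefinite_description _ (Hex k))). }
clearbody c.
exists c; intros h Hh.
destruct (double_series
  (fun n k => a n * (conv_pow u n k * h ^ k))
  (fun n => Cmod (a n) * M' ^ n)%R M
  (fun n => a n * w h ^ n) (fun k => c k * h ^ k)) as [l [HA HB]].
- intros n K; eapply Rle_trans; [|apply Rmult_le_compat_l; [apply Cmod_ge_0 | apply (proj1 (Hp n) K)]].
  rewrite <- rsum_scal; apply rsum_le; intros k _.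
  rewrite !Cmod_mult, Cmod_pow.
  apply Rmult_le_compat_l; [apply Cmod_ge_0|]; apply Rmult_le_compat_l; [apply Cmod_ge_0|].
  apply pow_incr; split; [apply Cmod_ge_0 | exact Hh].
- exact Ha.
- intros n; apply cseries_scal, (proj2 (Hp n) h Hh).
- intros k; rewrite Cmult_comm.
  eapply cseries_ext; [|apply (cseries_scal (h ^ k)), (Hc k)]; intros n; cbv beta; ring.
- replace (F (w h)) with l; [exact HB|].
  apply (cseries_unique _ _ _ HA), (proj2 HF).
  apply Rle_trans with M'; [apply psn_bound with r u; auto; lra | exact HMr].
Qed.

Lemma psn_shrink (r r' M : R) (a : nat -> C) (F : C -> C) : (0 <= r' <= r)%R ->
  psn r M a F -> psn r' M a F.
Proof.
intros Hr [HM HF]; split.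
- intros n; eapply Rle_trans; [|apply (HM n)]; apply rsum_le; intros k _.
  apply Rmult_le_compat_l; [apply Cmod_ge_0 | apply pow_incr; lra].
- intros h Hh; apply HF; lra.
Qed.

(** Without a constant term every weight shrinks by t^k <= t, so the norm can be made as small as
    desired. This is how an inner function is brought inside the disc of convergence of the outer
    one. *)
Lemma psn_shrink0 (r t M : R) (a : nat -> C) (F : C -> C) :
  (0 < r)%R -> (0 <= t <= 1)%R -> a 0%nat = 0 ->
  psn r M a F -> psn (t * r) (t * M) a F.
Proof.
intros Hr Ht Ha [HM HF]; split.
- intros n; eapply Rle_trans; [|apply Rmult_le_compat_l; [lra | apply (HM n)]].
  rewrite <- rsum_scal; apply rsum_le; intros [|k] _.
  + rewrite Ha, Cmod_0; simpl; lra.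
  + rewrite Rpow_mult_distr.
    assert (t ^ S k <= t)%R.
    { simpl; rewrite <- Rmult_1_r; apply Rmult_le_compat_l; [lra|].
      rewrite <- (pow1 k); apply pow_incr; lra. }
    assert (0 <= Cmod (a (S k)) * r ^ S k)%R.
    { apply Rmult_le_pos; [apply Cmod_ge_0 | apply pow_le; lra]. }
    nra.
- intros h Hh; apply HF; nra.
Qed.
(** * Analytic functions *)

Lemma pow_n_Cpow (z : C) (k : nat) : @pow_n C_Ring z k = z ^ k.
Proof. induction k as [|k IH]; [reflexivity|]; simpl; rewrite IH; reflexivity. Qed.

Lemma is_pseries_cseries (a : nat -> C) (h l : C) :
  @is_pseries C_AbsRing C_NormedModule a h l <-> cseries (fun k => a k * h ^ k) l.
Proof.
assert (E : forall k, @pow_n C_Ring h k * a k = a k * h ^ k).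
{ intros k; rewrite pow_n_Cpow; ring. }
split; apply cseries_ext; intros k; [apply E | symmetry; apply E].
Qed.

Lemma cseries_terms_bounded (c : nat -> C) (l : C) :
  cseries c l -> exists M, forall n, (Cmod (c n) <= M)%R.
Proof.
intros H; destruct (proj1 (cseries_clim _ _) H 1%R ltac:(lra)) as [N HN].
exists (2 + rsum (fun k => Cmod (c k)) N)%R; intros n.
destruct (Nat.le_gt_cases n N) as [Hn|Hn].
- enough (Cmod (c n) <= rsum (fun k => Cmod (c k)) N)%R by lra.
  clear HN; induction Hn as [|m Hm IH].
  + destruct n; [rewrite rsum_0; lra | rewrite rsum_S].
    pose proof (rsum_nonneg (fun k => Cmod (c k)) n (fun k => Cmod_ge_0 _)); lra.
  + rewrite rsum_S; pose proof (Cmod_ge_0 (c (S m))).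
    assert (Cmod (c n) <= rsum (fun k => Cmod (c k)) m)%R; [apply IH|lra].
- destruct n as [|n]; [lia|].
  pose proof (HN n ltac:(lia)) as H1; pose proof (HN (S n) ltac:(lia)) as H2.
  pose proof (Cmod_triangle (csum c (S n) - l) (- (csum c n - l))) as H3.
  rewrite Cmod_opp in H3; rewrite csum_S in H2, H3.
  replace (csum c n + c (S n) - l + - (csum c n - l)) with (c (S n)) in H3 by ring.
  pose proof (rsum_nonneg (fun k => Cmod (c k)) N (fun k => Cmod_ge_0 _)); lra.
Qed.

Lemma rsum_half (n : nat) : (rsum (fun k => (1 / 2) ^ k)%R n <= 2)%R.
Proof.
assert (E : rsum (fun k => (1 / 2) ^ k)%R n = (2 - (1 / 2) ^ n)%R).
{ induction n as [|n IH]; [rewrite rsum_0 | rewrite rsum_S, IH]; simpl; field. }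
rewrite E; pose proof (pow_le (1 / 2) n ltac:(lra)); lra.
Qed.

Lemma analytic_psn (F : C -> C) (x : C) :
  analytic_at F x <->
  exists (r M : R) (a : nat -> C), (0 < r)%R /\ psn r M a (fun h => F (x + h)).
Proof.
split.
- intros (a & r & Hr & H).
  assert (Hd : forall h, (Cmod h < r)%R -> cseries (fun k => a k * h ^ k) (F (x + h))).
  { intros h Hh; apply (proj1 (is_pseries_cseries a h (F (x + h)))).
    replace h with (x + h - x) at 1 by ring; apply H.
    replace (x + h - x) with h by ring; exact Hh. }
  (* Terms bounded by [M] at radius [r / 2] are dominated by M / 2^k at radius [r / 4]; hence the
     norm bound [2 * M]. *)
  destruct (cseries_terms_bounded _ _ (Hd (RtoC (r / 2))
    ltac:(rewrite Cmod_R, Rabs_pos_eq; lra))) as [M HM].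
  exists (r / 4)%R, (2 * M)%R, a; split; [lra|]; split.
  + intros n.
    apply Rle_trans with (rsum (fun k => M * (1 / 2) ^ k)%R n).
    * apply rsum_le; intros k _.
      replace (r / 4)%R with ((r / 2) * (1 / 2))%R by field.
      rewrite Rpow_mult_distr, <- Rmult_assoc.
      apply Rmult_le_compat_r; [apply pow_le; lra|].
      specialize (HM k); rewrite Cmod_mult, Cmod_pow, Cmod_R, Rabs_pos_eq in HM; lra.
    * rewrite rsum_scal, Rmult_comm; apply Rmult_le_compat_r; [|apply rsum_half].
      eapply Rle_trans; [apply Cmod_ge_0 | apply (HM 0%nat)].
  + intros h Hh; apply Hd; lra.
- intros (r & M & a & Hr & H); exists a, r; split; [exact Hr|].
  intros z Hz; apply (proj2 (is_pseries_cseries _ _ _)).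
  replace (F z) with (F (x + (z - x))) by (f_equal; ring).
  apply (proj2 H); lra.
Qed.

Lemma analytic_ext (F G : C -> C) (x : C) (r : R) : (0 < r)%R ->
  (forall z, (Cmod (z - x) < r)%R -> F z = G z) -> analytic_at F x -> analytic_at G x.
Proof.
intros Hr E (a & r' & Hr' & H); exists a, (Rmin r r'); split; [apply Rmin_pos; auto|].
intros z Hz; rewrite <- E; [apply H|];
  eapply Rlt_le_trans; [exact Hz | apply Rmin_r | exact Hz | apply Rmin_l].
Qed.

Lemma analytic_const (c x : C) : analytic_at (fun _ => c) x.
Proof.
apply analytic_psn; exists 1%R, (Cmod c), (fun k => if Nat.eqb k 0 then c else 0).
split; [lra | apply psn_const].
Qed.

Lemma analytic_plus (F G : C -> C) (x : C) :
  analytic_at F x -> analytic_at G x -> analytic_at (fun z => F z + G z) x.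
Proof.
rewrite !analytic_psn; intros (r & M & a & Hr & H) (r' & M' & a' & Hr' & H').
assert (0 < Rmin r r')%R by (apply Rmin_pos; auto).
exists (Rmin r r'), (M + M')%R, (fun k => a k + a' k); split; [auto|].
apply (psn_plus (Rmin r r') M M' a a' (fun h => F (x + h)) (fun h => G (x + h))); [lra| |].
- apply psn_shrink with r; [|exact H]; split; [lra | apply Rmin_l].
- apply psn_shrink with r'; [|exact H']; split; [lra | apply Rmin_r].
Qed.

Lemma analytic_mult (F G : C -> C) (x : C) :
  analytic_at F x -> analytic_at G x -> analytic_at (fun z => F z * G z) x.
Proof.
rewrite !analytic_psn; intros (r & M & a & Hr & H) (r' & M' & a' & Hr' & H').
assert (0 < Rmin r r')%R by (apply Rmin_pos; auto).
exists (Rmin r r'), (M * M')%R, (conv a a'); split; [auto|].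
apply (psn_mult (Rmin r r') M M' a a' (fun h => F (x + h)) (fun h => G (x + h))); [lra| |].
- apply psn_shrink with r; [|exact H]; split; [lra | apply Rmin_l].
- apply psn_shrink with r'; [|exact H']; split; [lra | apply Rmin_r].
Qed.

Lemma analytic_id (x : C) : analytic_at (fun z => z) x.
Proof.
apply analytic_psn.
exists 1%R, (Cmod x + 1)%R,
  (fun k => (if Nat.eqb k 0 then x else 0) + (if Nat.eqb k 1 then 1 else 0)).
split; [lra|].
apply (psn_plus 1 (Cmod x) 1 _ _ (fun _ => x) (fun h => h)); [lra | apply psn_const | apply psn_id; lra].
Qed.

Lemma psn_coef0 (r M : R) (a : nat -> C) (F : C -> C) : (0 <= r)%R ->
  psn r M a F -> F 0 = a 0%nat.
Proof.
intros Hr [_ H].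
apply (cseries_unique (fun k => a k * 0 ^ k)); [apply H; rewrite Cmod_0; exact Hr|].
apply (cseries_zero_tail 0); [|rewrite csum_0; simpl; ring].
intros [|n] Hn; [lia|]; simpl; ring.
Qed.

Lemma analytic_comp (F w : C -> C) (x : C) :
  analytic_at F (w x) -> analytic_at w x -> analytic_at (fun z => F (w z)) x.
Proof.
intros HF Hw.
assert (Hw0 : analytic_at (fun z => w z + - w x) x).
{ apply analytic_plus; [exact Hw | apply analytic_const]. }
apply analytic_psn in HF; destruct HF as (rho & M & a & Hrho & HF).
apply analytic_psn in Hw0; destruct Hw0 as (r & M' & u & Hr & Hu).
assert (Hu0 : u 0%nat = 0).
{ rewrite <- (psn_coef0 _ _ _ _ (Rlt_le _ _ Hr) Hu).
  replace (x + 0) with x by ring; ring. }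
pose proof (psn_nonneg _ _ _ _ Hu) as HM'.
(* A factor in (0, 1] with t M' <= rho, valid also when [M'] is zero. *)
set (t := (rho / (rho + M'))%R).
assert (Ht : (0 < t <= 1)%R).
{ unfold t; split; [apply Rdiv_lt_0_compat; lra|].
  apply Rmult_le_reg_r with (rho + M')%R; [lra|].
  unfold Rdiv; rewrite Rmult_assoc, Rinv_l; lra. }
assert (HtM : (t * M' <= rho)%R).
{ unfold t; apply Rmult_le_reg_r with (rho + M')%R; [lra|].
  replace (rho / (rho + M') * M' * (rho + M'))%R with (rho * M')%R by (field; lra).
  nra. }
pose proof (psn_shrink0 r t M' u _ Hr ltac:(lra) Hu0 Hu) as Hu'.
destruct (psn_comp rho (t * r) M (t * M') a u (fun h => F (w x + h)) (fun h => w (x + h) + - w x)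
  ltac:(nra) HtM HF Hu') as [c Hc].
exists c, (t * r)%R; split; [nra|].
intros z Hz; apply (proj2 (is_pseries_cseries _ _ _)).
specialize (Hc (z - x) ltac:(lra)).
replace (w x + (w (x + (z - x)) + - w x)) with (w z) in Hc; [exact Hc|].
replace (x + (z - x)) with z by ring; ring.
Qed.

Lemma analytic_Cinv (x : C) : x <> 0 -> analytic_at (fun z => / z) x.
Proof.
intros Hx.
pose proof (proj1 (Cmod_gt_0 x) Hx) as Hm.
apply analytic_psn.
exists (Cmod x / 2)%R, (/ Cmod x * 2)%R, (fun k => / x * (- / x) ^ k); split; [lra|].
assert (Hbound : forall n, (rsum (fun k => Cmod (/ x * (- / x) ^ k) * (Cmod x / 2) ^ k)%R n
    <= / Cmod x * 2)%R).
{ intros n; rewrite (rsum_ext _ (fun k => / Cmod x * (1 / 2) ^ k)%R).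
  - rewrite rsum_scal; apply Rmult_le_compat_l; [|apply rsum_half].
    apply Rlt_le, Rinv_0_lt_compat, Hm.
  - intros k _.
    rewrite Cmod_mult, Cmod_pow, Cmod_opp, Cmod_inv, Rmult_assoc by exact Hx; f_equal.
    rewrite <- Rpow_mult_distr; f_equal; field; lra. }
split; [exact Hbound|].
intros h Hh.
destruct (ex_cseries_abs (fun k => / x * (- / x) ^ k * h ^ k) (/ Cmod x * 2)) as [l Hl].
{ intros n; eapply Rle_trans; [|apply (Hbound n)]; apply rsum_le; intros k _.
  rewrite Cmod_mult, (Cmod_pow h); apply Rmult_le_compat_l; [apply Cmod_ge_0|].
  apply pow_incr; split; [apply Cmod_ge_0 | exact Hh]. }
assert (Hxh : x + h <> 0).
{ intros E; assert (E' : Cmod h = Cmod x).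
  { replace h with (- x); [apply Cmod_opp|].
    replace h with (x + h - x) by ring; rewrite E; ring. }
  lra. }
replace (/ (x + h)) with l; [exact Hl|].
(* Dropping the first term of the geometric series gives a linear equation for its sum, which
   determines the sum. *)
assert (El : l = / x + (- / x * h) * l).
{ apply (cseries_unique _ _ _ Hl).
  apply (is_series_decr_1 (K := C_AbsRing) (V := C_NormedModule)).
  replace (plus _ _) with (- / x * h * l) by (unfold plus, opp; simpl; ring).
  eapply cseries_ext; [|apply cseries_scal, Hl].
  intros k; simpl; ring. }
assert (E2 : l * (x + h) = 1).
{ assert (H : l * x = 1 - h * l) by (rewrite El at 1; field; exact Hx).
  replace (l * (x + h)) with (l * x + l * h) by ring; rewrite H; ring. }
replace l with (l * (x + h) * / (x + h)) by (field; exact Hxh).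
rewrite E2; ring.
Qed.
Lemma analytic_opp (F : C -> C) (x : C) :
  analytic_at F x -> analytic_at (fun z => - F z) x.
Proof.
intros H; apply analytic_ext with (fun z => - (1) * F z) 1%R; [lra | intros; ring|].
apply analytic_mult; [apply analytic_const | exact H].
Qed.

Lemma analytic_minus (F G : C -> C) (x : C) :
  analytic_at F x -> analytic_at G x -> analytic_at (fun z => F z - G z) x.
Proof. intros HF HG; apply analytic_plus; [exact HF | apply analytic_opp, HG]. Qed.

Lemma analytic_inv (F : C -> C) (x : C) :
  analytic_at F x -> F x <> 0 -> analytic_at (fun z => / F z) x.
Proof.
intros H H0; apply (analytic_comp (fun z => / z) F); [apply analytic_Cinv, H0 | exact H].
Qed.

Lemma analytic_div (F G : C -> C) (x : C) :
  analytic_at F x -> analytic_at G x -> G x <> 0 -> analytic_at (fun z => F z / G z) x.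
Proof. intros HF HG H0; apply analytic_mult; [exact HF | apply analytic_inv; auto]. Qed.

Lemma analytic_pow (F : C -> C) (x : C) (n : nat) :
  analytic_at F x -> analytic_at (fun z => F z ^ n) x.
Proof.
intros H; induction n as [|n IH]; simpl; [apply analytic_const | apply analytic_mult; auto].
Qed.

(** Division by z - x shifts the coefficients. [G] is the difference quotient off [x] and [a 1] at
    [x], so the factorisation holds for every [z] and not only within the radius [r]. *)
Lemma psn_quotient (r M : R) (a : nat -> C) (F : C -> C) (x : C) : (0 < r)%R ->
  psn r M a (fun h => F (x + h)) ->
  F x = a 0%nat /\
  exists G, psn r (M / r) (fun k => a (S k)) (fun h => G (x + h)) /\
    forall z, F z = F x + (z - x) * G z.
Proof.
intros Hr H.
assert (E0 : F x = a 0%nat).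
{ rewrite <- (psn_coef0 _ _ _ _ (Rlt_le _ _ Hr) H); f_equal; ring. }
split; [exact E0|].
exists (fun z => if excluded_middle_informative (z = x) then a 1%nat
                 else (F z - F x) / (z - x)).
split; [split|].
- intros n; apply Rmult_le_reg_l with r; [exact Hr|].
  replace (r * (M / r))%R with M by (field; lra).
  rewrite <- rsum_scal.
  eapply Rle_trans; [|apply (proj1 H (S n))].
  assert (E : forall m, rsum (fun k => Cmod (a k) * r ^ k)%R (S m) =
     (Cmod (a 0%nat) + rsum (fun k => r * (Cmod (a (S k)) * r ^ k)) m)%R).
  { induction m as [|m IH]; [rewrite rsum_S, !rsum_0; simpl; ring|].
    rewrite rsum_S, IH, rsum_S; simpl; ring. }
  rewrite E; pose proof (Cmod_ge_0 (a 0%nat)); lra.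
- intros h Hh; destruct (excluded_middle_informative (x + h = x)) as [e|ne].
  + assert (h = 0) as -> by (replace h with (x + h - x) by ring; rewrite e; ring).
    apply (cseries_zero_tail 0); [|rewrite csum_0; simpl; ring].
    intros [|n] Hn; [lia|]; simpl; ring.
  + assert (Hh0 : h <> 0) by (intros ->; apply ne; ring).
    replace (x + h - x) with h by ring.
    replace ((F (x + h) - F x) / h) with (/ h * (F (x + h) + - a 0%nat))
      by (rewrite E0; field; exact Hh0).
    eapply cseries_ext; [|apply (cseries_scal (/ h) (fun k => a (S k) * h ^ S k))].
    * intros k; simpl; field; exact Hh0.
    * apply (is_series_incr_1 (K := C_AbsRing) (V := C_NormedModule) (fun k => a k * h ^ k)).
      replace (plus _ _) with (F (x + h)) by (unfold plus; simpl; ring).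
      apply (proj2 H h Hh).
- intros z; destruct (excluded_middle_informative (z = x)) as [->|ne]; [ring|].
  field; intros E; apply ne; replace z with (z - x + x) by ring; rewrite E; ring.
Qed.

Lemma psn_analytic (r M : R) (a : nat -> C) (F : C -> C) (x : C) : (0 < r)%R ->
  psn r M a (fun h => F (x + h)) -> analytic_at F x.
Proof. intros Hr H; apply analytic_psn; exists r, M, a; auto. Qed.

Lemma analytic_quotient (F : C -> C) (x : C) : analytic_at F x ->
  exists G, analytic_at G x /\ forall z, F z = F x + (z - x) * G z.
Proof.
intros H; apply analytic_psn in H; destruct H as (r & M & a & Hr & H).
destruct (psn_quotient _ _ _ _ _ Hr H) as (_ & G & HG & E).
exists G; split; [apply (psn_analytic _ _ _ _ _ Hr HG) | exact E].
Qed.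

Lemma analytic_bounded (F : C -> C) (x : C) : analytic_at F x ->
  exists r M, (0 < r)%R /\ forall z, (Cmod (z - x) < r)%R -> (Cmod (F z) <= M)%R.
Proof.
intros H; apply analytic_psn in H; destruct H as (r & M & a & Hr & H).
exists r, M; split; [exact Hr|]; intros z Hz.
replace (F z) with (F (x + (z - x))) by (f_equal; ring).
apply (psn_bound _ _ _ _ _ (Rlt_le _ _ Hr) H); lra.
Qed.

(** * Continuity, order of zeros and derivatives of analytic germs *)

Definition ccont (F : C -> C) (x : C) : Prop :=
  forall eps : R, (0 < eps)%R -> exists d : R, (0 < d)%R /\
    forall z, (Cmod (z - x) < d)%R -> (Cmod (F z - F x) < eps)%R.

Lemma analytic_ccont (F : C -> C) (x : C) : analytic_at F x -> ccont F x.
Proof.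
intros H eps He; destruct (analytic_quotient _ _ H) as (G & HG & E).
destruct (analytic_bounded _ _ HG) as (r & M & Hr & HM).
assert (HM0 : (0 <= M)%R).
{ eapply Rle_trans; [apply Cmod_ge_0 | apply (HM x)].
  replace (x - x) with (RtoC 0) by ring; rewrite Cmod_0; exact Hr. }
exists (Rmin r (eps / (M + 1))); split.
- apply Rmin_pos; [exact Hr | apply Rdiv_lt_0_compat; lra].
- intros z Hz.
  pose proof (Rmin_l r (eps / (M + 1))); pose proof (Rmin_r r (eps / (M + 1))).
  rewrite (E z); replace (F x + (z - x) * G z - F x) with ((z - x) * G z) by ring.
  rewrite Cmod_mult.
  apply Rle_lt_trans with (Cmod (z - x) * M)%R.
  + apply Rmult_le_compat_l; [apply Cmod_ge_0 | apply HM; lra].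
  + apply Rle_lt_trans with (Cmod (z - x) * (M + 1))%R.
    * pose proof (Cmod_ge_0 (z - x)); nra.
    * apply Rmult_lt_reg_r with (/ (M + 1))%R; [apply Rinv_0_lt_compat; lra|].
      rewrite Rmult_assoc, Rinv_r, Rmult_1_r by lra; unfold Rdiv in *; lra.
Qed.

Lemma ccont_neq0 (F : C -> C) (x : C) : ccont F x -> F x <> 0 ->
  exists r, (0 < r)%R /\ forall z, (Cmod (z - x) < r)%R -> F z <> 0.
Proof.
intros H H0; destruct (H (Cmod (F x)) (proj1 (Cmod_gt_0 _) H0)) as (d & Hd & Hz).
exists d; split; [exact Hd|]; intros z Hzd E; specialize (Hz z Hzd).
rewrite E, <- Cmod_opp in Hz; replace (- (0 - F x)) with (F x) in Hz by ring; lra.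
Qed.

Lemma psn_order (m : nat) (r M : R) (a : nat -> C) (F : C -> C) (x : C) : (0 < r)%R ->
  psn r M a (fun h => F (x + h)) ->
  (forall k, (k < m)%nat -> a k = 0) -> a m <> 0 ->
  exists G, analytic_at G x /\ G x <> 0 /\ forall z, F z = (z - x) ^ m * G z.
Proof.
intros Hr; revert M a F; induction m as [|m IH]; intros M a F H Ha Ham.
- exists F; split; [apply (psn_analytic _ _ _ _ _ Hr H)|]; split.
  + rewrite (proj1 (psn_quotient _ _ _ _ _ Hr H)); exact Ham.
  + intros z; simpl; ring.
- destruct (psn_quotient _ _ _ _ _ Hr H) as (E0 & G & HG & E).
  destruct (IH _ _ _ HG) as (G' & HG' & HG0 & E').
  + intros k Hk; apply Ha; lia.
  + exact Ham.
  + exists G'; split; [exact HG'|]; split; [exact HG0|].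
    intros z; rewrite E, E0, Ha, E' by lia; simpl; ring.
Qed.

Lemma analytic_order (F : C -> C) (x : C) : analytic_at F x ->
  (exists r, (0 < r)%R /\ forall z, (Cmod (z - x) < r)%R -> F z = 0) \/
  exists m G, analytic_at G x /\ G x <> 0 /\ forall z, F z = (z - x) ^ m * G z.
Proof.
intros H; apply analytic_psn in H; destruct H as (r & M & a & Hr & H).
destruct (classic (exists k, a k <> 0)) as [Hex|Hno].
- right.
  destruct (dec_inh_nat_subset_has_unique_least_element (fun k => a k <> 0)
    (fun k => classic _) Hex) as (m & (Ham & Hmin) & _).
  exists m; apply (psn_order _ _ _ _ _ _ Hr H); [|exact Ham].
  intros k Hk; apply NNPP; intros Hak; specialize (Hmin k Hak); lia.
- left; exists r; split; [exact Hr|]; intros z Hz.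
  replace z with (x + (z - x)) by ring.
  apply (cseries_unique _ _ _ (proj2 H (z - x) (Rlt_le _ _ Hz))).
  apply (cseries_zero_tail 0); [intros n Hn | rewrite csum_0];
    match goal with |- a ?k * _ = _ => assert (a k = 0) as ->; [|ring] end;
    apply NNPP; intros Hak; apply Hno; eauto.
Qed.

(** Carathéodory's form of [F'(x) = l], for analytic [F]. *)
Definition drv (F : C -> C) (x l : C) : Prop :=
  exists G r, analytic_at G x /\ G x = l /\ (0 < r)%R /\
    forall z, (Cmod (z - x) < r)%R -> F z = F x + (z - x) * G z.

Lemma Cmod_minus_diag (x : C) : Cmod (x - x) = 0%R.
Proof. replace (x - x) with (RtoC 0) by ring; apply Cmod_0. Qed.

Lemma Cminus_neq0 (x y : C) : x <> y -> x - y <> 0.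
Proof. intros H E; apply H; replace x with (x - y + y) by ring; rewrite E; ring. Qed.

Lemma drv_exists (F : C -> C) (x : C) : analytic_at F x -> exists l, drv F x l.
Proof.
intros H; destruct (analytic_quotient _ _ H) as (G & HG & E).
exists (G x), G, 1%R; repeat split; auto; lra.
Qed.

Lemma drv_analytic (F : C -> C) (x l : C) : drv F x l -> analytic_at F x.
Proof.
intros (G & r & HG & _ & Hr & E).
apply analytic_ext with (fun z => F x + (z - x) * G z) r; [exact Hr | symmetry; auto|].
apply analytic_plus; [apply analytic_const|].
apply analytic_mult; [|exact HG].
apply analytic_minus; [apply analytic_id | apply analytic_const].
Qed.

Lemma drv_unique (F : C -> C) (x l m : C) : drv F x l -> drv F x m -> l = m.
Proof.
intros (G & r & HG & <- & Hr & E) (G' & r' & HG' & <- & Hr' & E').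
pose proof (analytic_minus _ _ _ HG HG') as HD; apply analytic_ccont in HD.
apply NNPP; intros Hne.
destruct (ccont_neq0 _ _ HD (Cminus_neq0 _ _ Hne)) as (d & Hd & H).
set (e := (Rmin d (Rmin r r') / 2)%R).
assert (He : (0 < e)%R).
{ unfold e; assert (0 < Rmin d (Rmin r r'))%R by (repeat apply Rmin_pos; auto); lra. }
assert (Hed : (e < d /\ e < r /\ e < r')%R).
{ pose proof (Rmin_l d (Rmin r r')); pose proof (Rmin_r d (Rmin r r')).
  pose proof (Rmin_l r r'); pose proof (Rmin_r r r'); unfold e in *; lra. }
assert (Hz : Cmod (x + RtoC e - x) = e).
{ replace (x + RtoC e - x) with (RtoC e) by ring; rewrite Cmod_R, Rabs_pos_eq; lra. }
apply (H (x + RtoC e)); [lra|].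
specialize (E (x + RtoC e) ltac:(lra)); specialize (E' (x + RtoC e) ltac:(lra)).
assert (He0 : RtoC e <> 0) by (intros Q; apply RtoC_inj in Q; lra).
replace (x + RtoC e - x) with (RtoC e) in E, E' by ring.
replace (G (x + RtoC e) - G' (x + RtoC e)) with
  (((F x + RtoC e * G (x + RtoC e)) - (F x + RtoC e * G' (x + RtoC e))) / RtoC e)
  by (field; exact He0).
rewrite <- E, <- E'; field; exact He0.
Qed.

Lemma drv_ext (F F' : C -> C) (x l : C) (r : R) : (0 < r)%R ->
  (forall z, (Cmod (z - x) < r)%R -> F z = F' z) -> drv F x l -> drv F' x l.
Proof.
intros Hr E (G & d & HG & HGx & Hd & H).
exists G, (Rmin r d); repeat split; auto; [apply Rmin_pos; auto|].
pose proof (Rmin_l r d); pose proof (Rmin_r r d).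
intros z Hz; rewrite <- !E by (rewrite ?Cmod_minus_diag; lra); apply H; lra.
Qed.

Lemma drv_const (c x : C) : drv (fun _ => c) x 0.
Proof.
exists (fun _ => 0), 1%R; repeat split; [apply analytic_const | lra | intros; ring].
Qed.

Lemma drv_id (x : C) : drv (fun z => z) x 1.
Proof.
exists (fun _ => 1), 1%R; repeat split; [apply analytic_const | lra | intros; ring].
Qed.

Lemma drv_plus (F F' : C -> C) (x l l' : C) :
  drv F x l -> drv F' x l' -> drv (fun z => F z + F' z) x (l + l').
Proof.
intros (G & r & HG & <- & Hr & E) (G' & r' & HG' & <- & Hr' & E').
exists (fun z => G z + G' z), (Rmin r r'); repeat split;
  [apply analytic_plus; auto | apply Rmin_pos; auto|].
pose proof (Rmin_l r r'); pose proof (Rmin_r r r').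
intros z Hz; rewrite E, E' by lra; ring.
Qed.

Lemma drv_mult (F F' : C -> C) (x l l' : C) :
  drv F x l -> drv F' x l' -> drv (fun z => F z * F' z) x (l * F' x + F x * l').
Proof.
intros HF HF'; pose proof (drv_analytic _ _ _ HF') as HA.
destruct HF as (G & r & HG & <- & Hr & E), HF' as (G' & r' & HG' & <- & Hr' & E').
exists (fun z => G z * F' z + F x * G' z), (Rmin r r'); repeat split;
  [|apply Rmin_pos; auto|].
- apply analytic_plus; apply analytic_mult; auto; apply analytic_const.
- pose proof (Rmin_l r r'); pose proof (Rmin_r r r').
  intros z Hz; rewrite (E z) by lra.
  replace (F x * F' x) with (F x * F' z - F x * ((z - x) * G' z)); [ring|].
  rewrite (E' z) by lra; ring.
Qed.

Lemma drv_comp (F w : C -> C) (x l m : C) :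
  drv F (w x) l -> drv w x m -> drv (fun z => F (w z)) x (l * m).
Proof.
intros (G & r & HG & <- & Hr & E) Hw; pose proof (drv_analytic _ _ _ Hw) as HA.
destruct Hw as (W & r' & HW & <- & Hr' & E').
destruct (analytic_ccont _ _ HA r Hr) as (d & Hd & Hwd).
exists (fun z => G (w z) * W z), (Rmin d r'); repeat split; [|apply Rmin_pos; auto|].
- apply analytic_mult; [apply analytic_comp; auto | exact HW].
- pose proof (Rmin_l d r'); pose proof (Rmin_r d r').
  intros z Hz; rewrite (E (w z)) by (apply Hwd; lra).
  replace (w z - w x) with ((z - x) * W z); [ring|].
  rewrite (E' z) at 1 by lra; ring.
Qed.

Lemma drv_Cinv (x : C) : x <> 0 -> drv (fun z => / z) x (- / (x * x)).
Proof.
intros Hx.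
destruct (ccont_neq0 (fun z => z) x (analytic_ccont _ _ (analytic_id x)) Hx) as (r & Hr & H).
exists (fun z => - / (x * z)), r; repeat split; [|exact Hr|].
- apply analytic_opp, analytic_inv; [|apply Cmult_neq_0; exact Hx].
  apply analytic_mult; [apply analytic_const | apply analytic_id].
- intros z Hz; specialize (H z Hz); field; auto.
Qed.

Lemma drv_div (F F' : C -> C) (x l l' : C) : F' x <> 0 ->
  drv F x l -> drv F' x l' ->
  drv (fun z => F z / F' z) x ((l * F' x - F x * l') / (F' x * F' x)).
Proof.
intros H0 HF HF'.
replace ((l * F' x - F x * l') / (F' x * F' x)) with
  (l * / F' x + F x * (- / (F' x * F' x) * l')) by (field; exact H0).
apply (drv_mult F (fun z => / F' z)); [exact HF|].
apply (drv_comp (fun z => / z) F'); [apply drv_Cinv, H0 | exact HF'].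
Qed.

(** The link to the derivative that occurs in [phasar_derivative]. *)
Lemma drv_C_derive (F : C -> C) (x l : C) : drv F x l -> C_derive F x = l.
Proof.
intros (G & r & HG & <- & Hr & E); apply is_C_derive_unique.
split; [apply is_linear_scal_l|].
intros y Hy.
apply (is_filter_lim_locally_unique (V := AbsRing_NormedModule C_AbsRing)) in Hy; subst y.
intros eps.
destruct (analytic_ccont _ _ HG eps (cond_pos eps)) as (d & Hd & HGd).
exists (mkposreal _ (Rmin_pos _ _ Hr Hd)); intros z Hz.
change (Cmod (z - x) < Rmin r d)%R in Hz.
pose proof (Rmin_l r d); pose proof (Rmin_r r d).
change (Cmod (F z - F x - (z - x) * G x) <= eps * Cmod (z - x))%R.
rewrite (E z) by lra.
replace (F x + (z - x) * G z - F x - (z - x) * G x) with ((G z - G x) * (z - x)) by ring.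
rewrite Cmod_mult; apply Rmult_le_compat_r; [apply Cmod_ge_0|].
apply Rlt_le, HGd; lra.
Qed.
(** * Boundary behaviour of functions with nonnegative imaginary part *)

Lemma Im_le_Cmod (z : C) : (Rabs (Im z) <= Cmod z)%R.
Proof. eapply Rle_trans; [apply Rmax_r | apply Rmax_Cmod]. Qed.

Lemma Cmod_le_abs (z : C) : (Cmod z <= Rabs (Re z) + Rabs (Im z))%R.
Proof.
replace z with (RtoC (Re z) + Ci * RtoC (Im z)) at 1.
- eapply Rle_trans; [apply Cmod_triangle|].
  rewrite Cmod_mult, Cmod_Ci, !Cmod_R; lra.
- destruct z as [a b]; unfold RtoC, Ci, Cplus, Cmult; simpl; f_equal; ring.
Qed.

Definition dist2 (z x : C) : R := ((Re z - Re x) ^ 2 + (Im z - Im x) ^ 2)%R.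

(** Averaging over [k, ik, -k, -ik] kills the terms of degree 1 and 2. *)
Lemma superharmonic_no_local_min (F : C -> C) (z0 x : C) (e r : R) :
  (0 < e)%R -> (0 < r)%R -> analytic_at F z0 ->
  ~ (forall z, (Cmod (z - z0) < r)%R ->
       (Im (F z0) - e * dist2 z0 x <= Im (F z) - e * dist2 z x)%R).
Proof.
intros He Hr HF Hmin.
destruct (analytic_quotient _ _ HF) as (G & HG & EG).
destruct (analytic_quotient _ _ HG) as (H & HH & EH).
destruct (analytic_quotient _ _ HH) as (K & HK & EK).
destruct (analytic_bounded _ _ HK) as (d & M & Hd & HM).
assert (HM0 : (0 <= M)%R).
{ eapply Rle_trans; [apply Cmod_ge_0 | apply (HM z0); rewrite Cmod_minus_diag; exact Hd]. }
set (t := (Rmin (Rmin r d) (e / (M + 1)) / 2)%R).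
assert (Hq : (0 < e / (M + 1))%R) by (apply Rdiv_lt_0_compat; lra).
assert (Hm : (0 < Rmin (Rmin r d) (e / (M + 1)))%R) by (repeat apply Rmin_pos; auto).
assert (Ht : (0 < t /\ t < r /\ t < d /\ t < e / (M + 1))%R).
{ pose proof (Rmin_l (Rmin r d) (e / (M + 1))); pose proof (Rmin_r (Rmin r d) (e / (M + 1))).
  pose proof (Rmin_l r d); pose proof (Rmin_r r d); unfold t; lra. }
destruct Ht as (Ht0 & Htr & Htd & Hte).
assert (HtM : (t * M < e)%R).
{ apply Rle_lt_trans with (t * (M + 1))%R; [nra|].
  apply Rmult_lt_reg_r with (/ (M + 1))%R; [apply Rinv_0_lt_compat; lra|].
  rewrite Rmult_assoc, Rinv_r by lra; unfold Rdiv in Hte; lra. }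
assert (Key : forall w : C, Cmod w = 1%R ->
  (Im (F z0) - e * dist2 z0 x <= Im (F z0 + RtoC t * w * G z0 + RtoC t ^ 2 * w ^ 2 * H z0)
     + t ^ 3 * M - e * dist2 (z0 + RtoC t * w) x)%R).
{ intros w Hw.
  assert (Hz : Cmod (z0 + RtoC t * w - z0) = t).
  { replace (z0 + RtoC t * w - z0) with (RtoC t * w) by ring.
    rewrite Cmod_mult, Hw, Cmod_R, Rabs_pos_eq; lra. }
  specialize (Hmin (z0 + RtoC t * w) ltac:(lra)).
  specialize (HM (z0 + RtoC t * w) ltac:(lra)).
  rewrite (EG (z0 + RtoC t * w)), (EH (z0 + RtoC t * w)), (EK (z0 + RtoC t * w)) in Hmin.
  replace (z0 + RtoC t * w - z0) with (RtoC t * w) in Hmin by ring.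
  set (kz := K (z0 + RtoC t * w)) in *.
  replace (F z0 + RtoC t * w * (G z0 + RtoC t * w * (H z0 + RtoC t * w * kz))) with
    ((F z0 + RtoC t * w * G z0 + RtoC t ^ 2 * w ^ 2 * H z0) + (RtoC t * w) ^ 3 * kz) in Hmin by ring.
  assert (B : (Rabs (Im ((RtoC t * w) ^ 3 * kz)) <= t ^ 3 * M)%R).
  { eapply Rle_trans; [apply Im_le_Cmod|].
    rewrite Cmod_mult, Cmod_pow, Cmod_mult, Hw, Cmod_R, Rmult_1_r, Rabs_pos_eq by lra.
    apply Rmult_le_compat_l; [apply pow_le; lra | exact HM]. }
  pose proof (Rle_abs (Im ((RtoC t * w) ^ 3 * kz))).
  assert (EIm : forall a b, Im (a + b) = (Im a + Im b)%R) by (intros [] []; reflexivity).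
  rewrite EIm in Hmin; lra. }
assert (K1 := Key 1 Cmod_1).
assert (K2 := Key (- (1)) Cmod_m1).
assert (K3 := Key Ci Cmod_Ci).
assert (K4 := Key (- Ci) ltac:(rewrite Cmod_opp; apply Cmod_Ci)).
clear Key Hmin.
(* In the sum of the four inequalities the Taylor terms cancel, while the squared distances exceed
   four times the central one by 4 t^2; the choice of [t] makes t M < e, which is incompatible. *)
assert (Hsum : (e * t ^ 2 <= t ^ 3 * M)%R).
{ destruct (F z0) as [f1 f2], (G z0) as [g1 g2], (H z0) as [h1 h2], z0 as [u v], x as [p q].
  unfold dist2, Ci, RtoC, Cplus, Cmult, Copp, Re, Im in K1, K2, K3, K4; simpl in K1, K2, K3, K4.
  nra. }
assert ((t * M) * t ^ 2 < e * t ^ 2)%R by (apply Rmult_lt_compat_r; [nra | exact HtM]).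
nra.
Qed.

Definition rcont (u : C -> R) (z0 : C) : Prop :=
  forall eps : R, (0 < eps)%R -> exists d : R, (0 < d)%R /\
    forall z, (Cmod (z - z0) < d)%R -> (Rabs (u z - u z0) < eps)%R.

Definition in_rectangle (a b c d : R) (z : C) : Prop :=
  (a <= Re z <= b)%R /\ (c <= Im z <= d)%R.

(** Radius and local bound are packed into one gauge: near each point [u] is at most the inverse of
    the gauge. The uniform lower bound on the gauge that [compactness_value_2d] supplies is then a
    uniform bound on [u]. *)
Lemma rectangle_bounded (u : C -> R) (a b c d : R) :
  (forall z0, in_rectangle a b c d z0 -> exists r M, (0 < r)%R /\
     forall z, in_rectangle a b c d z -> (Cmod (z - z0) < r)%R -> (u z <= M)%R) ->
  exists M, forall z, in_rectangle a b c d z -> (u z <= M)%R.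
Proof.
intros Hloc.
assert (Hd : forall p q, exists dl : posreal, in_rectangle a b c d (p, q) ->
  forall z, in_rectangle a b c d z ->
    (Rabs (Re z - p) < dl)%R -> (Rabs (Im z - q) < dl)%R -> (u z <= / dl)%R).
{ intros p q; destruct (classic (in_rectangle a b c d (p, q))) as [Hin|Hout].
  - destruct (Hloc _ Hin) as (r & M & Hr & H).
    assert (HM : (0 < / (Rabs M + 1))%R).
    { apply Rinv_0_lt_compat; pose proof (Rabs_pos M); lra. }
    assert (Hp : (0 < Rmin (r / 2) (/ (Rabs M + 1)))%R) by (apply Rmin_pos; lra).
    exists (mkposreal _ Hp); intros _ z Hz H1 H2; simpl in *.
    pose proof (Rmin_l (r / 2) (/ (Rabs M + 1))); pose proof (Rmin_r (r / 2) (/ (Rabs M + 1))).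
    apply Rle_trans with M.
    + apply H; [exact Hz|].
      eapply Rle_lt_trans; [apply Cmod_le_abs|].
      change (Rabs (Re z - p) + Rabs (Im z - q) < r)%R; lra.
    + apply Rle_trans with (Rabs M + 1)%R; [pose proof (Rle_abs M); lra|].
      rewrite <- (Rinv_inv (Rabs M + 1)) at 1; apply Rinv_le_contravar; assumption.
  - exists (mkposreal 1 Rlt_0_1); intros Hin; contradiction. }
set (delta := fun p q => proj1_sig (constructive_indefinite_description _ (Hd p q))).
assert (Hdelta : forall p q, in_rectangle a b c d (p, q) ->
  forall z, in_rectangle a b c d z ->
    (Rabs (Re z - p) < delta p q)%R -> (Rabs (Im z - q) < delta p q)%R ->
    (u z <= / delta p q)%R).
{ intros p q; apply (proj2_sig (constructive_indefinite_description _ (Hd p q))). }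
clearbody delta.
destruct (compactness_value_2d a b c d delta) as [dl Hdl].
exists (/ dl)%R; intros z Hz.
apply Rnot_lt_le; intros Hlt.
apply (Hdl (Re z) (Im z) (proj1 Hz) (proj2 Hz)).
intros (p & q & Hp & Hq & H1 & H2 & H3).
assert (u z <= / delta p q)%R by (apply Hdelta; [split|..]; assumption).
assert (/ delta p q <= / dl)%R.
{ apply Rinv_le_contravar; [apply cond_pos | exact H3]. }
lra.
Qed.

Lemma rectangle_min (u : C -> R) (a b c d : R) (z1 : C) : in_rectangle a b c d z1 ->
  (forall z0, in_rectangle a b c d z0 -> rcont u z0) ->
  exists z0, in_rectangle a b c d z0 /\ forall z, in_rectangle a b c d z -> (u z0 <= u z)%R.
Proof.
intros Hz1 Hc.
destruct (rectangle_bounded (fun z => (- u z)%R) a b c d) as [M HM].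
{ intros z0 Hz0; destruct (Hc z0 Hz0 1%R Rlt_0_1) as (r & Hr & H).
  exists r, (- u z0 + 1)%R; split; [exact Hr|]; intros z _ Hz; specialize (H z Hz).
  apply Rabs_def2 in H; lra. }
destruct (completeness (fun y => exists z, in_rectangle a b c d z /\ y = (- u z)%R)) as [S [HS1 HS2]].
{ exists M; intros y (z & Hz & ->); auto. }
{ exists (- u z1)%R, z1; auto. }
apply NNPP; intros Hno.
assert (Hpos : forall z, in_rectangle a b c d z -> (0 < S + u z)%R).
{ intros z Hz; assert (- u z <= S)%R by (apply HS1; eauto).
  destruct (Rle_lt_or_eq_dec (- u z) S H) as [Hlt|Heq]; [lra|].
  exfalso; apply Hno; exists z; split; [exact Hz|]; intros z' Hz'.
  assert (- u z' <= S)%R by (apply HS1; eauto); lra. }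
(* If the infimum [- S] is not attained, this reciprocal is locally bounded, hence bounded, which
   keeps [u] away from its infimum. *)
destruct (rectangle_bounded (fun z => / (S + u z))%R a b c d) as [B HB].
{ intros z0 Hz0; specialize (Hpos z0 Hz0).
  destruct (Hc z0 Hz0 ((S + u z0) / 2)%R ltac:(lra)) as (r & Hr & H).
  exists r, (/ ((S + u z0) / 2))%R; split; [exact Hr|]; intros z _ Hz; specialize (H z Hz).
  apply Rabs_def2 in H; apply Rinv_le_contravar; lra. }
assert (HB0 : (0 < B)%R).
{ eapply Rlt_le_trans; [apply Rinv_0_lt_compat, (Hpos z1 Hz1) | apply (HB z1 Hz1)]. }
assert (S <= S - / B)%R; [|pose proof (Rinv_0_lt_compat B HB0); lra].
apply HS2; intros y (z & Hz & ->).
specialize (HB z Hz); specialize (Hpos z Hz).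
assert (/ B <= S + u z)%R; [|lra].
rewrite <- (Rinv_inv (S + u z)); apply Rinv_le_contravar; [apply Rinv_0_lt_compat|]; assumption.
Qed.

Lemma Re_minus (a b : C) : Re (a - b) = (Re a - Re b)%R.
Proof. reflexivity. Qed.

Lemma Im_minus (a b : C) : Im (a - b) = (Im a - Im b)%R.
Proof. reflexivity. Qed.

Lemma rcont_Im_dist2 (F : C -> C) (x z0 : C) (e : R) : ccont F z0 ->
  rcont (fun z => Im (F z) - e * dist2 z x)%R z0.
Proof.
intros HF eps Heps.
set (B := (Rabs (Re z0 - Re x) + Rabs (Im z0 - Im x))%R).
assert (HB : (0 <= B)%R) by (pose proof (Rabs_pos (Re z0 - Re x)); pose proof (Rabs_pos (Im z0 - Im x)); unfold B; lra).
pose proof (Rabs_pos e) as He0.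
destruct (HF (eps / 2)%R ltac:(lra)) as (d & Hd & H).
set (D := (2 * ((Rabs e + 1) * (2 * B + 2)))%R).
assert (HD : (0 < D)%R) by (unfold D; nra).
assert (HeD : (0 < eps / D)%R) by (apply Rdiv_lt_0_compat; lra).
exists (Rmin (Rmin d 1) (eps / D)); split; [repeat apply Rmin_pos; auto; lra|].
intros z Hz.
pose proof (Rmin_l (Rmin d 1) (eps / D)); pose proof (Rmin_r (Rmin d 1) (eps / D)).
pose proof (Rmin_l d 1); pose proof (Rmin_r d 1).
specialize (H z ltac:(lra)).
pose proof (Im_le_Cmod (F z - F z0)) as B1; rewrite Im_minus in B1.
pose proof (Im_le_Cmod (z - z0)) as B2; rewrite Im_minus in B2.
pose proof (re_le_Cmod (z - z0)) as B3; rewrite Re_minus in B3.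
set (s := Cmod (z - z0)) in *.
assert (Hs : (0 <= s)%R) by apply Cmod_ge_0.
replace (Im (F z) - e * dist2 z x - (Im (F z0) - e * dist2 z0 x))%R with
  ((Im (F z) - Im (F z0)) - e * (dist2 z x - dist2 z0 x))%R by ring.
assert (Q : (Rabs (dist2 z x - dist2 z0 x) <= s * (2 * B + 2))%R).
{ replace (dist2 z x - dist2 z0 x)%R with
    ((Re z - Re z0) * (Re z - Re z0 + 2 * (Re z0 - Re x)) +
     (Im z - Im z0) * (Im z - Im z0 + 2 * (Im z0 - Im x)))%R by (unfold dist2; ring).
  eapply Rle_trans; [apply Rabs_triang|]; rewrite !Rabs_mult.
  pose proof (Rabs_triang (Re z - Re z0) (2 * (Re z0 - Re x))) as T1.
  pose proof (Rabs_triang (Im z - Im z0) (2 * (Im z0 - Im x))) as T2.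
  rewrite Rabs_mult, (Rabs_pos_eq 2) in T1, T2 by lra.
  pose proof (Rabs_pos (Re z0 - Re x)); pose proof (Rabs_pos (Im z0 - Im x)).
  apply Rle_trans with (s * (1 + 2 * Rabs (Re z0 - Re x)) + s * (1 + 2 * Rabs (Im z0 - Im x)))%R.
  - apply Rplus_le_compat; apply Rmult_le_compat; try apply Rabs_pos; lra.
  - unfold B; nra. }
eapply Rle_lt_trans; [apply Rabs_triang|]; rewrite Rabs_Ropp, Rabs_mult.
assert (Rabs e * Rabs (dist2 z x - dist2 z0 x) <= (Rabs e + 1) * (s * (2 * B + 2)))%R.
{ apply Rmult_le_compat; try apply Rabs_pos; lra. }
assert (s * D < eps)%R.
{ apply Rmult_lt_reg_r with (/ D)%R; [apply Rinv_0_lt_compat, HD|].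
  rewrite Rmult_assoc, Rinv_r by lra; unfold Rdiv in *; lra. }
unfold D in *; nra.
Qed.
Lemma Cmod_dist2 (z x : C) : (Cmod (z - x) ^ 2 = dist2 z x)%R.
Proof. rewrite Cmod2_alt; reflexivity. Qed.

Lemma dist2_nonneg (z x : C) : (0 <= dist2 z x)%R.
Proof. apply Rplus_le_le_0_compat; apply pow2_ge_0. Qed.

(** The Poisson kernel at [x] is small near the rest of the boundary, so a negative
    value of [Im h] would give [Im h - e |z - x|^2] an interior minimum on a large
    rectangle. *)
Lemma Im_nonneg_poisson (h H : C -> C) (x : C) (t r : R) :
  Im x = 0%R -> (0 < t)%R -> analytic_on upper_half_plane h ->
  (forall z, upper_half_plane z -> (- Im z <= Im (h z) * (t * dist2 z x))%R) ->
  (0 < r)%R -> (forall z, upper_half_plane z -> (Cmod (z - x) < r)%R -> H z = h z) ->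
  ccont H x -> (0 <= Im (H x))%R ->
  forall z, upper_half_plane z -> (0 <= Im (h z))%R.
Proof.
intros Hx Ht Hh Hlow Hr HHh HHc HHx zs Hzs.
apply Rnot_lt_le; intros Hneg.
set (m := (- Im (h zs) / 2)%R).
assert (Hm : (0 < m)%R) by (unfold m; lra).
destruct (HHc m Hm) as (d & Hd & Hnear).
set (r1 := Rmin r d).
assert (Hr1 : (0 < r1)%R) by (apply Rmin_pos; auto).
assert (Hclose : forall z, upper_half_plane z -> (Cmod (z - x) < r1)%R -> (- m < Im (h z))%R).
{ intros z Hz Hzr.
  pose proof (Rmin_l r d); pose proof (Rmin_r r d).
  rewrite <- HHh by (auto; unfold r1 in *; lra).
  specialize (Hnear z ltac:(unfold r1 in *; lra)).
  pose proof (Im_le_Cmod (H z - H x)) as B; rewrite Im_minus in B.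
  pose proof (Rabs_def2 _ _ (Rle_lt_trans _ _ _ B Hnear)); lra. }
(* The points where [Im (h z) <= - m] lie in a horodisc at [x]: a disc tangent to the real line
   there, of diameter 1 / (m t). *)
assert (Hfar : forall z, upper_half_plane z -> (Im (h z) <= - m)%R ->
  (m * t * dist2 z x <= Im z)%R).
{ intros z Hz Hle; specialize (Hlow z Hz).
  pose proof (dist2_nonneg z x).
  assert (Im (h z) * (t * dist2 z x) <= - m * (t * dist2 z x))%R; [|lra].
  apply Rmult_le_compat_r; [|exact Hle]; apply Rmult_le_pos; lra. }
assert (Hmt : (0 < m * t)%R) by (apply Rmult_lt_0_compat; auto).
(* Large enough for the rectangle to contain [zs], and larger than the diameter of the horodisc. *)
set (L := (Rabs (Re zs - Re x) + Im zs + 2 / (m * t) + 1)%R).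
assert (Hmt2 : (0 < 2 / (m * t))%R) by (apply Rdiv_lt_0_compat; lra).
assert (HLm : (1 < m * t * L)%R).
{ assert (2 <= m * t * L)%R; [|lra].
  replace 2%R with (m * t * (2 / (m * t)))%R at 1 by (field; lra).
  apply Rmult_le_compat_l; [lra|].
  pose proof (Rabs_pos (Re zs - Re x)); unfold upper_half_plane, L in *; lra. }
(* The bottom edge runs below [zs] and below every point of the horodisc at distance at least [r1]
   from [x]. *)
set (y0 := (Rmin (Im zs) (m * t * (r1 * r1)) / 2)%R).
unfold upper_half_plane in Hzs.
assert (Hmr : (0 < m * t * (r1 * r1))%R) by (apply Rmult_lt_0_compat; nra).
assert (Hy0 : (0 < y0 /\ y0 < Im zs /\ y0 < m * t * (r1 * r1))%R).
{ pose proof (Rmin_l (Im zs) (m * t * (r1 * r1))); pose proof (Rmin_r (Im zs) (m * t * (r1 * r1))).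
  pose proof (Rmin_pos _ _ Hzs Hmr); unfold y0; lra. }
destruct Hy0 as (Hy0 & Hy1 & Hy2).
assert (HzsR : (Rabs (Re zs - Re x) < L /\ Im zs < L /\ 0 < L)%R).
{ pose proof (Rabs_pos (Re zs - Re x)); unfold L; repeat split; lra. }
destruct HzsR as (HzsR & HzsL & HL0).
(* The penalty is then at most m / 2 on the rectangle, while [Im (h zs)] is - 2 m: a minimiser of
   the penalised function still has [Im h <= - m]. So it lies in the horodisc and outside the disc
   of radius [r1], which places it in the interior. *)
set (e := (m / (4 * (L * L)))%R).
assert (HLL : (0 < 4 * (L * L))%R) by nra.
assert (He : (0 < e)%R) by (apply Rdiv_lt_0_compat; auto).
assert (HeL : (e * (2 * (L * L)) = m / 2)%R) by (unfold e; field; lra).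
set (a := (Re x - L)%R); set (b := (Re x + L)%R).
assert (Hin : in_rectangle a b y0 L zs).
{ apply Rabs_def2 in HzsR; unfold a, b; split; lra. }
assert (HU : forall z, in_rectangle a b y0 L z -> upper_half_plane z).
{ intros z [_ Hz]; unfold upper_half_plane; lra. }
destruct (rectangle_min (fun z => Im (h z) - e * dist2 z x)%R a b y0 L zs Hin) as (z0 & Hz0 & Hmin).
{ intros z0 Hz0; apply rcont_Im_dist2, analytic_ccont, Hh, HU, Hz0. }
assert (Hz0v : (Im (h z0) - e * dist2 z0 x <= - 2 * m)%R).
{ specialize (Hmin zs Hin).
  assert (0 <= e * dist2 zs x)%R by (apply Rmult_le_pos; [lra | apply dist2_nonneg]).
  unfold m in *; lra. }
assert (Hbox : (dist2 z0 x <= 2 * (L * L))%R).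
{ destruct Hz0 as [H1 H2]; unfold dist2; rewrite Hx.
  assert ((Re z0 - Re x) ^ 2 <= L * L)%R by (unfold a, b in H1; nra).
  assert ((Im z0 - 0) ^ 2 <= L * L)%R by nra.
  lra. }
assert (Hz0h : (Im (h z0) <= - m)%R).
{ assert (e * dist2 z0 x <= m / 2)%R; [|lra].
  rewrite <- HeL; apply Rmult_le_compat_l; lra. }
assert (Hz0U := HU z0 Hz0).
assert (Hq := Hfar z0 Hz0U Hz0h).
assert (Hq1 : (r1 * r1 <= dist2 z0 x)%R).
{ apply Rnot_lt_le; intros Hlt; rewrite <- Cmod_dist2 in Hlt.
  assert (Cmod (z0 - x) < r1)%R by (pose proof (Cmod_ge_0 (z0 - x)); nra).
  specialize (Hclose z0 Hz0U H0); lra. }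
assert (HqL : (dist2 z0 x < L * L)%R).
{ apply Rnot_le_lt; intros Hle.
  assert (m * t * (L * L) <= Im z0)%R by nra.
  destruct Hz0 as [_ H2]; nra. }
destruct Hz0 as [[Ha1 Ha2] [Hb1 Hb2]].
assert (Hint : (a < Re z0 < b /\ y0 < Im z0 < L)%R).
{ assert (Hs : ((Re z0 - Re x) ^ 2 < L * L /\ Im z0 ^ 2 < L * L)%R).
  { unfold dist2 in HqL; rewrite Hx in HqL.
    pose proof (pow2_ge_0 (Re z0 - Re x)); pose proof (pow2_ge_0 (Im z0 - 0)).
    replace (Im z0 ^ 2)%R with ((Im z0 - 0) ^ 2)%R by ring; lra. }
  destruct Hs as [Hs1 Hs2].
  unfold a, b in *; repeat split; [nra | nra | | nra].
  apply Rlt_le_trans with (2 := Hq).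
  apply Rlt_le_trans with (1 := Hy2); apply Rmult_le_compat_l; lra. }
apply (superharmonic_no_local_min h z0 x e
  (Rmin (Rmin (Re z0 - a) (b - Re z0)) (Rmin (Im z0 - y0) (L - Im z0))) He).
- repeat apply Rmin_pos; lra.
- apply Hh, Hz0U.
- intros z Hz; apply Hmin.
  pose proof (re_le_Cmod (z - z0)) as B1; pose proof (Im_le_Cmod (z - z0)) as B2.
  rewrite Re_minus in B1; rewrite Im_minus in B2.
  pose proof (Rabs_def2 _ _ (Rle_lt_trans _ _ _ B1 Hz)) as [C1 C2].
  pose proof (Rabs_def2 _ _ (Rle_lt_trans _ _ _ B2 Hz)) as [D1 D2].
  pose proof (Rmin_l (Rmin (Re z0 - a) (b - Re z0)) (Rmin (Im z0 - y0) (L - Im z0))).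
  pose proof (Rmin_r (Rmin (Re z0 - a) (b - Re z0)) (Rmin (Im z0 - y0) (L - Im z0))).
  pose proof (Rmin_l (Re z0 - a) (b - Re z0)); pose proof (Rmin_r (Re z0 - a) (b - Re z0)).
  pose proof (Rmin_l (Im z0 - y0) (L - Im z0)); pose proof (Rmin_r (Im z0 - y0) (L - Im z0)).
  split; lra.
Qed.

(** * Zeros of analytic functions with nonnegative imaginary part *)

Definition cis (a : R) : C := (cos a, sin a).

Lemma cis_pow (a : R) (n : nat) : cis a ^ n = cis (INR n * a).
Proof.
induction n as [|n IH].
- simpl; rewrite Rmult_0_l; unfold cis; rewrite cos_0, sin_0; reflexivity.
- rewrite Cpow_S, IH, S_INR, Rmult_plus_distr_r, Rmult_1_l, Rplus_comm.
  unfold cis, Cmult; simpl; rewrite cos_plus, sin_plus; f_equal; ring.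
Qed.

Lemma Cmod_cis (a : R) : Cmod (cis a) = 1%R.
Proof.
unfold cis, Cmod; simpl.
replace (cos a * (cos a * 1) + sin a * (sin a * 1))%R with 1%R; [apply sqrt_1|].
pose proof (sin2_cos2 a) as H; unfold Rsqr in H; lra.
Qed.

Lemma root_direction (m : nat) (g : C) : (1 <= m)%nat -> g <> 0 ->
  exists w, Cmod w = 1%R /\ (Im (w ^ m * g) < 0)%R.
Proof.
intros Hm Hg.
assert (Hroot : forall a, exists w, Cmod w = 1%R /\ w ^ m = cis a).
{ intros a; exists (cis (a / INR m)); split; [apply Cmod_cis|].
  rewrite cis_pow; f_equal; field; apply not_0_INR; lia. }
destruct g as [p q].
assert (Hcase : (q < 0 \/ 0 < q \/ p < 0 \/ 0 < p)%R).
{ destruct (Rtotal_order q 0) as [|[->|]]; [tauto| |tauto].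
  destruct (Rtotal_order p 0) as [|[->|]]; [tauto| |tauto].
  exfalso; apply Hg; reflexivity. }
destruct Hcase as [H|[H|[H|H]]].
- destruct (Hroot 0%R) as (w & Hw & E); exists w; split; [exact Hw|].
  rewrite E; unfold cis; rewrite cos_0, sin_0; simpl; lra.
- destruct (Hroot PI) as (w & Hw & E); exists w; split; [exact Hw|].
  rewrite E; unfold cis; rewrite cos_PI, sin_PI; simpl; lra.
- destruct (Hroot (PI / 2)%R) as (w & Hw & E); exists w; split; [exact Hw|].
  rewrite E; unfold cis; rewrite cos_PI2, sin_PI2; simpl; lra.
- destruct (Hroot (- (PI / 2))%R) as (w & Hw & E); exists w; split; [exact Hw|].
  rewrite E; unfold cis; rewrite cos_neg, sin_neg, cos_PI2, sin_PI2; simpl; lra.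
Qed.

Lemma Im_plus (a b : C) : Im (a + b) = (Im a + Im b)%R.
Proof. reflexivity. Qed.

(** A local form of the open mapping theorem: at a zero of finite positive order the leading term
    takes every argument on small circles, and [root_direction] picks one with negative imaginary
    part. *)
Lemma Im_nonneg_locally_zero (F : C -> C) (z0 : C) (r : R) : (0 < r)%R -> analytic_at F z0 ->
  (forall z, (Cmod (z - z0) < r)%R -> (0 <= Im (F z))%R) -> F z0 = 0 ->
  exists d, (0 < d)%R /\ forall z, (Cmod (z - z0) < d)%R -> F z = 0.
Proof.
intros Hr HF Him H0.
destruct (analytic_order _ _ HF) as [Hz|(m & G & HG & HG0 & E)]; [exact Hz|exfalso].
destruct m as [|m].
{ apply HG0; rewrite E in H0; simpl in H0; replace (G z0) with (1 * G z0) by ring; exact H0. }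
destruct (root_direction (S m) (G z0) ltac:(lia) HG0) as (w & Hw & Hneg).
destruct (analytic_ccont _ _ HG (- Im (w ^ S m * G z0))%R ltac:(lra)) as (d & Hd & HGc).
set (s := (Rmin r d / 2)%R).
assert (Hs : (0 < s /\ s < r /\ s < d)%R).
{ pose proof (Rmin_l r d); pose proof (Rmin_r r d); pose proof (Rmin_pos _ _ Hr Hd); unfold s; lra. }
destruct Hs as (Hs0 & Hsr & Hsd).
set (z := z0 + RtoC s * w).
assert (Hz : Cmod (z - z0) = s).
{ unfold z; replace (z0 + RtoC s * w - z0) with (RtoC s * w) by ring.
  rewrite Cmod_mult, Hw, Cmod_R, Rabs_pos_eq; lra. }
specialize (Him z ltac:(lra)); specialize (HGc z ltac:(lra)).
rewrite E in Him.
replace (z - z0) with (RtoC s * w) in Him by (unfold z; ring).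
rewrite Cpow_mult_l, <- RtoC_pow in Him.
replace (RtoC (s ^ S m) * w ^ S m * G z) with
  (RtoC (s ^ S m) * (w ^ S m * G z0 + w ^ S m * (G z - G z0))) in Him by ring.
assert (EIm : forall (c : R) v, Im (RtoC c * v) = (c * Im v)%R) by (intros c []; simpl; ring).
rewrite EIm, Im_plus in Him.
assert (Hb : (Im (w ^ S m * (G z - G z0)) < - Im (w ^ S m * G z0))%R).
{ eapply Rle_lt_trans; [apply Rle_abs|]; eapply Rle_lt_trans; [apply Im_le_Cmod|].
  rewrite Cmod_mult, Cmod_pow, Hw, pow1, Rmult_1_l; exact HGc. }
pose proof (pow_lt s (S m) Hs0); nra.
Qed.

(** Propagates nonvanishing from the end at [x] back to [z0]. The supremum of the zeros on the
    segment is itself a zero by continuity, and by [Im_nonneg_locally_zero] further zeros follow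
    it. *)
Lemma segment_nonzero (F : C -> C) (z0 x : C) (d : R) :
  (forall s, (0 <= s < 1)%R -> analytic_at F (z0 + RtoC s * (x - z0)) /\
     exists r, (0 < r)%R /\ forall z, (Cmod (z - (z0 + RtoC s * (x - z0))) < r)%R ->
       (0 <= Im (F z))%R) ->
  (0 < d)%R -> (forall s, (0 <= s < 1)%R -> (1 - d < s)%R -> F (z0 + RtoC s * (x - z0)) <> 0) ->
  F z0 <> 0.
Proof.
intros Hs Hd Hend H0.
set (g := fun s : R => z0 + RtoC s * (x - z0)).
assert (Hg : forall s s', (Cmod (g s - g s') = Rabs (s - s') * Cmod (x - z0))%R).
{ intros s s'; unfold g.
  replace (z0 + RtoC s * (x - z0) - (z0 + RtoC s' * (x - z0)))
    with (RtoC (s - s') * (x - z0)) by (rewrite RtoC_minus; ring).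
  rewrite Cmod_mult, Cmod_R; reflexivity. }
assert (Hnear : forall r, (0 < r)%R -> exists e, (0 < e)%R /\
  forall s s', (Rabs (s - s') < e)%R -> (Cmod (g s - g s') < r)%R).
{ intros r Hr; pose proof (Cmod_ge_0 (x - z0)) as Hc.
  exists (r / (Cmod (x - z0) + 1))%R; split; [apply Rdiv_lt_0_compat; lra|].
  intros s s' Hlt; rewrite Hg.
  apply Rle_lt_trans with (Rabs (s - s') * (Cmod (x - z0) + 1))%R.
  - apply Rmult_le_compat_l; [apply Rabs_pos | lra].
  - apply Rmult_lt_reg_r with (/ (Cmod (x - z0) + 1))%R; [apply Rinv_0_lt_compat; lra|].
    rewrite Rmult_assoc, Rinv_r by lra; unfold Rdiv in Hlt; lra. }
assert (Hg0 : g 0%R = z0) by (unfold g; ring).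
destruct (completeness (fun s => (0 <= s < 1)%R /\ F (g s) = 0)) as [S [HS1 HS2]].
{ exists 1%R; intros s [Hs1 _]; lra. }
{ exists 0%R; split; [lra|]; rewrite Hg0; exact H0. }
assert (HS0 : (0 <= S)%R) by (apply HS1; split; [lra | rewrite Hg0; exact H0]).
assert (HSd : (S <= 1 - d)%R).
{ apply HS2; intros s [Hs1 Hs2]; apply Rnot_lt_le; intros Hlt.
  exact (Hend s Hs1 Hlt Hs2). }
destruct (Hs S ltac:(lra)) as (HA & r & Hr & Him); fold (g S) in HA, Him.
assert (HFS : F (g S) = 0).
{ apply NNPP; intros Hne.
  destruct (ccont_neq0 _ _ (analytic_ccont _ _ HA) Hne) as (r' & Hr' & Hz).
  destruct (Hnear r' Hr') as (e & He & Hge).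
  assert (S <= S - e)%R; [|lra].
  apply HS2; intros s [Hs1 Hs2]; apply Rnot_lt_le; intros Hlt.
  assert (s <= S)%R by (apply HS1; split; assumption).
  apply (Hz (g s)); [apply Hge, Rabs_def1; lra | exact Hs2]. }
destruct (Im_nonneg_locally_zero F (g S) r Hr HA Him HFS) as (r' & Hr' & Hz).
destruct (Hnear r' Hr') as (e & He & Hge).
set (s := (S + Rmin e d / 2)%R).
pose proof (Rmin_l e d); pose proof (Rmin_r e d); pose proof (Rmin_pos _ _ He Hd).
assert (s <= S)%R; [|unfold s in *; lra].
apply HS1; split; [unfold s; lra|].
apply Hz, Hge, Rabs_def1; unfold s; lra.
Qed.
(** * Meromorphic germs in homogeneous coordinates *)

Definition near_upper (x : C) (A : C -> Prop) : Prop :=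
  exists r, (0 < r)%R /\ forall z, upper_half_plane z -> (Cmod (z - x) < r)%R -> A z.

Lemma near_upper_and (x : C) (A B : C -> Prop) :
  near_upper x A -> near_upper x B -> near_upper x (fun z => A z /\ B z).
Proof.
intros (r & Hr & HA) (r' & Hr' & HB); exists (Rmin r r'); split; [apply Rmin_pos; auto|].
pose proof (Rmin_l r r'); pose proof (Rmin_r r r').
intros z Hz Hzr; split; [apply HA | apply HB]; auto; lra.
Qed.

Lemma near_upper_imp (x : C) (A B : C -> Prop) :
  (forall z, upper_half_plane z -> A z -> B z) -> near_upper x A -> near_upper x B.
Proof. intros H (r & Hr & HA); exists r; split; auto. Qed.

Lemma near_upper_all (x : C) (A : C -> Prop) :
  (forall z, upper_half_plane z -> A z) -> near_upper x A.
Proof. intros H; exists 1%R; split; [lra | auto]. Qed.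

Lemma near_upper_of_near (x : C) (A : C -> Prop) (r : R) : (0 < r)%R ->
  (forall z, (Cmod (z - x) < r)%R -> A z) -> near_upper x A.
Proof. intros Hr H; exists r; split; auto. Qed.

Lemma near_upper_exists (x : C) (A : C -> Prop) (d : R) : Im x = 0%R -> (0 < d)%R ->
  near_upper x A -> exists z, upper_half_plane z /\ (Cmod (z - x) < d)%R /\ A z.
Proof.
intros Hx Hd (r & Hr & H).
pose proof (Rmin_l r d); pose proof (Rmin_r r d); pose proof (Rmin_pos _ _ Hr Hd).
assert (E : Cmod (x + RtoC (Rmin r d / 2) * Ci - x) = (Rmin r d / 2)%R).
{ replace (x + RtoC (Rmin r d / 2) * Ci - x) with (RtoC (Rmin r d / 2) * Ci) by ring.
  rewrite Cmod_mult, Cmod_Ci, Cmod_R, Rabs_pos_eq; lra. }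
assert (HU : upper_half_plane (x + RtoC (Rmin r d / 2) * Ci)).
{ unfold upper_half_plane; rewrite Im_plus, Hx; simpl; lra. }
exists (x + RtoC (Rmin r d / 2) * Ci); repeat split; [exact HU | rewrite E; lra|].
apply H; [exact HU | rewrite E; lra].
Qed.

Lemma upper_neq_real (z x : C) : Im x = 0%R -> upper_half_plane z -> z - x <> 0.
Proof.
intros Hx Hz; apply Cminus_neq0; intros ->; unfold upper_half_plane in Hz; lra.
Qed.

Lemma near_upper_zero (H : C -> C) (x : C) : Im x = 0%R -> ccont H x ->
  near_upper x (fun z => H z = 0) -> H x = 0.
Proof.
intros Hx Hc H0; apply NNPP; intros Hne.
destruct (ccont_neq0 _ _ Hc Hne) as (r & Hr & Hn).
destruct (near_upper_exists x _ r Hx Hr H0) as (z & _ & Hz & E).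
exact (Hn z Hz E).
Qed.

(** [P / Q] represents, in homogeneous coordinates, the meromorphic germ of [f] at [x]. *)
Definition rep (f : C -> C) (x : C) (P Q : C -> C) : Prop :=
  analytic_at P x /\ analytic_at Q x /\ ~ (P x = 0 /\ Q x = 0) /\
  near_upper x (fun z => Q z <> 0 /\ f z = P z / Q z).

Lemma extension_near (f F : C -> C) (x : C) :
  analytic_extension upper_half_plane f x F <->
  analytic_at F x /\ near_upper x (fun z => F z = f z).
Proof. reflexivity. Qed.

(** While the numerator vanishes at [x], one factor z - x is cancelled; the process stops either
    without a pole or with a nonzero numerator, so no common zero survives. *)
Lemma meromorphic_rep (f : C -> C) (x : C) : Im x = 0%R ->
  meromorphic_at upper_half_plane f x -> exists P Q, rep f x P Q.
Proof.
intros Hx (m & G & HG); apply extension_near in HG; destruct HG as [HG HE].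
revert G HG HE; induction m as [|m IH]; intros G HG HE.
- exists G, (fun _ => 1); repeat split; auto using analytic_const.
  + intros [_ E]; apply RtoC_inj in E; lra.
  + revert HE; apply near_upper_imp; intros z _ ->; simpl; split; [|field].
    intros E; apply RtoC_inj in E; lra.
- destruct (classic (G x = 0)) as [E0|N0].
  + destruct (analytic_quotient _ _ HG) as (G1 & HG1 & EG).
    apply (IH G1 HG1); revert HE; apply near_upper_imp; intros z Hz E.
    pose proof (upper_neq_real z x Hx Hz) as Hzx.
    rewrite EG, E0 in E; simpl in E.
    replace (G1 z) with ((0 + (z - x) * G1 z) / (z - x)) by (field; exact Hzx).
    rewrite E; field; exact Hzx.
  + exists G, (fun z => (z - x) ^ S m); repeat split; auto.
    * apply analytic_pow, analytic_minus; [apply analytic_id | apply analytic_const].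
    * tauto.
    * revert HE; apply near_upper_imp; intros z Hz E.
      pose proof (Cpow_nz _ (S m) (upper_neq_real z x Hx Hz)).
      split; [assumption|]; rewrite E; field; assumption.
Qed.

Lemma rep_order (f P Q : C -> C) (x : C) : Im x = 0%R -> rep f x P Q ->
  exists m Q1, analytic_at Q1 x /\ Q1 x <> 0 /\ (forall z, Q z = (z - x) ^ m * Q1 z) /\
    analytic_extension upper_half_plane (fun z => (z - x) ^ m * f z) x (fun z => P z / Q1 z).
Proof.
intros Hx (HP & HQ & _ & HE).
destruct (analytic_order _ _ HQ) as [(r & Hr & Hz)|(m & Q1 & HQ1 & HQ10 & E)].
- exfalso.
  destruct (near_upper_exists x _ r Hx Hr HE) as (z & _ & Hzr & Hne & _).
  exact (Hne (Hz z Hzr)).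
- exists m, Q1; repeat split; auto; [apply analytic_div; auto|].
  change (near_upper x (fun z => P z / Q1 z = (z - x) ^ m * f z)).
  destruct (ccont_neq0 _ _ (analytic_ccont _ _ HQ1) HQ10) as (r & Hr & HQ1n).
  pose proof (near_upper_and _ _ _ HE (near_upper_of_near x _ r Hr HQ1n)) as HE'.
  revert HE'; apply near_upper_imp; intros z Hz [[_ ->] Hn].
  pose proof (Cpow_nz _ m (upper_neq_real z x Hx Hz)).
  rewrite E; field; auto.
Qed.

Lemma rep_meromorphic (f P Q : C -> C) (x : C) : Im x = 0%R -> rep f x P Q ->
  meromorphic_at upper_half_plane f x.
Proof.
intros Hx Hrep; destruct (rep_order _ _ _ _ Hx Hrep) as (m & Q1 & _ & _ & _ & H).
exists m, (fun z => P z / Q1 z); exact H.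
Qed.

(** Two descriptions of the same germ agree after cross-multiplication near [x] in the half-plane,
    hence at [x] by continuity. Finite and infinite values thus become linear conditions on (P x, Q
    x), independent of the chosen extension. *)
Lemma rep_has_value (f P Q : C -> C) (x : C) (v : option C) : Im x = 0%R -> rep f x P Q ->
  has_value_at upper_half_plane f x v <->
  match v with Some w => P x = w * Q x | None => Q x = 0 end.
Proof.
intros Hx Hrep; pose proof Hrep as (HP & HQ & H0 & HE); destruct v as [w|]; simpl; split.
- intros (F & HF & HFx); apply extension_near in HF; destruct HF as [HF HFE].
  pose proof (near_upper_and _ _ _ HE HFE) as HE'.
  assert (E : F x * Q x - P x = 0).
  { apply (near_upper_zero (fun z => F z * Q z - P z)); [exact Hx| |].
    - apply analytic_ccont, analytic_minus; [apply analytic_mult; auto | exact HP].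
    - revert HE'; apply near_upper_imp; intros z _ [[Hq E1] E2]; rewrite E2, E1; field; exact Hq. }
  rewrite HFx in E; replace (P x) with (w * Q x - (w * Q x - P x)) by ring; rewrite E; ring.
- intros E; assert (HQ0 : Q x <> 0).
  { intros E'; apply H0; split; [rewrite E, E'; ring | exact E']. }
  exists (fun z => P z / Q z); split; [split; [apply analytic_div; auto|]|].
  + revert HE; apply near_upper_imp; intros z _ [_ E1]; symmetry; exact E1.
  + rewrite E; field; exact HQ0.
- intros (m & G & Hm & HG & HGx); apply extension_near in HG; destruct HG as [HG HGE].
  pose proof (near_upper_and _ _ _ HE HGE) as HE'.
  assert (E : G x * Q x - (x - x) ^ m * P x = 0).
  { apply (near_upper_zero (fun z => G z * Q z - (z - x) ^ m * P z)); [exact Hx| |].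
    - apply analytic_ccont, analytic_minus; apply analytic_mult; auto.
      apply analytic_pow, analytic_minus; [apply analytic_id | apply analytic_const].
    - revert HE'; apply near_upper_imp; intros z _ [[Hq E1] E2]; rewrite E2, E1; field; exact Hq. }
  destruct m as [|m]; [lia|]; simpl in E.
  destruct (Ceq_dec (Q x) 0) as [Hq|Hq]; [exact Hq|exfalso].
  apply (Cmult_neq_0 _ _ HGx Hq); rewrite <- E; ring.
- intros E; destruct (rep_order _ _ _ _ Hx Hrep) as (m & Q1 & HQ1 & HQ10 & EQ & H).
  exists m, (fun z => P z / Q1 z); split; [|split; [exact H|]].
  + destruct m; [|lia]; exfalso; apply HQ10; rewrite EQ in E; simpl in E.
    replace (Q1 x) with (1 * Q1 x) by ring; exact E.
  + unfold Cdiv; apply Cmult_neq_0; [intros E'; apply H0; auto|].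
    intros E'; apply (f_equal (fun y => Q1 x * y)) in E'.
    rewrite Cinv_r in E' by exact HQ10.
    replace (Q1 x * 0) with (RtoC 0) in E' by ring; apply RtoC_inj in E'; lra.
Qed.

(** * Action of Moebius maps, shears and added poles on germs *)

Lemma rep_mobius (f g P Q : C -> C) (x a b c d : C) : a * d - b * c = 1 ->
  rep f x P Q -> near_upper x (fun z => c * f z + d <> 0 /\ g z = (a * f z + b) / (c * f z + d)) ->
  rep g x (fun z => a * P z + b * Q z) (fun z => c * P z + d * Q z).
Proof.
intros Hdet (HP & HQ & H0 & HE) Hg; repeat split.
- apply analytic_plus; apply analytic_mult; auto using analytic_const.
- apply analytic_plus; apply analytic_mult; auto using analytic_const.
- intros [E1 E2]; apply H0; split.
  + replace (P x) with ((a * d - b * c) * P x) by (rewrite Hdet; ring).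
    replace ((a * d - b * c) * P x) with (d * (a * P x + b * Q x) - b * (c * P x + d * Q x)) by ring.
    rewrite E1, E2; ring.
  + replace (Q x) with ((a * d - b * c) * Q x) by (rewrite Hdet; ring).
    replace ((a * d - b * c) * Q x) with (a * (c * P x + d * Q x) - c * (a * P x + b * Q x)) by ring.
    rewrite E1, E2; ring.
- pose proof (near_upper_and _ _ _ HE Hg) as HE'; revert HE'.
  apply near_upper_imp; intros z _ [[Hq E] [Hn ->]]; rewrite E in *.
  assert (Hne : c * P z + d * Q z <> 0).
  { intros E'; apply Hn; replace (c * (P z / Q z) + d) with ((c * P z + d * Q z) / Q z)
      by (field; exact Hq).
    rewrite E'; unfold Cdiv; ring. }
  split; [exact Hne|]; field; repeat split; auto.
Qed.

Lemma rep_shear (f g P Q s : C -> C) (x : C) : analytic_at s x ->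
  rep f x P Q -> near_upper x (fun z => g z = f z + s z) ->
  rep g x (fun z => P z + s z * Q z) Q.
Proof.
intros Hs (HP & HQ & H0 & HE) Hg; repeat split; auto.
- apply analytic_plus; [exact HP | apply analytic_mult; auto].
- intros [E1 E2]; apply H0; split; [|exact E2].
  rewrite E2 in E1; rewrite <- E1; ring.
- pose proof (near_upper_and _ _ _ HE Hg) as HE'; revert HE'.
  apply near_upper_imp; intros z _ [[Hq E] ->]; split; [exact Hq|]; rewrite E; field; exact Hq.
Qed.

(** The germ takes the value [p : q] at [x], and the Wronskian of the
    representatives normalised to equal [(p, q)] at [x] is [d]; for [q = 1] this
    says [f x = p] and [f' x = d]. *)
Definition interp (f : C -> C) (x p q d : C) : Prop :=
  exists P Q, rep f x P Q /\ P x = p /\ Q x = q /\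
    exists P' Q', drv P x P' /\ drv Q x Q' /\ P' * q - p * Q' = d.

(** A determinant of two homogeneous vectors: [f] is meromorphic at [x] and its value there is a
    point other than [p : q]. *)
Definition avoid (f : C -> C) (x p q : C) : Prop :=
  exists P Q, rep f x P Q /\ P x * q - Q x * p <> 0.

(** A constant matrix multiplies the Wronskian by its determinant, so unimodular maps change the
    values but not the slope datum [e]. *)
Lemma interp_mobius (f g : C -> C) (x p q e a b c d : C) : a * d - b * c = 1 ->
  near_upper x (fun z => c * f z + d <> 0 /\ g z = (a * f z + b) / (c * f z + d)) ->
  interp f x p q e -> interp g x (a * p + b * q) (c * p + d * q) e.
Proof.
intros Hdet Hg (P & Q & Hrep & HPx & HQx & P' & Q' & HP' & HQ' & HW).
exists (fun z => a * P z + b * Q z), (fun z => c * P z + d * Q z).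
split; [apply (rep_mobius f); auto|].
rewrite HPx, HQx; repeat split.
exists (a * P' + b * Q'), (c * P' + d * Q').
assert (Hlin : forall u v, drv (fun z => u * P z + v * Q z) x (u * P' + v * Q')).
{ intros u v.
  replace (u * P' + v * Q') with ((0 * P x + u * P') + (0 * Q x + v * Q')) by ring.
  apply (drv_plus (fun z => u * P z) (fun z => v * Q z));
    apply (drv_mult (fun _ => _)); auto using drv_const. }
repeat split; try apply Hlin.
rewrite <- HW; replace (P' * q - p * Q') with ((a * d - b * c) * (P' * q - p * Q'))
  by (rewrite Hdet; ring); ring.
Qed.

Lemma avoid_mobius (f g : C -> C) (x p q a b c d : C) : a * d - b * c = 1 ->
  near_upper x (fun z => c * f z + d <> 0 /\ g z = (a * f z + b) / (c * f z + d)) ->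
  avoid f x p q -> avoid g x (a * p + b * q) (c * p + d * q).
Proof.
intros Hdet Hg (P & Q & Hrep & Hne).
exists (fun z => a * P z + b * Q z), (fun z => c * P z + d * Q z).
split; [apply (rep_mobius f); auto|]; intros E; apply Hne.
replace (P x * q - Q x * p) with ((a * d - b * c) * (P x * q - Q x * p)) by (rewrite Hdet; ring).
rewrite <- E; ring.
Qed.

(** The Wronskian of (P + s Q, Q) is that of (P, Q) plus s' Q^2. *)
Lemma interp_shear (f g s : C -> C) (x p q e s' : C) : drv s x s' ->
  near_upper x (fun z => g z = f z + s z) ->
  interp f x p q e -> interp g x (p + s x * q) q (e + q * q * s').
Proof.
intros Hs Hg (P & Q & Hrep & HPx & HQx & P' & Q' & HP' & HQ' & HW).
exists (fun z => P z + s z * Q z), Q.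
split; [apply (rep_shear f); auto; apply (drv_analytic _ _ _ Hs)|].
rewrite HPx, HQx; repeat split.
exists (P' + (s' * Q x + s x * Q')), Q'; split; [|split; [exact HQ'|]].
- apply (drv_plus P (fun z => s z * Q z)); [exact HP' | apply (drv_mult s Q); auto].
- rewrite <- HW, HQx; ring.
Qed.

Lemma avoid_shear (f g s : C -> C) (x p q : C) : analytic_at s x ->
  near_upper x (fun z => g z = f z + s z) ->
  avoid f x p q -> avoid g x (p + s x * q) q.
Proof.
intros Hs Hg (P & Q & Hrep & Hne).
exists (fun z => P z + s z * Q z), Q.
split; [apply (rep_shear f); auto|]; intros E; apply Hne; rewrite <- E; ring.
Qed.

(** With value (a, 0) the Wronskian is - a Q', so the slope t a^2 says that Q' = - t a, that is,
    that [F] has a simple pole of residue - 1 / t. This is exactly the pole cancelled in [g]: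
    writing Q = (z - x) Q1, the numerator t P + Q1 vanishes at [x]. *)
Lemma avoid_pole (F g : C -> C) (x a t : C) : a <> 0 -> t <> 0 -> Im x = 0%R ->
  near_upper x (fun z => g z = F z + 1 / (t * (z - x))) ->
  interp F x a 0 (t * (a * a)) -> avoid g x 1 0.
Proof.
intros Ha Ht Hx Hg (P & Q & (HP & HQ & H0 & HE) & HPx & HQx & P' & Q' & HP' & HQ' & HW).
destruct (analytic_quotient _ _ HQ) as (Q1 & HQ1 & EQ).
assert (EQ1 : Q1 x = Q').
{ apply (drv_unique Q x); [|exact HQ'].
  exists Q1, 1%R; repeat split; auto; lra. }
assert (EQ' : Q' = - (t * a)).
{ replace Q' with (- ((P' * 0 - a * Q') / - a) * - (1)) by (field; exact Ha).
  rewrite HW; field; exact Ha. }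
assert (HN : analytic_at (fun z => t * P z + Q1 z) x).
{ apply analytic_plus; [apply analytic_mult; auto using analytic_const | exact HQ1]. }
destruct (analytic_quotient _ _ HN) as (R & HR & ER).
assert (E0 : t * P x + Q1 x = 0) by (rewrite HPx, EQ1, EQ'; ring).
exists R, (fun z => t * Q1 z).
assert (HS : t * Q1 x <> 0).
{ rewrite EQ1, EQ'; replace (t * - (t * a)) with (- (t * (t * a))) by ring.
  intros E; apply (Cmult_neq_0 _ _ Ht (Cmult_neq_0 _ _ Ht Ha)).
  replace (t * (t * a)) with (- - (t * (t * a))) by ring; rewrite E; ring. }
split; [split; [exact HR|split; [|split]]|].
- apply analytic_mult; auto using analytic_const.
- tauto.
- pose proof (near_upper_and _ _ _ HE Hg) as HE'; revert HE'.
  apply near_upper_imp; intros z Hz [[Hq E] ->].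
  pose proof (upper_neq_real z x Hx Hz) as Hzx.
  rewrite EQ, HQx in Hq, E.
  assert (HQ1z : Q1 z <> 0) by (intros E'; apply Hq; rewrite E'; ring).
  split; [apply Cmult_neq_0; assumption|].
  specialize (ER z); rewrite E0 in ER.
  rewrite E.
  replace (P z / (0 + (z - x) * Q1 z) + 1 / (t * (z - x))) with
    ((t * P z + Q1 z) / (t * (z - x) * Q1 z)) by (field; auto).
  rewrite ER; field; auto.
- intros E; apply HS; replace (t * Q1 x) with (- (R x * 0 - t * Q1 x * 1)) by ring.
  rewrite E; ring.
Qed.

Lemma interp_pole (F g : C -> C) (x a t : C) : a <> 0 -> t <> 0 -> Im x = 0%R ->
  near_upper x (fun z => F z = g z - 1 / (t * (z - x))) ->
  avoid g x 1 0 -> interp F x a 0 (t * (a * a)).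
Proof.
intros Ha Ht Hx HF (R & S & (HR & HS & H0 & HE) & Hne).
assert (HSx : S x <> 0) by (intros E; apply Hne; rewrite E; ring).
(* Homogeneous coordinates are free up to a factor; this one normalises the value of the
   representative at [x] to (a, 0). *)
set (l := - a / S x).
assert (Hl : l * S x = - a) by (unfold l; field; exact HSx).
clearbody l.
destruct (drv_exists _ _ HR) as [R' HR'], (drv_exists _ _ HS) as [S' HS'].
assert (Hzx : drv (fun z => z - x) x 1).
{ replace (RtoC 1) with (1 + 0) at 1 by ring.
  apply (drv_plus (fun z => z) (fun _ => - x)); [apply drv_id | apply drv_const]. }
assert (HP' : drv (fun z => (l * t) * ((z - x) * R z) + (- l) * S z) x
  ((l * t) * R x + (- l) * S')).
{ replace ((l * t) * R x + - l * S') with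
    ((0 * ((x - x) * R x) + (l * t) * (1 * R x + (x - x) * R')) + (0 * S x + (- l) * S')) by ring.
  apply (drv_plus (fun z => (l * t) * ((z - x) * R z)) (fun z => - l * S z)).
  - apply (drv_mult (fun _ => l * t) (fun z => (z - x) * R z)); [apply drv_const|].
    apply (drv_mult (fun z => z - x) R); assumption.
  - apply (drv_mult (fun _ => - l) S); [apply drv_const | assumption]. }
assert (HQ' : drv (fun z => (l * t) * ((z - x) * S z)) x ((l * t) * S x)).
{ replace ((l * t) * S x) with
    (0 * ((x - x) * S x) + (l * t) * (1 * S x + (x - x) * S')) by ring.
  apply (drv_mult (fun _ => l * t) (fun z => (z - x) * S z)); [apply drv_const|].
  apply (drv_mult (fun z => z - x) S); assumption. }
assert (EP : (l * t) * ((x - x) * R x) + (- l) * S x = a).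
{ replace ((l * t) * ((x - x) * R x) + (- l) * S x) with (- (l * S x)) by ring; rewrite Hl; ring. }
assert (Hl0 : l <> 0).
{ intros E; rewrite E in Hl; apply Ha; replace a with (- - a) by ring; rewrite <- Hl; ring. }
exists (fun z => (l * t) * ((z - x) * R z) + (- l) * S z), (fun z => (l * t) * ((z - x) * S z)).
split; [split; [|split; [|split]]|].
- exact (drv_analytic _ _ _ HP').
- exact (drv_analytic _ _ _ HQ').
- rewrite EP; tauto.
- pose proof (near_upper_and _ _ _ HE HF) as HE'; revert HE'.
  apply near_upper_imp; intros z Hz [[Hs E] ->].
  pose proof (upper_neq_real z x Hx Hz) as Hzx'.
  split; [repeat apply Cmult_neq_0; assumption|].
  rewrite E; field; repeat split; assumption.
- split; [exact EP|]; split; [ring|].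
  exists ((l * t) * R x + (- l) * S'), ((l * t) * S x); repeat split; try assumption.
  replace ((l * t * R x + - l * S') * 0 - a * (l * t * S x)) with (- (a * t * (l * S x))) by ring.
  rewrite Hl; ring.
Qed.
(** * The Pick class *)

Lemma Im_pole (z : C) (x t : R) : upper_half_plane z -> (t <> 0)%R ->
  (Im (1 / (RtoC t * (z - RtoC x))) * (t * dist2 z (RtoC x)) = - Im z)%R.
Proof.
destruct z as [u v]; unfold upper_half_plane; simpl; intros Hv Ht.
unfold dist2, Cdiv, Cinv; simpl.
field.
assert (H : (0 < (u - x) ^ 2 + v ^ 2)%R) by (pose proof (pow2_ge_0 (u - x)); nra).
assert (H' : (0 < t * t)%R) by nra.
pose proof (Rmult_lt_0_compat _ _ H' H); apply Rgt_not_eq; nra.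
Qed.

Lemma dist2_pos (z : C) (x : R) : upper_half_plane z -> (0 < dist2 z (RtoC x))%R.
Proof.
intros Hz; unfold upper_half_plane, dist2 in *; simpl.
pose proof (pow2_ge_0 (Re z - x)); nra.
Qed.

Lemma Im_pole_neg (z : C) (x t : R) : upper_half_plane z -> (0 < t)%R ->
  (Im (1 / (RtoC t * (z - RtoC x))) < 0)%R.
Proof.
intros Hz Ht; pose proof (Im_pole z x t Hz (Rgt_not_eq _ _ Ht)) as E.
pose proof (dist2_pos z x Hz) as Hd; unfold upper_half_plane in Hz.
pose proof (Rmult_lt_0_compat _ _ Ht Hd); nra.
Qed.

(** Approach [x] along [x + e + i e^3], where the Poisson kernel is small. *)
Lemma boundary_Im_nonneg (H : C -> C) (x t : R) : (0 < t)%R -> ccont H (RtoC x) ->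
  near_upper (RtoC x) (fun z => - Im z <= Im (H z) * (t * dist2 z (RtoC x)))%R ->
  (0 <= Im (H (RtoC x)))%R.
Proof.
intros Ht Hc (r & Hr & Hlow); apply Rnot_lt_le; intros Hneg.
set (m := (- Im (H (RtoC x)) / 2)%R).
assert (Hm : (0 < m)%R) by (unfold m; lra).
destruct (Hc m Hm) as (d & Hd & Hnear).
assert (Hmt : (0 < m * t)%R) by (apply Rmult_lt_0_compat; auto).
set (e := (Rmin (Rmin (Rmin r d) 1) (m * t) / 4)%R).
assert (He : (0 < e /\ 4 * e <= r /\ 4 * e <= d /\ 4 * e <= 1 /\ 4 * e <= m * t)%R).
{ pose proof (Rmin_l (Rmin (Rmin r d) 1) (m * t)); pose proof (Rmin_r (Rmin (Rmin r d) 1) (m * t)).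
  pose proof (Rmin_l (Rmin r d) 1); pose proof (Rmin_r (Rmin r d) 1).
  pose proof (Rmin_l r d); pose proof (Rmin_r r d).
  assert (0 < Rmin (Rmin (Rmin r d) 1) (m * t))%R by (repeat apply Rmin_pos; lra).
  unfold e; lra. }
destruct He as (He & Her & Hed & He1 & Hem).
assert (He3 : (0 < e ^ 3 <= e)%R) by (split; [apply pow_lt, He | simpl; nra]).
set (z := ((x + e)%R, (e ^ 3)%R) : C).
assert (Hz : upper_half_plane z) by (unfold upper_half_plane; simpl; simpl in He3; lra).
assert (Hzx : (Cmod (z - RtoC x) <= 2 * e)%R).
{ eapply Rle_trans; [apply Cmod_le_abs|]; unfold z; simpl.
  rewrite !Rabs_pos_eq by (simpl in He3; lra); simpl in He3; lra. }
specialize (Hlow z Hz ltac:(lra)); specialize (Hnear z ltac:(lra)).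
pose proof (Im_le_Cmod (H z - H (RtoC x))) as B; rewrite Im_minus in B.
pose proof (Rabs_def2 _ _ (Rle_lt_trans _ _ _ B Hnear)) as [B1 _].
assert (Hq : (e ^ 2 <= dist2 z (RtoC x))%R).
{ unfold dist2, z; simpl; pose proof (pow2_ge_0 (e ^ 3)); simpl in *; nra. }
assert (Hh : (Im (H z) < - m)%R) by (unfold m in *; lra).
assert (Im (H z) * (t * dist2 z (RtoC x)) <= - m * (t * e ^ 2))%R.
{ assert (0 <= e ^ 2)%R by apply pow2_ge_0.
  assert (t * e ^ 2 <= t * dist2 z (RtoC x))%R by (apply Rmult_le_compat_l; lra).
  assert (0 <= t * e ^ 2)%R by (apply Rmult_le_pos; lra).
  set (B' := (t * dist2 z (RtoC x))%R) in *; set (C' := (t * e ^ 2)%R) in *.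
  assert (Im (H z) * B' <= - m * B')%R by (apply Rmult_le_compat_r; lra).
  assert (- m * B' <= - m * C')%R by (apply Rmult_le_compat_neg_l; lra); lra. }
change (Im z) with (e ^ 3)%R in Hlow.
assert (m * t * e ^ 2 <= e * e ^ 2)%R by (simpl in *; lra).
assert (0 < e ^ 2)%R by (apply pow_lt, He).
nra.
Qed.

Lemma avoid_infinity_extension (g : C -> C) (x : C) : avoid g x 1 0 ->
  exists H, analytic_at H x /\ near_upper x (fun z => H z = g z).
Proof.
intros (R & S & (HR & HS & _ & HE) & Hne).
exists (fun z => R z / S z); split.
- apply analytic_div; auto; intros E; apply Hne; rewrite E; ring.
- revert HE; apply near_upper_imp; intros z _ [_ E]; symmetry; exact E.
Qed.

Lemma pick_analytic_eq (f g : C -> C) : (forall z, upper_half_plane z -> f z = g z) ->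
  analytic_on upper_half_plane f -> analytic_on upper_half_plane g.
Proof.
intros E Hf z Hz; apply analytic_ext with f (Im z); auto.
intros w Hw; apply E; unfold upper_half_plane.
pose proof (Im_le_Cmod (w - z)) as B; rewrite Im_minus in B.
pose proof (Rabs_def2 _ _ (Rle_lt_trans _ _ _ B Hw)); lra.
Qed.

Lemma analytic_pole (x t : R) (z : C) : t <> 0%R -> z <> RtoC x ->
  analytic_at (fun z => 1 / (RtoC t * (z - RtoC x))) z.
Proof.
intros Ht Hz; apply analytic_div; [apply analytic_const| |].
- apply analytic_mult; [apply analytic_const | apply analytic_minus];
    [apply analytic_id | apply analytic_const].
- apply Cmult_neq_0; [intros E; apply RtoC_inj in E; contradiction | apply Cminus_neq0, Hz].
Qed.

Lemma upper_neq_RtoC (z : C) (x : R) : upper_half_plane z -> z <> RtoC x.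
Proof. intros Hz ->; unfold upper_half_plane in Hz; simpl in Hz; lra. Qed.

(** Julia's lemma: [1 / (t (z - x))] has a Poisson kernel as its imaginary part, so
    adding it to [F] can only make the imaginary part negative at [x], where the
    poles cancel. *)
Lemma pick_remove_pole (F g : C -> C) (x a t : R) : a <> 0%R -> (0 < t)%R -> pick_class F ->
  interp F (RtoC x) (RtoC a) 0 (RtoC t * (RtoC a * RtoC a)) ->
  (forall z, upper_half_plane z -> g z = F z + 1 / (RtoC t * (z - RtoC x))) ->
  pick_class g.
Proof.
intros Ha Ht [HF HFim] Hint Hg.
assert (Hav : avoid g (RtoC x) 1 0).
{ apply (avoid_pole F g (RtoC x) (RtoC a) (RtoC t)); auto.
  - intros E; apply RtoC_inj in E; contradiction.
  - intros E; apply RtoC_inj in E; lra.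
  - apply near_upper_all, Hg. }
destruct (avoid_infinity_extension _ _ Hav) as (H & HH & (r & Hr & HE)).
assert (Hlow : forall z, upper_half_plane z ->
  (- Im z <= Im (g z) * (t * dist2 z (RtoC x)))%R).
{ intros z Hz; rewrite Hg, Im_plus, Rmult_plus_distr_r by exact Hz.
  rewrite Im_pole by (auto; lra).
  pose proof (HFim z Hz) as HF0; pose proof (dist2_pos z x Hz).
  assert (0 <= Im (F z) * (t * dist2 z (RtoC x)))%R; [|lra].
  apply Rmult_le_pos; [exact HF0 | apply Rmult_le_pos; lra]. }
assert (Hga : analytic_on upper_half_plane g).
{ apply (pick_analytic_eq (fun z => F z + 1 / (RtoC t * (z - RtoC x)))).
  - intros z Hz; symmetry; auto.
  - intros z Hz; apply analytic_plus; [apply HF, Hz|].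
    apply analytic_pole; [lra | apply upper_neq_RtoC, Hz]. }
split; [exact Hga|].
apply (Im_nonneg_poisson g H (RtoC x) t r); auto.
- apply analytic_ccont, HH.
- apply (boundary_Im_nonneg H x t Ht); [apply analytic_ccont, HH|].
  exists r; split; [exact Hr|]; intros z Hz Hzr; rewrite HE; auto.
Qed.

(** The added term has strictly positive imaginary part; the resulting nonvanishing of [F] is what
    makes an augmentation at a finite value well defined. *)
Lemma pick_add_pole (g F : C -> C) (x t : R) : (0 < t)%R -> pick_class g ->
  (forall z, upper_half_plane z -> F z = g z - 1 / (RtoC t * (z - RtoC x))) ->
  pick_class F /\ forall z, upper_half_plane z -> F z <> 0.
Proof.
intros Ht [Hg Hgim] HF.
assert (Hpos : forall z, upper_half_plane z -> (0 < Im (F z))%R).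
{ intros z Hz; rewrite HF, Im_minus by exact Hz.
  pose proof (Im_pole_neg z x t Hz Ht); specialize (Hgim z Hz); lra. }
split; [split|].
- apply (pick_analytic_eq (fun z => g z - 1 / (RtoC t * (z - RtoC x)))).
  + intros z Hz; symmetry; auto.
  + intros z Hz; apply analytic_minus; [apply Hg, Hz|].
    apply analytic_pole; [lra | apply upper_neq_RtoC, Hz].
- intros z Hz; apply Rlt_le; auto.
- intros z Hz E; specialize (Hpos z Hz); rewrite E in Hpos; simpl in Hpos; lra.
Qed.

Lemma Im_mobius_inv (w : C) : w <> 0 -> (0 <= Im w)%R -> (0 <= Im (- (1) / w))%R.
Proof.
intros Hw Hi; destruct w as [u v]; unfold Cdiv, Cinv; simpl in *.
assert (H : (0 < u * (u * 1) + v * (v * 1))%R).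
{ assert (~ (u = 0 /\ v = 0))%R by (intros [-> ->]; apply Hw; reflexivity).
  pose proof (pow2_ge_0 u); pose proof (pow2_ge_0 v).
  destruct (Req_dec u 0); destruct (Req_dec v 0); [tauto| | |]; simpl in *; nra. }
replace (- (1) * (- v / (u * (u * 1) + v * (v * 1))) + -0 * (u / (u * (u * 1) + v * (v * 1))))%R
  with (v / (u * (u * 1) + v * (v * 1)))%R by (field; lra).
apply Rmult_le_pos; [exact Hi | apply Rlt_le, Rinv_0_lt_compat, H].
Qed.

Lemma pick_neg_inv (f : C -> C) (s : R) (F : C -> C) : pick_class f ->
  (forall z, upper_half_plane z -> f z - RtoC s <> 0) ->
  (forall z, upper_half_plane z -> F z = - (1) / (f z - RtoC s)) -> pick_class F.
Proof.
intros [Hf Him] Hne HF; split.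
- apply (pick_analytic_eq (fun z => - (1) / (f z - RtoC s))).
  + intros z Hz; symmetry; auto.
  + intros z Hz; apply analytic_div; [apply analytic_const| |auto].
    apply analytic_minus; [apply Hf, Hz | apply analytic_const].
- intros z Hz; rewrite HF by exact Hz; apply Im_mobius_inv; [auto|].
  rewrite Im_minus; simpl; specialize (Him z Hz); lra.
Qed.

(** Allows -1 / (f - p/q) on the whole half-plane. The nonzero slope makes [x] a simple zero of P -
    (p/q) Q, so f - p/q has no zero in the half-plane near [x], and [segment_nonzero] carries this
    to an arbitrary point. *)
Lemma pick_neq_real (f : C -> C) (x p q d : R) : pick_class f -> q <> 0%R -> d <> 0%R ->
  interp f (RtoC x) (RtoC p) (RtoC q) (RtoC d) ->
  forall z, upper_half_plane z -> f z - RtoC (p / q) <> 0.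
Proof.
intros [Hf Him] Hq Hd (P & Q & (HP & HQ & _ & HE) & HPx & HQx & P' & Q' & HP' & HQ' & HW) z0 Hz0.
assert (Hqc : RtoC q <> 0) by (intros E; apply RtoC_inj in E; contradiction).
assert (HN : analytic_at (fun z => P z + - RtoC (p / q) * Q z) (RtoC x)).
{ apply analytic_plus; [exact HP | apply analytic_mult; [apply analytic_const | exact HQ]]. }
assert (HNx : P (RtoC x) + - RtoC (p / q) * Q (RtoC x) = 0).
{ rewrite HPx, HQx, RtoC_div by exact Hq; field; exact Hqc. }
assert (HN' : drv (fun z => P z + - RtoC (p / q) * Q z) (RtoC x)
  (P' + (0 * Q (RtoC x) + - RtoC (p / q) * Q'))).
{ apply (drv_plus P); [exact HP'|]; apply (drv_mult (fun _ => _) Q); [apply drv_const | exact HQ']. }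
destruct (analytic_quotient _ _ HN) as (G & HG & EG).
(* [G] takes at [x] the value P' - (p/q) Q', which is d / q. *)
assert (HGx : G (RtoC x) <> 0).
{ assert (E : G (RtoC x) = P' + (0 * Q (RtoC x) + - RtoC (p / q) * Q')).
  { apply (drv_unique (fun z => P z + - RtoC (p / q) * Q z) (RtoC x)); [|exact HN'].
    exists G, 1%R; repeat split; auto; lra. }
  intros E0; rewrite E, RtoC_div in E0 by exact Hq.
  apply Hd, RtoC_inj; rewrite <- HW.
  replace (P' * RtoC q - RtoC p * Q') with
    (RtoC q * (P' + (0 * Q (RtoC x) + - (RtoC p / RtoC q) * Q'))) by (field; exact Hqc).
  rewrite E0; ring. }
destruct (ccont_neq0 _ _ (analytic_ccont _ _ HG) HGx) as (r & Hr & HGn).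
destruct (near_upper_and _ _ _ HE (near_upper_of_near _ _ r Hr HGn)) as (r' & Hr' & Hnear).
assert (HU : forall s, (0 <= s < 1)%R -> upper_half_plane (z0 + RtoC s * (RtoC x - z0))).
{ intros s Hs; unfold upper_half_plane in *; rewrite Im_plus; destruct z0; simpl in *; nra. }
pose proof (Cmod_ge_0 (z0 - RtoC x)) as Hc0.
apply (segment_nonzero (fun z => f z - RtoC (p / q)) z0 (RtoC x) (r' / (Cmod (z0 - RtoC x) + 1))).
- intros s Hs; specialize (HU s Hs); split.
  + apply analytic_minus; [apply Hf, HU | apply analytic_const].
  + exists (Im (z0 + RtoC s * (RtoC x - z0))); split; [exact HU|].
    intros z Hz; rewrite Im_minus; simpl (Im (RtoC _)); rewrite Rminus_0_r; apply Him.
    pose proof (Im_le_Cmod (z - (z0 + RtoC s * (RtoC x - z0)))) as B; rewrite Im_minus in B.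
    pose proof (Rabs_def2 _ _ (Rle_lt_trans _ _ _ B Hz)); unfold upper_half_plane; lra.
- apply Rdiv_lt_0_compat; lra.
- intros s Hs Hs1; set (z := z0 + RtoC s * (RtoC x - z0)) in *.
  destruct (Hnear z (HU s Hs)) as [[HQz Ez] HGz].
  { replace (z - RtoC x) with (RtoC (1 - s) * (z0 - RtoC x))
      by (unfold z; rewrite RtoC_minus; ring).
    rewrite Cmod_mult, Cmod_R, Rabs_pos_eq by lra.
    apply Rle_lt_trans with ((1 - s) * (Cmod (z0 - RtoC x) + 1))%R; [apply Rmult_le_compat_l; lra|].
    apply Rmult_lt_reg_r with (/ (Cmod (z0 - RtoC x) + 1))%R; [apply Rinv_0_lt_compat; lra|].
    rewrite Rmult_assoc, Rinv_r by lra; unfold Rdiv in Hs1; lra. }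
  rewrite Ez; specialize (EG z); rewrite HNx in EG.
  replace (P z / Q z - RtoC (p / q)) with ((P z + - RtoC (p / q) * Q z) / Q z) by (field; exact HQz).
  rewrite EG; unfold Cdiv.
  replace ((0 + (z - RtoC x) * G z) * / Q z) with ((z - RtoC x) * (G z * / Q z)) by ring.
  apply Cmult_neq_0; [apply Cminus_neq0, upper_neq_RtoC, HU, Hs|].
  apply Cmult_neq_0; [exact HGz|].
  intros E; apply (f_equal (fun y => Q z * y)) in E; rewrite Cinv_r in E by exact HQz.
  replace (Q z * 0) with (RtoC 0) in E by ring; apply RtoC_inj in E; lra.
Qed.
(** * One step of the boundary Schur algorithm *)

(** Values in the extended real line are given by homogeneous coordinates [u j].
    Boundary data at the nodes [x 1 .. x n]: the nodes from [k] on carry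
    interpolation conditions, the others carry the value to be avoided. *)
Definition solves (x : nat -> R) (n k : nat) (u : nat -> R * R) (d : nat -> R)
    (f : C -> C) : Prop :=
  pick_class f /\ forall j, (1 <= j <= n)%nat ->
    if (k <=? j)%nat
    then interp f (RtoC (x j)) (RtoC (fst (u j))) (RtoC (snd (u j))) (RtoC (d j))
    else avoid f (RtoC (x j)) (RtoC (fst (u j))) (RtoC (snd (u j))).

Definition lin (a b c e : R) (v : R * R) : R * R :=
  ((a * fst v + b * snd v)%R, (c * fst v + e * snd v)%R).

Lemma solves_mobius (x : nat -> R) (n k : nat) (u : nat -> R * R) (d : nat -> R)
    (a b c e : R) (f g : C -> C) :
  (a * e - b * c = 1)%R -> pick_class g ->
  (forall z, upper_half_plane z ->
     RtoC c * f z + RtoC e <> 0 /\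
     g z = (RtoC a * f z + RtoC b) / (RtoC c * f z + RtoC e)) ->
  solves x n k u d f -> solves x n k (fun j => lin a b c e (u j)) d g.
Proof.
intros Hdet Hg E [_ Hf]; split; [exact Hg|]; intros j Hj; specialize (Hf j Hj).
assert (HdetC : RtoC a * RtoC e - RtoC b * RtoC c = 1).
{ rewrite <- !RtoC_mult, <- RtoC_minus, Hdet; reflexivity. }
unfold lin; simpl fst; simpl snd; rewrite !RtoC_plus, !RtoC_mult.
pose proof (near_upper_all (RtoC (x j)) _ E) as EN.
destruct (k <=? j)%nat.
- apply (interp_mobius f); assumption.
- apply (avoid_mobius f); assumption.
Qed.

Lemma solves_ext (x : nat -> R) (n k : nat) (u u' : nat -> R * R) (d d' : nat -> R)
    (f : C -> C) :
  (forall j, u j = u' j) -> (forall j, d j = d' j) ->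
  solves x n k u d f -> solves x n k u' d' f.
Proof.
intros Eu Ed [Hf H]; split; [exact Hf|]; intros j Hj; rewrite <- Eu, <- Ed; exact (H j Hj).
Qed.

(** Effect on the values of adding 1 / (t (z - x_k)). At the node [k] itself the new datum is the
    point at infinity, the value that the reduced function must avoid. *)
Definition shear_u (x : nat -> R) (k : nat) (t : R) (v : nat -> R * R) (j : nat) : R * R :=
  if (j =? k)%nat then (1%R, 0%R)
  else ((fst (v j) + snd (v j) / (t * (x j - x k)))%R, snd (v j)).

(** The subtracted term comes from the derivative of the added pole, weighted by q^2. At [j = k] the
    formula divides by zero; slopes of removed nodes are never consulted again. *)
Definition shear_d (x : nat -> R) (k : nat) (t : R) (v : nat -> R * R) (d : nat -> R)
    (j : nat) : R :=
  (d j - snd (v j) ^ 2 / (t * (x j - x k) ^ 2))%R.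

Lemma drv_pole (t x : R) (y : R) : t <> 0%R -> y <> x ->
  drv (fun z => 1 / (RtoC t * (z - RtoC x))) (RtoC y) (RtoC (- (1 / (t * (y - x) ^ 2)))).
Proof.
intros Ht Hy.
assert (Htc : RtoC t <> 0) by (intros E; apply RtoC_inj in E; contradiction).
assert (Hyc : RtoC y - RtoC x <> 0).
{ apply Cminus_neq0; intros E; apply RtoC_inj in E; contradiction. }
assert (Hyr : (y - x <> 0)%R) by lra.
replace (RtoC (- (1 / (t * (y - x) ^ 2)))) with
  ((0 * (RtoC t * (RtoC y - RtoC x)) - 1 * (RtoC t * 1)) /
   ((RtoC t * (RtoC y - RtoC x)) * (RtoC t * (RtoC y - RtoC x)))).
- apply (drv_div (fun _ => 1) (fun z => RtoC t * (z - RtoC x))).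
  + apply Cmult_neq_0; assumption.
  + apply drv_const.
  + replace (RtoC t * 1) with (0 * (RtoC y - RtoC x) + RtoC t * (1 + 0)) by ring.
    apply (drv_mult (fun _ => RtoC t) (fun z => z - RtoC x)); [apply drv_const|].
    apply (drv_plus (fun z => z) (fun _ => - RtoC x)); [apply drv_id | apply drv_const].
- rewrite RtoC_opp, RtoC_div, RtoC_mult, RtoC_pow, RtoC_minus.
  + field; auto.
  + apply Rmult_integral_contrapositive; split; [exact Ht | apply pow_nonzero, Hyr].
Qed.

Lemma drv_pole_neg (t x : R) (y : R) : t <> 0%R -> y <> x ->
  drv (fun z => - (1 / (RtoC t * (z - RtoC x)))) (RtoC y) (RtoC (1 / (t * (y - x) ^ 2))).
Proof.
intros Ht Hy.
apply (drv_ext (fun z => - (1) * (1 / (RtoC t * (z - RtoC x)))) _ _ _ 1%R); [lra | intros; ring|].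
replace (RtoC (1 / (t * (y - x) ^ 2))) with
  (0 * (1 / (RtoC t * (RtoC y - RtoC x))) + - (1) * RtoC (- (1 / (t * (y - x) ^ 2)))).
- apply (drv_mult (fun _ => - (1)) (fun z => 1 / (RtoC t * (z - RtoC x))));
    [apply drv_const | apply drv_pole; assumption].
- rewrite RtoC_opp; ring.
Qed.

Section OneNode.
Variables (x : nat -> R) (n k : nat).
Hypothesis (Hk : (1 <= k <= n)%nat).
Hypothesis (Hx : forall i j, (1 <= i <= n)%nat -> (1 <= j <= n)%nat -> i <> j -> x i <> x j).

Lemma solves_remove_pole (v : nat -> R * R) (d : nat -> R) (a t : R) (F g : C -> C) :
  v k = (a, 0%R) -> a <> 0%R -> (0 < t)%R -> d k = (t * (a * a))%R ->
  (forall z, upper_half_plane z -> g z = F z + 1 / (RtoC t * (z - RtoC (x k)))) ->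
  solves x n k v d F ->
  solves x n (S k) (shear_u x k t v) (shear_d x k t v d) g.
Proof.
intros Hvk Ha Ht Hdk Hg [HF H].
assert (Hac : RtoC a <> 0) by (intros E; apply RtoC_inj in E; contradiction).
assert (Htc : RtoC t <> 0) by (intros E; apply RtoC_inj in E; lra).
assert (Hint : interp F (RtoC (x k)) (RtoC a) 0 (RtoC t * (RtoC a * RtoC a))).
{ specialize (H k Hk); rewrite Nat.leb_refl, Hvk, Hdk, !RtoC_mult in H; exact H. }
split; [apply (pick_remove_pole F g (x k) a t); auto|].
intros j Hj; unfold shear_u, shear_d.
destruct (Nat.eqb_spec j k) as [->|Hjk].
- destruct (Nat.leb_spec (S k) k); [lia|].
  apply (avoid_pole F g (RtoC (x k)) (RtoC a) (RtoC t)); auto.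
  apply near_upper_all, Hg.
- specialize (H j Hj).
  assert (Hxj : x j <> x k) by (apply Hx; auto).
  assert (Hden : (t * (x j - x k) <> 0)%R) by (apply Rmult_integral_contrapositive; lra).
  assert (E1 : RtoC (fst (v j) + snd (v j) / (t * (x j - x k))) =
    RtoC (fst (v j)) + 1 / (RtoC t * (RtoC (x j) - RtoC (x k))) * RtoC (snd (v j))).
  { rewrite RtoC_plus, RtoC_div, RtoC_mult, RtoC_minus by exact Hden.
    field; split; [|exact Htc]; apply Cminus_neq0; intros E; apply RtoC_inj in E; contradiction. }
  simpl fst; simpl snd; rewrite E1.
  pose proof (drv_pole t (x k) (x j) ltac:(lra) Hxj) as Hdrv.
  assert (EN : near_upper (RtoC (x j))
    (fun z => g z = F z + 1 / (RtoC t * (z - RtoC (x k))))) by apply near_upper_all, Hg.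
  replace (S k <=? j)%nat with (k <=? j)%nat.
  2: { destruct (Nat.leb_spec k j), (Nat.leb_spec (S k) j); auto; lia. }
  destruct (k <=? j)%nat.
  + replace (RtoC (d j - snd (v j) ^ 2 / (t * (x j - x k) ^ 2))) with
      (RtoC (d j) + RtoC (snd (v j)) * RtoC (snd (v j)) * RtoC (- (1 / (t * (x j - x k) ^ 2)))).
    * apply (interp_shear F g _ _ _ _ _ _ Hdrv EN H).
    * rewrite <- !RtoC_mult, <- RtoC_plus; f_equal; field; split; lra.
  + apply (avoid_shear F g (fun z => 1 / (RtoC t * (z - RtoC (x k))))); auto.
    apply (drv_analytic _ _ _ Hdrv).
Qed.

Lemma solves_add_pole (v : nat -> R * R) (d : nat -> R) (a t : R) (F g : C -> C) :
  v k = (a, 0%R) -> a <> 0%R -> (0 < t)%R -> d k = (t * (a * a))%R ->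
  (forall z, upper_half_plane z -> F z = g z - 1 / (RtoC t * (z - RtoC (x k)))) ->
  solves x n (S k) (shear_u x k t v) (shear_d x k t v d) g ->
  solves x n k v d F.
Proof.
intros Hvk Ha Ht Hdk HF [Hg H].
assert (Hac : RtoC a <> 0) by (intros E; apply RtoC_inj in E; contradiction).
assert (Htc : RtoC t <> 0) by (intros E; apply RtoC_inj in E; lra).
split; [apply (pick_add_pole g F (x k) t); auto|].
intros j Hj; specialize (H j Hj); unfold shear_u, shear_d in H; revert H.
destruct (Nat.eqb_spec j k) as [->|Hjk].
- destruct (Nat.leb_spec (S k) k) as [Hlt|_]; [lia|]; intros H.
  rewrite Nat.leb_refl, Hvk, Hdk, !RtoC_mult.
  apply (interp_pole F g); auto.
  apply near_upper_all, HF.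
- intros H; assert (Hxj : x j <> x k) by (apply Hx; auto).
  assert (Hden : (t * (x j - x k) <> 0)%R) by (apply Rmult_integral_contrapositive; lra).
  assert (E1 : RtoC (fst (v j)) = RtoC (fst (v j) + snd (v j) / (t * (x j - x k))) +
    - (1 / (RtoC t * (RtoC (x j) - RtoC (x k)))) * RtoC (snd (v j))).
  { rewrite RtoC_plus, RtoC_div, RtoC_mult, RtoC_minus by exact Hden.
    field; split; [|exact Htc]; apply Cminus_neq0; intros E; apply RtoC_inj in E; contradiction. }
  simpl fst in H; simpl snd in H; rewrite E1.
  pose proof (drv_pole_neg t (x k) (x j) ltac:(lra) Hxj) as Hdrv.
  assert (EN : near_upper (RtoC (x j))
    (fun z => F z = g z + - (1 / (RtoC t * (z - RtoC (x k)))))) by apply near_upper_all, HF.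
  replace (S k <=? j)%nat with (k <=? j)%nat in H.
  2: { destruct (Nat.leb_spec k j), (Nat.leb_spec (S k) j); auto; lia. }
  destruct (k <=? j)%nat.
  + replace (RtoC (d j)) with
      (RtoC (d j - snd (v j) ^ 2 / (t * (x j - x k) ^ 2)) +
       RtoC (snd (v j)) * RtoC (snd (v j)) * RtoC (1 / (t * (x j - x k) ^ 2))).
    * apply (interp_shear g F _ _ _ _ _ _ Hdrv EN H).
    * rewrite <- !RtoC_mult, <- RtoC_plus; f_equal; field; split; lra.
  + apply (avoid_shear g F (fun z => - (1 / (RtoC t * (z - RtoC (x k)))))); auto.
    apply (drv_analytic _ _ _ Hdrv).
Qed.

End OneNode.

(** * Reduction and augmentation as mutually inverse steps *)

Lemma RtoC_m1 : RtoC (-1) = - (1).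
Proof. unfold RtoC, Copp; simpl; f_equal; ring. Qed.

Definition is_zero (q : R) : bool := if Req_EM_T q 0 then true else false.

Definition proj_value (w : R * R) : option R :=
  if is_zero (snd w) then None else Some (fst w / snd w)%R.

(** A unimodular map taking [w] to a multiple of [(1, 0)]: the identity, or
    [f |-> -1 / (f - s)] with [s] the value of [w]. *)
Definition to_pole (w : R * R) : R * R -> R * R :=
  match proj_value w with
  | None => lin 1 0 0 1
  | Some s => lin 0 (-1) 1 (- s)
  end.

Definition pole_coef (w : R * R) : R := fst (to_pole w w).

(** Chosen so that d = t a^2 with (a, 0) the transformed value, the form required by [avoid_pole].
    For w = (p, q) with q nonzero it is d / q^2, the derivative at the node; at a pole it is minus
    the inverse of the residue. *)
Definition aug_slope (w : R * R) (d : R) : R := (d / (pole_coef w * pole_coef w))%R.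

Lemma to_pole_self (w : R * R) : to_pole w w = (pole_coef w, 0%R).
Proof.
unfold pole_coef, to_pole, proj_value, is_zero.
destruct w as [p q]; simpl; destruct (Req_EM_T q 0) as [->|Hq]; unfold lin; simpl; f_equal.
- ring.
- field; exact Hq.
Qed.

Lemma pole_coef_neq0 (w : R * R) : w <> (0%R, 0%R) -> pole_coef w <> 0%R.
Proof.
unfold pole_coef, to_pole, proj_value, is_zero; intros Hw.
destruct w as [p q]; simpl; destruct (Req_EM_T q 0) as [->|Hq]; simpl.
- intros E; apply Hw; f_equal; lra.
- lra.
Qed.

Definition next_u (x : nat -> R) (k : nat) (u : nat -> R * R) (d : nat -> R) : nat -> R * R :=
  shear_u x k (aug_slope (u k) (d k)) (fun j => to_pole (u k) (u j)).

Definition next_d (x : nat -> R) (k : nat) (u : nat -> R * R) (d : nat -> R) : nat -> R :=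
  shear_d x k (aug_slope (u k) (d k)) (fun j => to_pole (u k) (u j)) d.

Lemma aug_slope_pos (w : R * R) (d : R) : w <> (0%R, 0%R) -> (0 < d)%R ->
  (0 < aug_slope w d)%R /\ d = (aug_slope w d * (pole_coef w * pole_coef w))%R.
Proof.
intros Hw Hd; apply pole_coef_neq0 in Hw; unfold aug_slope; split.
- apply Rdiv_lt_0_compat; [exact Hd | nra].
- field; exact Hw.
Qed.

Lemma avoid_meromorphic (f : C -> C) (x : R) (p q : C) :
  avoid f (RtoC x) p q -> meromorphic_at upper_half_plane f (RtoC x).
Proof. intros (P & Q & H & _); apply (rep_meromorphic f P Q); auto. Qed.

Section Step.
Variables (x : nat -> R) (n k : nat).
Hypothesis (Hk : (1 <= k <= n)%nat).
Hypothesis (Hx : forall i j, (1 <= i <= n)%nat -> (1 <= j <= n)%nat -> i <> j -> x i <> x j).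
Variables (u : nat -> R * R) (d : nat -> R).
Hypothesis (Huk : u k <> (0%R, 0%R)).
Hypothesis (Hdk : (0 < d k)%R).

Let s := proj_value (u k).
Let t := aug_slope (u k) (d k).

Lemma solves_pole_meromorphic (g : C -> C) :
  solves x n (S k) (next_u x k u d) (next_d x k u d) g ->
  meromorphic_at upper_half_plane g (RtoC (x k)).
Proof.
intros [_ H]; specialize (H k Hk); revert H; destruct (Nat.leb_spec (S k) k) as [Hlt|_]; [lia|]; intros H.
apply (avoid_meromorphic _ _ _ _ H).
Qed.

Lemma lin_id (w : R * R) : lin 1 0 0 1 w = w.
Proof. destruct w as [p q]; unfold lin; simpl; f_equal; ring. Qed.

(** The augmentation formula is solved for [g]: with F = -1 / (f - s), or F = f when the value is
    infinite, g = F + 1 / (t (z - x_k)). *)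
Lemma reduction_exists (f : C -> C) : solves x n k u d f ->
  exists g, solves x n (S k) (next_u x k u d) (next_d x k u d) g /\
    is_augmentation g (RtoC (x k)) s t f.
Proof.
intros Hf.
destruct (aug_slope_pos _ _ Huk Hdk) as [Ht Ed]; fold t in Ht, Ed.
pose proof (pole_coef_neq0 _ Huk) as Ha.
assert (Hred : forall F, solves x n k (fun j => to_pole (u k) (u j)) d F ->
  solves x n (S k) (next_u x k u d) (next_d x k u d)
    (fun z => F z + 1 / (RtoC t * (z - RtoC (x k))))).
{ intros F HF; apply (solves_remove_pole x n k Hk Hx _ d (pole_coef (u k)) t F); auto.
  apply to_pole_self. }
unfold s; destruct (proj_value (u k)) as [s0|] eqn:Es.
- assert (Hne : forall z, upper_half_plane z -> f z - RtoC s0 <> 0).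
  { unfold proj_value, is_zero in Es; destruct (Req_EM_T (snd (u k)) 0) as [|Hq]; [discriminate|].
    injection Es as <-.
    destruct Hf as [Hfp Hf]; specialize (Hf k Hk); rewrite Nat.leb_refl in Hf.
    apply (pick_neq_real f (x k) _ _ (d k)); auto; lra. }
  set (F := fun z => - (1) / (f z - RtoC s0)).
  assert (HF : solves x n k (fun j => to_pole (u k) (u j)) d F).
  { unfold to_pole; rewrite Es; apply (solves_mobius x n k u d 0 (-1) 1 (- s0) f F); auto; [ring| |].
    - apply (pick_neg_inv f s0); auto; apply Hf.
    - intros z Hz; specialize (Hne z Hz); unfold F.
      replace (RtoC 1 * f z + RtoC (- s0)) with (f z - RtoC s0) by (rewrite RtoC_opp; ring).
      split; [exact Hne|]; rewrite RtoC_m1; field; exact Hne. }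
  exists (fun z => F z + 1 / (RtoC t * (z - RtoC (x k)))).
  pose proof (Hred F HF) as Hg; split; [exact Hg|].
  split; [apply Hg|]; split; [reflexivity|]; split; [apply solves_pole_meromorphic, Hg|].
  split; [exact Ht|]; intros z Hz; specialize (Hne z Hz); split.
  + intros E; apply Hne; rewrite E; ring.
  + unfold F; field; split; [apply Cminus_neq0, upper_neq_RtoC, Hz|].
    split; [intros E; apply RtoC_inj in E; lra | exact Hne].
- assert (HF : solves x n k (fun j => to_pole (u k) (u j)) d f).
  { unfold to_pole; rewrite Es; apply (solves_ext x n k u _ d d); auto.
    intros j; symmetry; apply lin_id. }
  exists (fun z => f z + 1 / (RtoC t * (z - RtoC (x k)))).
  pose proof (Hred f HF) as Hg; split; [exact Hg|].
  split; [apply Hg|]; split; [reflexivity|]; split; [apply solves_pole_meromorphic, Hg|].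
  split; [exact Ht|]; intros z Hz; ring.
Qed.

Lemma augmentation_solves (f g : C -> C) :
  solves x n (S k) (next_u x k u d) (next_d x k u d) g ->
  is_augmentation g (RtoC (x k)) s t f -> solves x n k u d f.
Proof.
intros Hg (_ & _ & _ & _ & Haug).
destruct (aug_slope_pos _ _ Huk Hdk) as [Ht Ed]; fold t in Ht, Ed.
pose proof (pole_coef_neq0 _ Huk) as Ha.
set (F := fun z => g z - 1 / (RtoC t * (z - RtoC (x k)))).
assert (HF : solves x n k (fun j => to_pole (u k) (u j)) d F).
{ apply (solves_add_pole x n k Hk Hx _ d (pole_coef (u k)) t F g); auto.
  apply to_pole_self. }
destruct (pick_add_pole g F (x k) t Ht (proj1 Hg) (fun z _ => eq_refl)) as [HFp HF0].
unfold s in Haug; destruct (proj_value (u k)) as [s0|] eqn:Es.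
- assert (Ef : forall z, upper_half_plane z -> f z = RtoC s0 - 1 / F z).
  { intros z Hz; destruct (Haug z Hz) as [Hne E]; specialize (HF0 z Hz).
    assert (Hne' : f z - RtoC s0 <> 0) by (apply Cminus_neq0, Hne).
    assert (EF : F z = - (1 / (f z - RtoC s0))) by (unfold F; rewrite E; ring).
    rewrite EF; field; auto. }
  assert (Hfp : pick_class f).
  { destruct (pick_neg_inv F 0 (fun z => - (1) / F z) HFp) as [H1 H2].
    - intros z Hz E; apply (HF0 z Hz); rewrite <- E; ring.
    - intros z Hz; do 2 f_equal; ring.
    - split.
      + apply (pick_analytic_eq (fun z => - (1) / F z + RtoC s0)).
        * intros z Hz; rewrite Ef by exact Hz; field; auto.
        * intros z Hz; apply analytic_plus; [apply H1, Hz | apply analytic_const].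
      + intros z Hz; specialize (H2 z Hz); rewrite Ef by exact Hz.
        replace (RtoC s0 - 1 / F z) with (- (1) / F z + RtoC s0) by (field; auto).
        rewrite Im_plus; simpl (Im (RtoC s0)); lra. }
  (* The matrix of F |-> s0 - 1 / F, which inverts that of [to_pole]. *)
  apply (solves_ext x n k (fun j => lin (- s0) 1 (-1) 0 (to_pole (u k) (u j))) _ d d).
  + intros j; unfold to_pole; rewrite Es; destruct (u j) as [p q]; unfold lin; simpl; f_equal; ring.
  + reflexivity.
  + apply (solves_mobius x n k _ d _ _ _ _ F f); auto; [ring|].
    intros z Hz; specialize (HF0 z Hz).
    assert (HF0' : RtoC (-1) * F z + RtoC 0 <> 0).
    { intros E; apply HF0; replace (F z) with (- (RtoC (-1) * F z + RtoC 0))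
        by (rewrite RtoC_m1; ring); rewrite E; ring. }
    split; [exact HF0'|]; rewrite Ef by exact Hz; rewrite RtoC_opp, RtoC_m1 in *.
    field; repeat split; auto.
- apply (solves_ext x n k (fun j => lin 1 0 0 1 (to_pole (u k) (u j))) _ d d); auto.
  + intros j; unfold to_pole; rewrite Es, !lin_id; reflexivity.
  + apply (solves_mobius x n k _ d _ _ _ _ F f); auto; [ring| |].
    * destruct HFp as [H1 H2]; split.
      -- apply (pick_analytic_eq F); [intros z Hz; symmetry; apply Haug, Hz | exact H1].
      -- intros z Hz; rewrite (Haug z Hz); apply H2, Hz.
    * intros z Hz; rewrite (Haug z Hz); fold (F z).
      replace (RtoC 0 * F z + RtoC 1) with (RtoC 1) by ring.
      split; [intros E; apply RtoC_inj in E; lra | field].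
Qed.

Lemma augmentation_exists (g : C -> C) :
  solves x n (S k) (next_u x k u d) (next_d x k u d) g ->
  exists f, is_augmentation g (RtoC (x k)) s t f.
Proof.
intros Hg.
destruct (aug_slope_pos _ _ Huk Hdk) as [Ht _]; fold t in Ht.
set (F := fun z => g z - 1 / (RtoC t * (z - RtoC (x k)))).
destruct (pick_add_pole g F (x k) t Ht (proj1 Hg) (fun z _ => eq_refl)) as [_ HF0].
exists (fun z => match s with Some s0 => RtoC s0 - 1 / F z | None => F z end).
split; [apply Hg|]; split; [reflexivity|]; split; [apply solves_pole_meromorphic, Hg|].
split; [exact Ht|]; intros z Hz; specialize (HF0 z Hz); destruct s as [s0|]; [|reflexivity].
assert (E1 : RtoC 1 <> RtoC 0) by (intros E; apply RtoC_inj in E; lra).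
split.
- intros E; apply E1.
  replace (RtoC 1) with ((RtoC s0 - (RtoC s0 - 1 / F z)) * F z) by (field; exact HF0).
  rewrite E; ring.
- replace (1 / (RtoC s0 - 1 / F z - RtoC s0)) with (- F z).
  + unfold F; ring.
  + replace (RtoC s0 - 1 / F z - RtoC s0) with (- (1) / F z) by (field; exact HF0).
    field; exact HF0.
Qed.

End Step.
(** * Pick matrices and Schur complements *)

Definition rsum_m (a : nat -> R) (k n : nat) : R := sum_n_m a k n.

Lemma rsum_m_split (a : nat -> R) (k n : nat) : (k <= n)%nat ->
  rsum_m a k n = (a k + rsum_m a (S k) n)%R.
Proof. exact (sum_Sn_m (G := R_AbelianMonoid) a k n). Qed.

Lemma rsum_m_plus (a b : nat -> R) (k n : nat) :
  rsum_m (fun i => (a i + b i)%R) k n = (rsum_m a k n + rsum_m b k n)%R.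
Proof. exact (sum_n_m_plus (G := R_AbelianMonoid) a b k n). Qed.

Lemma rsum_m_scal (c : R) (a : nat -> R) (k n : nat) :
  rsum_m (fun i => (c * a i)%R) k n = (c * rsum_m a k n)%R.
Proof. exact (sum_n_m_mult_l (K := R_Ring) c a k n). Qed.

Lemma rsum_m_ext (a b : nat -> R) (k n : nat) :
  (forall i, (k <= i <= n)%nat -> a i = b i) -> rsum_m a k n = rsum_m b k n.
Proof. exact (sum_n_m_ext_loc (G := R_AbelianMonoid) a b k n). Qed.

Definition quad_form (m : nat -> nat -> R) (k n : nat) (c : nat -> R) : R :=
  rsum_m (fun i => rsum_m (fun j => (c i * m i j * c j)%R) k n) k n.

Definition pos_def (m : nat -> nat -> R) (k n : nat) : Prop :=
  forall c : nat -> R, (exists i, (k <= i <= n)%nat /\ c i <> 0%R) ->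
    (0 < quad_form m k n c)%R.

Lemma quad_form_split (m : nat -> nat -> R) (k n : nat) (c : nat -> R) : (k <= n)%nat ->
  (forall i, (k <= i <= n)%nat -> m i k = m k i) ->
  quad_form m k n c =
  (m k k * c k ^ 2 + 2 * c k * rsum_m (fun j => (m k j * c j)%R) (S k) n +
   quad_form m (S k) n c)%R.
Proof.
intros Hk Hsym; unfold quad_form.
rewrite rsum_m_split by exact Hk; rewrite (rsum_m_split (fun j => _ * c j)%R) by exact Hk.
rewrite (rsum_m_ext (fun i => rsum_m (fun j => (c i * m i j * c j)%R) k n)
  (fun i => (c k * (m k i * c i) + rsum_m (fun j => (c i * m i j * c j)%R) (S k) n)%R)).
- rewrite rsum_m_plus, rsum_m_scal.
  rewrite (rsum_m_ext (fun j => (c k * m k j * c j)%R) (fun j => (c k * (m k j * c j))%R))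
    by (intros; ring).
  rewrite rsum_m_scal; ring.
- intros i Hi; rewrite rsum_m_split, Hsym by lia; ring.
Qed.

Lemma quad_form_ext (m m' : nat -> nat -> R) (k n : nat) (c c' : nat -> R) :
  (forall i j, (k <= i <= n)%nat -> (k <= j <= n)%nat -> m i j = m' i j) ->
  (forall i, (k <= i <= n)%nat -> c i = c' i) ->
  quad_form m k n c = quad_form m' k n c'.
Proof.
intros Hm Hc; apply rsum_m_ext; intros i Hi; apply rsum_m_ext; intros j Hj.
rewrite Hm, !Hc; auto.
Qed.

Lemma rsum_m_0 (k n : nat) : rsum_m (fun _ => 0%R) k n = 0%R.
Proof. exact (sum_n_m_const_zero (G := R_AbelianMonoid) k n). Qed.

Lemma pos_def_diag (m : nat -> nat -> R) (k n : nat) : (k <= n)%nat ->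
  (forall i, (k <= i <= n)%nat -> m i k = m k i) -> pos_def m k n -> (0 < m k k)%R.
Proof.
intros Hk Hsym Hpd.
specialize (Hpd (fun i => if (i =? k)%nat then 1%R else 0%R)).
rewrite quad_form_split in Hpd by assumption; rewrite Nat.eqb_refl in Hpd.
rewrite (rsum_m_ext _ (fun _ => 0%R)), rsum_m_0 in Hpd.
2: { intros i Hi; destruct (Nat.eqb_spec i k); [lia | ring]. }
unfold quad_form in Hpd; rewrite (rsum_m_ext _ (fun _ => 0%R)), rsum_m_0 in Hpd.
2: { intros i Hi; transitivity (rsum_m (fun _ => 0%R) (S k) n); [|apply rsum_m_0].
     apply rsum_m_ext; intros j Hj.
     destruct (Nat.eqb_spec i k); [lia | ring]. }
assert (0 < m k k * 1 ^ 2 + 2 * 1 * 0 + 0)%R; [|lra].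
apply Hpd; exists k; rewrite Nat.eqb_refl; split; [lia | lra].
Qed.

(** Completing the square in the variable of index [k]: the form of the Schur complement is the
    value of the full form at the minimising choice of that variable. *)
Lemma pos_def_schur (m m' : nat -> nat -> R) (k n : nat) : (k <= n)%nat ->
  (forall i, (k <= i <= n)%nat -> m i k = m k i) -> pos_def m k n ->
  (forall i j, (S k <= i <= n)%nat -> (S k <= j <= n)%nat ->
     m' i j = (m i j - m i k * m k j / m k k)%R) ->
  pos_def m' (S k) n.
Proof.
intros Hk Hsym Hpd Hm' c (i0 & Hi0 & Hc0).
pose proof (pos_def_diag m k n Hk Hsym Hpd) as Hkk.
set (b := rsum_m (fun j => (m k j * c j)%R) (S k) n).
(* The minimiser of m_kk y^2 + 2 b y in y. *)
set (c' := fun i => if (i =? k)%nat then (- b / m k k)%R else c i).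
assert (Ec : forall i, (S k <= i <= n)%nat -> c' i = c i).
{ intros i Hi; unfold c'; destruct (Nat.eqb_spec i k); [lia | reflexivity]. }
assert (E : quad_form m k n c' = quad_form m' (S k) n c).
{ rewrite quad_form_split by assumption.
  rewrite (quad_form_ext m m (S k) n c' c) by auto.
  rewrite (rsum_m_ext _ (fun j => (m k j * c j)%R)) by (intros; rewrite Ec; auto).
  fold b; unfold c' at 1 2; rewrite Nat.eqb_refl.
  assert (E' : quad_form m' (S k) n c = (quad_form m (S k) n c + - / m k k * (b * b))%R).
  { unfold quad_form.
    rewrite (rsum_m_ext (fun i => rsum_m (fun j => (c i * m' i j * c j)%R) (S k) n)
      (fun i => (rsum_m (fun j => (c i * m i j * c j)%R) (S k) n +
                 (- / m k k * b) * (m k i * c i))%R)).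
    - rewrite rsum_m_plus, rsum_m_scal; fold b; ring.
    - intros i Hi.
      rewrite (rsum_m_ext _ (fun j => (c i * m i j * c j +
        (- / m k k * (m k i * c i)) * (m k j * c j))%R)).
      + rewrite rsum_m_plus, rsum_m_scal; fold b; ring.
      + intros j Hj; rewrite Hm', Hsym by lia; field; lra. }
  rewrite E'; field; lra. }
rewrite <- E; apply Hpd; exists i0; split; [lia | rewrite Ec by exact Hi0; exact Hc0].
Qed.

(** The Pick matrix of the half-plane problem, in homogeneous coordinates; these make
    it invariant under unimodular maps of the values. *)
Definition gram (x : nat -> R) (u : nat -> R * R) (d : nat -> R) (i j : nat) : R :=
  if (i =? j)%nat then d i
  else ((fst (u i) * snd (u j) - snd (u i) * fst (u j)) / (x i - x j))%R.

Lemma gram_mobius (x : nat -> R) (u : nat -> R * R) (d : nat -> R) (a b c e : R) (i j : nat) :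
  (a * e - b * c = 1)%R -> gram x (fun j => lin a b c e (u j)) d i j = gram x u d i j.
Proof.
intros Hdet; unfold gram; destruct (i =? j)%nat; [reflexivity|].
unfold Rdiv; f_equal; unfold lin; simpl.
replace (fst (u i) * snd (u j) - snd (u i) * fst (u j))%R with
  ((a * e - b * c) * (fst (u i) * snd (u j) - snd (u i) * fst (u j)))%R by (rewrite Hdet; ring).
ring.
Qed.

Lemma gram_to_pole (x : nat -> R) (u : nat -> R * R) (d : nat -> R) (w : R * R) (i j : nat) :
  gram x (fun j => to_pole w (u j)) d i j = gram x u d i j.
Proof. unfold to_pole; destruct (proj_value w); apply gram_mobius; ring. Qed.

Lemma gram_sym (x : nat -> R) (u : nat -> R * R) (d : nat -> R) (i j : nat) :
  (i <> j -> x i <> x j) -> gram x u d i j = gram x u d j i.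
Proof.
intros Hx; unfold gram.
destruct (Nat.eqb_spec i j) as [->|Hij]; [rewrite Nat.eqb_refl; reflexivity|].
destruct (Nat.eqb_spec j i); [congruence|]; specialize (Hx Hij); field; split; lra.
Qed.

(** Removing the pole is one step of Gaussian elimination. With v_k = (a, 0) the entries in row and
    column [k] are - a q_i / (x_i - x_k), so the rank-one correction is q_i q_j / (t (x_i - x_k)
    (x_j - x_k)). The shear subtracts the same quantity, on the diagonal through the slopes and off
    it through the values. *)
Lemma gram_shear (x : nat -> R) (k : nat) (v : nat -> R * R) (d : nat -> R) (a t : R) (i j : nat) :
  v k = (a, 0%R) -> a <> 0%R -> (0 < t)%R -> d k = (t * (a * a))%R ->
  i <> k -> j <> k -> x i <> x k -> x j <> x k -> (i <> j -> x i <> x j) ->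
  gram x (shear_u x k t v) (shear_d x k t v d) i j =
  (gram x v d i j - gram x v d i k * gram x v d k j / gram x v d k k)%R.
Proof.
intros Hvk Ha Ht Hdk Hik Hjk Hxi Hxj Hxij; unfold gram, shear_u, shear_d.
destruct (Nat.eqb_spec i k); [contradiction|]; destruct (Nat.eqb_spec j k); [contradiction|].
destruct (Nat.eqb_spec k j); [congruence|]; rewrite Nat.eqb_refl, Hvk, Hdk; simpl fst; simpl snd.
assert (H1 : (x i - x k <> 0)%R) by lra; assert (H2 : (x j - x k <> 0)%R) by lra.
assert (H3 : (x k - x j <> 0)%R) by lra.
destruct (Nat.eqb_spec i j) as [->|Hij].
- field; repeat split; auto; lra.
- specialize (Hxij Hij); assert (H4 : (x i - x j <> 0)%R) by lra.
  field; repeat split; auto; lra.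
Qed.

Lemma to_pole_neq0 (w v : R * R) : v <> (0%R, 0%R) -> to_pole w v <> (0%R, 0%R).
Proof.
intros Hv; unfold to_pole; destruct (proj_value w) as [s|]; destruct v as [p q];
  unfold lin; simpl; intros E; injection E as E1 E2; apply Hv.
- assert (q = 0%R) by lra; subst q; f_equal; lra.
- f_equal; lra.
Qed.

Lemma next_u_neq0 (x : nat -> R) (k : nat) (u : nat -> R * R) (d : nat -> R) (j : nat) :
  u j <> (0%R, 0%R) -> next_u x k u d j <> (0%R, 0%R).
Proof.
intros Hu; unfold next_u, shear_u; destruct (j =? k)%nat.
- intros E; injection E as E; lra.
- pose proof (to_pole_neq0 (u k) (u j) Hu) as H; destruct (to_pole (u k) (u j)) as [p q]; simpl.
  intros E; injection E as E1 E2; apply H; subst q; f_equal.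
  rewrite <- E1; unfold Rdiv; ring.
Qed.

(** * The recursion *)

(** Stage [i] is reached when nodes 1, ..., i have been removed; it carries the data of f_{i+1}. No
    solution enters its computation. *)
Fixpoint stage (x : nat -> R) (u0 : nat -> R * R) (d0 : nat -> R) (i : nat) :
    (nat -> R * R) * (nat -> R) :=
  match i with
  | 0%nat => (u0, d0)
  | S k => let u := fst (stage x u0 d0 k) in let d := snd (stage x u0 d0 k) in
           (next_u x (S k) u d, next_d x (S k) u d)
  end.

Section Recursion.
Variables (x : nat -> R) (n : nat) (u0 : nat -> R * R) (d0 : nat -> R).
Hypothesis (Hx : forall i j, (1 <= i <= n)%nat -> (1 <= j <= n)%nat -> i <> j -> x i <> x j).
Hypothesis (Hu0 : forall j, u0 j <> (0%R, 0%R)).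
Hypothesis (Hpd : pos_def (gram x u0 d0) 1 n).

Let U (i : nat) : nat -> R * R := fst (stage x u0 d0 i).
Let D (i : nat) : nat -> R := snd (stage x u0 d0 i).

Lemma stage_neq0 (i j : nat) : U i j <> (0%R, 0%R).
Proof. induction i as [|i IH]; [apply Hu0 | apply next_u_neq0, IH]. Qed.

(** Only the block of the nodes still to be interpolated is concerned. Its first diagonal entry is
    the slope at the next node, so positivity keeps the recursion running. *)
Lemma stage_pos_def (i : nat) : (i <= n)%nat -> pos_def (gram x (U i) (D i)) (S i) n.
Proof.
induction i as [|i IH]; intros Hi; [exact Hpd|].
specialize (IH ltac:(lia)).
assert (Hsym : forall j, (S i <= j <= n)%nat ->
  gram x (U i) (D i) j (S i) = gram x (U i) (D i) (S i) j).
{ intros j Hj; apply gram_sym; intros; apply Hx; lia. }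
pose proof (pos_def_diag _ _ _ Hi Hsym IH) as Hd.
unfold gram in Hd; rewrite Nat.eqb_refl in Hd.
apply (pos_def_schur (gram x (U i) (D i)) _ (S i) n Hi Hsym IH).
intros a b Ha Hb.
destruct (aug_slope_pos _ _ (stage_neq0 i (S i)) Hd) as [Ht Ed].
change (U (S i)) with (next_u x (S i) (U i) (D i)).
change (D (S i)) with (next_d x (S i) (U i) (D i)).
unfold next_u, next_d.
rewrite (gram_shear x (S i) _ _ (pole_coef (U i (S i))));
  [rewrite !gram_to_pole; reflexivity | apply to_pole_self | apply pole_coef_neq0, stage_neq0
  | exact Ht | exact Ed | lia | lia | apply Hx; lia | apply Hx; lia | intros; apply Hx; lia].
Qed.

Lemma stage_diag_pos (i : nat) : (i < n)%nat -> (0 < D i (S i))%R.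
Proof.
intros Hi; pose proof (stage_pos_def i ltac:(lia)) as H.
apply pos_def_diag in H; [unfold gram in H; rewrite Nat.eqb_refl in H; exact H | lia|].
intros j Hj; apply gram_sym; intros; apply Hx; lia.
Qed.

(** Node [k] is removed from stage k - 1, hence the shift of index. *)
Definition aug_value (k : nat) : option R := proj_value (fst (stage x u0 d0 (k - 1)) k).
Definition aug_param (k : nat) : R :=
  aug_slope (fst (stage x u0 d0 (k - 1)) k) (snd (stage x u0 d0 (k - 1)) k).
Definition avoid_value (j : nat) : option R := proj_value (fst (stage x u0 d0 n) j).

Definition stage_solves (i : nat) : (C -> C) -> Prop := solves x n (S i) (U i) (D i).

Definition stage_aug (i : nat) (g f : C -> C) : Prop :=
  is_augmentation g (RtoC (x (S i))) (aug_value (S i)) (aug_param (S i)) f.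

Lemma aug_param_pos (k : nat) : (1 <= k <= n)%nat -> (0 < aug_param k)%R.
Proof.
intros Hk; unfold aug_param; destruct k as [|k]; [lia|].
replace (S k - 1)%nat with k by lia.
apply aug_slope_pos; [apply stage_neq0 | apply stage_diag_pos; lia].
Qed.

Lemma stage_reduction (i : nat) (f : C -> C) : (i < n)%nat -> stage_solves i f ->
  exists g, stage_solves (S i) g /\ stage_aug i g f.
Proof.
intros Hi Hf; unfold stage_aug, aug_value, aug_param; replace (S i - 1)%nat with i by lia.
apply (reduction_exists x n (S i) ltac:(lia) Hx (U i) (D i)); auto;
  [apply stage_neq0 | apply stage_diag_pos, Hi].
Qed.

Lemma stage_augmentation (i : nat) (g f : C -> C) : (i < n)%nat ->
  stage_solves (S i) g -> stage_aug i g f -> stage_solves i f.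
Proof.
intros Hi Hg; unfold stage_aug, aug_value, aug_param; replace (S i - 1)%nat with i by lia.
apply (augmentation_solves x n (S i) ltac:(lia) Hx (U i) (D i)); auto;
  [apply stage_neq0 | apply stage_diag_pos, Hi].
Qed.

Lemma stage_augmentation_exists (i : nat) (g : C -> C) : (i < n)%nat ->
  stage_solves (S i) g -> exists f, stage_aug i g f.
Proof.
intros Hi Hg; unfold stage_aug, aug_value, aug_param; replace (S i - 1)%nat with i by lia.
apply (augmentation_exists x n (S i) ltac:(lia) (U i) (D i)); auto;
  [apply stage_neq0 | apply stage_diag_pos, Hi].
Qed.

(** Each reduction is only known to exist, so the sequence is extended by overriding it at the next
    index; induction runs on the number of removed nodes. *)
Lemma reduction_chain (f1 : C -> C) (m : nat) : (m <= n)%nat -> stage_solves 0 f1 ->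
  exists f : nat -> C -> C, f 1%nat = f1 /\
    (forall i, (i <= m)%nat -> stage_solves i (f (S i))) /\
    (forall i, (i < m)%nat -> stage_aug i (f (S (S i))) (f (S i))).
Proof.
intros Hm Hf1; induction m as [|m IH].
- exists (fun _ => f1); split; [reflexivity | split; [|intros; lia]].
  intros i Hi; replace i with 0%nat by lia; exact Hf1.
- destruct (IH ltac:(lia)) as (f & E1 & Hs & Ha).
  destruct (stage_reduction m (f (S m)) ltac:(lia) (Hs m (le_n _))) as (g & Hg & Hga).
  exists (fun k => if (k =? S (S m))%nat then g else f k).
  assert (Eg : forall k, (k < S (S m))%nat -> (k =? S (S m))%nat = false).
  { intros k Hk; apply Nat.eqb_neq; lia. }
  split; [rewrite Eg by lia; exact E1 | split].
  + intros i Hi; destruct (Nat.eq_dec i (S m)) as [->|Hne].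
    * rewrite Nat.eqb_refl; exact Hg.
    * rewrite Eg by lia; apply Hs; lia.
  + intros i Hi; rewrite (Eg (S i)) by lia; destruct (Nat.eq_dec i m) as [->|Hne].
    * rewrite Nat.eqb_refl; exact Hga.
    * rewrite Eg by lia; apply Ha; lia.
Qed.

(** The same construction downwards from [S n]. Membership in each stage is carried along because
    the next augmentation exists only for a function satisfying the conditions of its stage. *)
Lemma augmentation_chain (g : C -> C) (m : nat) : (m <= n)%nat -> stage_solves n g ->
  exists f : nat -> C -> C, f (S n) = g /\
    (forall i, (n - m <= i <= n)%nat -> stage_solves i (f (S i))) /\
    (forall i, (n - m <= i < n)%nat -> stage_aug i (f (S (S i))) (f (S i))).
Proof.
intros Hm Hg; induction m as [|m IH].
- exists (fun _ => g); split; [reflexivity | split; [|intros; lia]].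
  intros i Hi; replace i with n by lia; exact Hg.
- destruct (IH ltac:(lia)) as (f & E1 & Hs & Ha).
  set (i0 := (n - S m)%nat).
  assert (Hi0 : (S i0 = n - m)%nat) by (unfold i0; lia).
  destruct (stage_augmentation_exists i0 (f (S (S i0))) ltac:(lia)
    (Hs (S i0) ltac:(lia))) as (h & Hh).
  exists (fun k => if (k =? S i0)%nat then h else f k).
  assert (Eg : forall k, (S i0 < k)%nat -> (k =? S i0)%nat = false).
  { intros k Hk; apply Nat.eqb_neq; lia. }
  split; [rewrite Eg by lia; exact E1 | split].
  + intros i Hi; destruct (Nat.eq_dec i i0) as [->|Hne].
    * rewrite Nat.eqb_refl; apply (stage_augmentation i0 (f (S (S i0)))); auto; [lia|].
      apply Hs; lia.
    * rewrite Eg by lia; apply Hs; lia.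
  + intros i Hi; rewrite (Eg (S (S i))) by lia; destruct (Nat.eq_dec i i0) as [->|Hne].
    * rewrite Nat.eqb_refl; exact Hh.
    * rewrite Eg by lia; apply Ha; lia.
Qed.

Lemma chain_solves (f : nat -> C -> C) :
  stage_solves n (f (S n)) -> (forall i, (i < n)%nat -> stage_aug i (f (S (S i))) (f (S i))) ->
  stage_solves 0 (f 1%nat).
Proof.
intros Hn Ha.
assert (H : forall m, (m <= n)%nat -> stage_solves (n - m) (f (S (n - m)))).
{ induction m as [|m IH]; intros Hm; [rewrite Nat.sub_0_r; exact Hn|].
  specialize (IH ltac:(lia)); set (i := (n - S m)%nat) in *.
  replace (n - m)%nat with (S i) in IH by (unfold i; lia).
  apply (stage_augmentation i (f (S (S i)))); auto; [unfold i; lia|].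
  apply Ha; unfold i; lia. }
specialize (H n (le_n _)); rewrite Nat.sub_diag in H; exact H.
Qed.

End Recursion.

(** Returns from homogeneous coordinates to the form of the condition on the last function:
    meromorphy and a forbidden value in the extended real line. *)
Lemma avoid_iff (f : C -> C) (x : R) (w : R * R) : w <> (0%R, 0%R) ->
  avoid f (RtoC x) (RtoC (fst w)) (RtoC (snd w)) <->
  meromorphic_at upper_half_plane f (RtoC x) /\
  ~ has_value_at upper_half_plane f (RtoC x) (option_map RtoC (proj_value w)).
Proof.
intros Hw.
assert (Hval : forall P Q, rep f (RtoC x) P Q ->
  has_value_at upper_half_plane f (RtoC x) (option_map RtoC (proj_value w)) <->
  P (RtoC x) * RtoC (snd w) - Q (RtoC x) * RtoC (fst w) = 0).
{ intros P Q Hrep; rewrite (rep_has_value f P Q) by (auto; reflexivity).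
  unfold proj_value, is_zero; destruct w as [p q]; simpl fst; simpl snd.
  destruct (Req_EM_T q 0) as [->|Hq]; simpl.
  - assert (Hp : RtoC p <> 0).
    { intros E; apply RtoC_inj in E; apply Hw; rewrite E; reflexivity. }
    split; [intros ->; ring|]; intros E.
    replace (Q (RtoC x)) with (- (P (RtoC x) * 0 - Q (RtoC x) * RtoC p) / RtoC p) by (field; exact Hp).
    rewrite E; field; exact Hp.
  - assert (Hqc : RtoC q <> 0) by (intros E; apply RtoC_inj in E; contradiction).
    rewrite RtoC_div by exact Hq; split; intros E.
    + rewrite E; field; exact Hqc.
    + replace (P (RtoC x)) with
        ((P (RtoC x) * RtoC q - Q (RtoC x) * RtoC p + Q (RtoC x) * RtoC p) / RtoC q)
        by (field; exact Hqc).
      rewrite E; field; exact Hqc. }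
split.
- intros (P & Q & Hrep & Hne); split; [apply (rep_meromorphic f P Q); auto|].
  rewrite (Hval P Q Hrep); exact Hne.
- intros [Hm Hnv]; destruct (meromorphic_rep f (RtoC x) eq_refl Hm) as (P & Q & Hrep).
  exists P, Q; split; [exact Hrep|]; rewrite <- (Hval P Q Hrep); exact Hnv.
Qed.
(** * Transfer to the disc *)

Lemma unit_neq0 (z : C) : unit_circle z -> z <> 0.
Proof. intros Hz E; unfold unit_circle in Hz; rewrite E, Cmod_0 in Hz; lra. Qed.

Lemma unit_conj (z : C) : unit_circle z -> Cconj z = / z.
Proof.
intros Hz; pose proof (unit_neq0 z Hz) as H0.
pose proof (Cmod2_conj z) as E; rewrite Hz in E.
replace (Cconj z) with ((z * Cconj z) * / z) by (field; exact H0).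
rewrite <- E, pow1; ring.
Qed.

Lemma conj_real (w : C) : Cconj w = w -> w = RtoC (Re w).
Proof.
destruct w as [a b]; unfold Cconj, RtoC; simpl; intros E; injection E as E; f_equal; lra.
Qed.

Lemma Cconj_Ci : Cconj Ci = - Ci.
Proof. unfold Cconj, Ci, Copp; simpl; f_equal; ring. Qed.

Lemma C2_neq0 : RtoC 2 <> 0.
Proof. intros E; apply RtoC_inj in E; lra. Qed.

Lemma cayley_real (tau z : C) : unit_circle tau -> unit_circle z -> tau <> z ->
  cayley tau z = RtoC (Re (cayley tau z)).
Proof.
intros Ht Hz Hne; apply conj_real; unfold cayley, Cdiv.
pose proof (unit_neq0 _ Ht) as Ht0; pose proof (unit_neq0 _ Hz) as Hz0.
pose proof (Cminus_neq0 _ _ Hne) as Hd.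
rewrite !Cmult_conj, Cinv_conj, Cminus_conj, Cplus_conj, Cconj_Ci, !unit_conj by assumption.
field; repeat split; auto.
intros E; apply Hd; replace (tau - z) with (- (z - tau)) by ring; rewrite E; ring.
Qed.

Lemma cayley_plus_i (tau z : C) : z <> tau -> cayley tau z + Ci = 2 * Ci * tau / (tau - z).
Proof.
intros Hz; unfold cayley; field; apply Cminus_neq0; congruence.
Qed.

Lemma cayley_plus_i_neq0 (tau z : C) : tau <> 0 -> z <> tau -> cayley tau z + Ci <> 0.
Proof.
intros Ht Hz; rewrite cayley_plus_i by exact Hz.
assert (Hd : tau - z <> 0) by (apply Cminus_neq0; congruence).
intros E; apply (Cmult_neq_0 _ _ (Cmult_neq_0 _ _ C2_neq0 Ci_neq_0) Ht).
replace (2 * Ci * tau) with (2 * Ci * tau / (tau - z) * (tau - z)) by (field; exact Hd).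
rewrite E; ring.
Qed.

Lemma Im_cayley (tau z : C) : unit_circle tau -> z <> tau ->
  (Im (cayley tau z) * Cmod (tau - z) ^ 2 = 1 - Cmod z ^ 2)%R.
Proof.
intros Ht Hz.
pose proof (proj1 (Cmod_gt_0 (tau - z)) (Cminus_neq0 tau z (fun e => Hz (eq_sym e)))) as Hp.
assert (Ht2 : (Cmod tau ^ 2 = 1)%R) by (rewrite Ht; ring).
rewrite Cmod2_alt in Ht2.
apply (pow_lt _ 2) in Hp; rewrite Cmod2_alt in Hp |- *; rewrite Cmod2_alt.
destruct tau as [c d], z as [a b]; unfold cayley, Cdiv, Cinv, Ci; simpl in *.
transitivity (c * c + d * d - (a * a + b * b))%R; [field; nra | lra].
Qed.

Lemma cayley_upper (tau z : C) : unit_circle tau -> unit_disc z -> upper_half_plane (cayley tau z).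
Proof.
intros Ht Hz; unfold unit_disc in Hz.
assert (Hne : z <> tau) by (intros ->; unfold unit_circle in Ht; lra).
pose proof (Im_cayley tau z Ht Hne) as E.
pose proof (proj1 (Cmod_gt_0 (tau - z)) (Cminus_neq0 tau z (fun e => Hne (eq_sym e)))) as Hp.
unfold upper_half_plane; apply (pow_lt _ 2) in Hp; pose proof (Cmod_ge_0 z).
apply Rmult_lt_reg_r with (1 := Hp); rewrite E; nra.
Qed.

Lemma Im_cayley_nonneg (tau z : C) : unit_circle tau -> z <> tau -> (Cmod z <= 1)%R ->
  (0 <= Im (cayley tau z))%R.
Proof.
intros Ht Hne Hz; pose proof (Im_cayley tau z Ht Hne) as E.
pose proof (proj1 (Cmod_gt_0 (tau - z)) (Cminus_neq0 tau z (fun e => Hne (eq_sym e)))) as Hp.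
apply (pow_lt _ 2) in Hp; pose proof (Cmod_ge_0 z).
apply Rmult_le_reg_r with (1 := Hp); rewrite E; nra.
Qed.

Lemma plus_i_neq0 (w : C) : (0 <= Im w)%R -> w + Ci <> 0.
Proof.
intros Hw E; apply (f_equal Im) in E; rewrite Im_plus in E; simpl in E; lra.
Qed.

Lemma Cmod_cayley_inv (sigma w : C) : unit_circle sigma -> (0 <= Im w)%R ->
  (Cmod (cayley_inv sigma w) ^ 2 * Cmod (w + Ci) ^ 2 = Cmod (w + Ci) ^ 2 - 4 * Im w)%R.
Proof.
intros Hs Hw; pose proof (plus_i_neq0 w Hw) as Hne.
unfold cayley_inv; rewrite Cmod_div, Cmod_mult, Hs by exact Hne.
pose proof (proj1 (Cmod_gt_0 _) Hne) as Hp.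
replace ((1 * Cmod (w - Ci) / Cmod (w + Ci)) ^ 2 * Cmod (w + Ci) ^ 2)%R
  with (Cmod (w - Ci) ^ 2)%R by (field; lra).
rewrite !Cmod2_alt; destruct w as [a b]; simpl; ring.
Qed.

Lemma cayley_inv_disc (sigma w : C) : unit_circle sigma -> upper_half_plane w ->
  unit_disc (cayley_inv sigma w).
Proof.
intros Hs Hw; unfold upper_half_plane in Hw; unfold unit_disc.
pose proof (Cmod_cayley_inv sigma w Hs ltac:(lra)) as E.
pose proof (proj1 (Cmod_gt_0 _) (plus_i_neq0 w ltac:(lra))) as Hp.
apply (pow_lt _ 2) in Hp; pose proof (Cmod_ge_0 (cayley_inv sigma w)).
apply Rnot_le_lt; intros Hle; assert (1 <= Cmod (cayley_inv sigma w) ^ 2)%R by nra; nra.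
Qed.

Lemma Cmod_cayley_inv_le (sigma w : C) : unit_circle sigma -> (0 <= Im w)%R ->
  (Cmod (cayley_inv sigma w) <= 1)%R.
Proof.
intros Hs Hw.
pose proof (Cmod_cayley_inv sigma w Hs Hw) as E.
pose proof (proj1 (Cmod_gt_0 _) (plus_i_neq0 w Hw)) as Hp.
apply (pow_lt _ 2) in Hp; pose proof (Cmod_ge_0 (cayley_inv sigma w)).
apply Rnot_lt_le; intros Hle; assert (1 < Cmod (cayley_inv sigma w) ^ 2)%R by nra; nra.
Qed.

Lemma drv_scal (c : C) (F : C -> C) (x l : C) : drv F x l -> drv (fun z => c * F z) x (c * l).
Proof.
intros HF; replace (c * l) with (0 * F x + c * l) by ring.
apply (drv_mult (fun _ => c) F); [apply drv_const | exact HF].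
Qed.

Lemma drv_cayley (tau z : C) : z <> tau ->
  drv (cayley tau) z (2 * Ci * tau / ((tau - z) * (tau - z))).
Proof.
intros Hz; assert (Hd : tau - z <> 0) by (apply Cminus_neq0; congruence).
replace (2 * Ci * tau / ((tau - z) * (tau - z))) with
  (((0 * (tau + z) + Ci * (0 + 1)) * (tau - z) - (Ci * (tau + z)) * (0 + - (1) * 1)) /
   ((tau - z) * (tau - z))) by (field; exact Hd).
apply (drv_div (fun z => Ci * (tau + z)) (fun z => tau - z)); [exact Hd| |].
- apply (drv_mult (fun _ => Ci) (fun z => tau + z)); [apply drv_const|].
  apply (drv_plus (fun _ => tau) (fun z => z)); [apply drv_const | apply drv_id].
- apply (drv_plus (fun _ => tau) (fun z => - z)); [apply drv_const|].
  apply (drv_ext (fun z => - (1) * z) _ _ _ 1%R); [lra | intros; ring|].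
  apply (drv_scal (- (1)) (fun z => z)), drv_id.
Qed.

Lemma drv_cayley_inv (sigma w : C) : w + Ci <> 0 ->
  drv (cayley_inv sigma) w (2 * Ci * sigma / ((w + Ci) * (w + Ci))).
Proof.
intros Hw.
replace (2 * Ci * sigma / ((w + Ci) * (w + Ci))) with
  (((0 * (w - Ci) + sigma * (1 + 0)) * (w + Ci) - (sigma * (w - Ci)) * (1 + 0)) /
   ((w + Ci) * (w + Ci))) by (field; exact Hw).
assert (Hlin : forall a : C, drv (fun z => z + a) w (1 + 0)).
{ intros a; apply (drv_plus (fun z => z) (fun _ => a)); [apply drv_id | apply drv_const]. }
apply (drv_div (fun z => sigma * (z - Ci)) (fun z => z + Ci)); [exact Hw| |apply Hlin].
apply (drv_mult (fun _ => sigma) (fun z => z - Ci)); [apply drv_const | apply Hlin].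
Qed.

(** A germ that maps the upper half-plane into itself and is real at [x] has a
    real derivative there: look at [x + s e + i e^2] for [s = 1] and [s = -1]. *)
Lemma real_derivative (H : C -> C) (x : R) (l : C) :
  drv H (RtoC x) l -> Im (H (RtoC x)) = 0%R ->
  near_upper (RtoC x) (fun z => 0 <= Im (H z))%R -> Im l = 0%R.
Proof.
intros (G & r & HG & <- & Hr & E) H0 (r' & Hr' & Him).
set (l := G (RtoC x)) in *.
assert (Key : forall s : R, (s = 1 \/ s = -1)%R -> (0 <= s * Im l)%R).
{ intros s Hs; apply Rnot_lt_le; intros Hneg.
  set (m := (- (s * Im l) / 2)%R); assert (Hm : (0 < m)%R) by (unfold m; lra).
  destruct (analytic_ccont _ _ HG m Hm) as (d & Hd & HGc); fold l in HGc.
  set (B := (Rabs (Re l) + m)%R).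
  assert (HB : (0 < B)%R) by (pose proof (Rabs_pos (Re l)); unfold B; lra).
  assert (HmB : (0 < m / B)%R) by (apply Rdiv_lt_0_compat; lra).
  set (e := (Rmin (Rmin (Rmin r r') d) (Rmin 1 (m / B)) / 4)%R).
  assert (He : (0 < e /\ 4 * e <= r /\ 4 * e <= r' /\ 4 * e <= d /\ 4 * e <= 1 /\ 4 * e <= m / B)%R).
  { pose proof (Rmin_l (Rmin (Rmin r r') d) (Rmin 1 (m / B)));
    pose proof (Rmin_r (Rmin (Rmin r r') d) (Rmin 1 (m / B))).
    pose proof (Rmin_l (Rmin r r') d); pose proof (Rmin_r (Rmin r r') d).
    pose proof (Rmin_l 1 (m / B)); pose proof (Rmin_r 1 (m / B)).
    pose proof (Rmin_l r r'); pose proof (Rmin_r r r').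
    assert (0 < Rmin (Rmin (Rmin r r') d) (Rmin 1 (m / B)))%R by (repeat apply Rmin_pos; lra).
    unfold e; lra. }
  destruct He as (He & Her & Her' & Hed & He1 & HeB).
  assert (HeB' : (4 * e * B <= m)%R).
  { apply Rmult_le_compat_r with (r := B) in HeB; [|lra].
    replace (m / B * B)%R with m in HeB by (field; lra); exact HeB. }
  set (z := ((x + s * e)%R, (e * e)%R) : C).
  assert (Hz : upper_half_plane z) by (unfold upper_half_plane; simpl; nra).
  assert (Hzx : (Cmod (z - RtoC x) <= 2 * e)%R).
  { eapply Rle_trans; [apply Cmod_le_abs|]; unfold z; simpl.
    replace (x + s * e + - x)%R with (s * e)%R by ring.
    replace (e * e + - 0)%R with (e * e)%R by ring.
    rewrite !Rabs_mult, (Rabs_pos_eq e) by lra.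
    assert (Rabs s = 1)%R by (destruct Hs; subst s; [apply Rabs_R1 | rewrite Rabs_left; lra]).
    nra. }
  specialize (Him z Hz ltac:(lra)); rewrite (E z), Im_plus, H0 in Him by lra.
  specialize (HGc z ltac:(lra)).
  pose proof (Im_le_Cmod (G z - l)) as B1; rewrite Im_minus in B1.
  pose proof (Rabs_def2 _ _ (Rle_lt_trans _ _ _ B1 HGc)) as [I1 I2].
  pose proof (re_le_Cmod (G z - l)) as B2; rewrite Re_minus in B2.
  pose proof (Rabs_def2 _ _ (Rle_lt_trans _ _ _ B2 HGc)) as [R1 _].
  assert (HRe : (Re (G z) <= B)%R) by (pose proof (Rle_abs (Re l)); unfold B; lra).
  assert (HIm : (s * Im (G z) <= - m)%R) by (unfold m in *; destruct Hs; subst s; lra).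
  replace (Im ((z - RtoC x) * G z)) with (e * (s * Im (G z)) + e * e * Re (G z))%R in Him
    by (generalize (G z); intros []; unfold z; simpl; ring).
  nra. }
pose proof (Key 1%R (or_introl eq_refl)); pose proof (Key (-1)%R (or_intror eq_refl)); lra.
Qed.

(** * Half-plane data and the congruence of the two Pick matrices *)

Definition node (tau : C) (xi : nat -> C) (j : nat) : R := Re (cayley tau (xi j)).

(** [|node_factor|^2] is the ratio between the phasar derivative and the derivative
    of the transferred function, and [diag(node_factor)] is a congruence between
    the two Pick matrices. *)
Definition node_factor (tau sigma : C) (xi eta : nat -> C) (j : nat) : C :=
  (sigma - eta j) / (tau - xi j).

Definition half_plane_values (sigma : C) (eta : nat -> C) (j : nat) : R * R :=
  (Re (cayley sigma (eta j)), 1%R).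

Definition half_plane_slopes (tau sigma : C) (xi eta : nat -> C) (rho : nat -> R) (j : nat) : R :=
  (rho j / Cmod (node_factor tau sigma xi eta j) ^ 2)%R.

Lemma sum_n_m_RtoC (a : nat -> C) (b : nat -> R) (k n : nat) :
  (forall i, (k <= i <= n)%nat -> a i = RtoC (b i)) -> sum_n_m a k n = RtoC (rsum_m b k n).
Proof.
intros H; rewrite (sum_n_m_ext_loc a (fun i => RtoC (b i))) by exact H; clear H.
unfold rsum_m; destruct (Nat.le_gt_cases k n) as [Hk|Hk].
- induction Hk as [|n Hk IH].
  + rewrite !sum_n_n; reflexivity.
  + rewrite !sum_n_Sm by lia; rewrite IH; symmetry; apply RtoC_plus.
- rewrite !sum_n_m_zero by exact Hk; reflexivity.
Qed.

Lemma segment_in_disc (z x : C) (s : R) : unit_disc z -> unit_circle x -> (0 <= s < 1)%R ->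
  unit_disc (z + RtoC s * (x - z)).
Proof.
unfold unit_disc, unit_circle; intros Hz Hx Hs.
replace (z + RtoC s * (x - z)) with (RtoC (1 - s) * z + RtoC s * x) by (rewrite RtoC_minus; ring).
eapply Rle_lt_trans; [apply Cmod_triangle|].
rewrite !Cmod_mult, !Cmod_R, Hx, !Rabs_pos_eq by lra; nra.
Qed.

Lemma disc_open (z w : C) : (Cmod (w - z) < 1 - Cmod z)%R -> unit_disc w.
Proof.
intros H; unfold unit_disc; replace w with (z + (w - z)) by ring.
eapply Rle_lt_trans; [apply Cmod_triangle | lra].
Qed.

Section Transfer.
Variables (n : nat) (xi eta : nat -> C) (rho : nat -> R) (tau sigma : C).
Hypothesis (hn : (1 <= n)%nat).
Hypothesis (hxi : forall j, (1 <= j <= n)%nat -> unit_circle (xi j)).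
Hypothesis (hxi_distinct : forall i j, (1 <= i <= n)%nat -> (1 <= j <= n)%nat ->
  i <> j -> xi i <> xi j).
Hypothesis (heta : forall j, (1 <= j <= n)%nat -> unit_circle (eta j)).
Hypothesis (htau : unit_circle tau).
Hypothesis (hsigma : unit_circle sigma).
Hypothesis (htau_xi : forall j, (1 <= j <= n)%nat -> tau <> xi j).
Hypothesis (hsigma_eta : forall j, (1 <= j <= n)%nat -> sigma <> eta j).

Let x := node tau xi.
Let u0 := half_plane_values sigma eta.
Let d0 := half_plane_slopes tau sigma xi eta rho.
Let g := node_factor tau sigma xi eta.

Lemma node_eq (j : nat) : (1 <= j <= n)%nat -> cayley tau (xi j) = RtoC (x j).
Proof. intros Hj; apply cayley_real; auto. Qed.

Lemma value_eq (j : nat) : (1 <= j <= n)%nat -> cayley sigma (eta j) = RtoC (fst (u0 j)).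
Proof. intros Hj; apply cayley_real; auto. Qed.

Lemma node_distinct (i j : nat) : (1 <= i <= n)%nat -> (1 <= j <= n)%nat -> i <> j -> x i <> x j.
Proof.
intros Hi Hj Hij E; apply (hxi_distinct i j Hi Hj Hij).
assert (K : forall l, (1 <= l <= n)%nat -> cayley_inv tau (cayley tau (xi l)) = xi l).
{ intros l Hl; apply cayleyK; [apply unit_neq0, htau|].
  intros El; apply (htau_xi l Hl); auto. }
rewrite <- (K i), <- (K j), !node_eq, E by assumption; reflexivity.
Qed.

Lemma tau_xi_neq0 (j : nat) : (1 <= j <= n)%nat -> tau - xi j <> 0.
Proof. intros Hj; apply Cminus_neq0; auto. Qed.

Lemma sigma_eta_neq0 (j : nat) : (1 <= j <= n)%nat -> sigma - eta j <> 0.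
Proof. intros Hj; apply Cminus_neq0; auto. Qed.

Lemma factor_neq0 (j : nat) : (1 <= j <= n)%nat -> g j <> 0.
Proof.
intros Hj E; apply (sigma_eta_neq0 j Hj).
replace (sigma - eta j) with (g j * (tau - xi j)) by (unfold g, node_factor; field; apply tau_xi_neq0, Hj).
rewrite E; ring.
Qed.

Lemma factor_conj (j : nat) : (1 <= j <= n)%nat ->
  Cconj (g j) = g j * ((tau * xi j) / (sigma * eta j)).
Proof.
intros Hj; pose proof (tau_xi_neq0 j Hj); pose proof (sigma_eta_neq0 j Hj).
unfold g, node_factor, Cdiv.
rewrite Cmult_conj, Cinv_conj, !Cminus_conj, !unit_conj by auto.
field; repeat split; auto using unit_neq0.
intros E; apply H; replace (tau - xi j) with (- (xi j - tau)) by ring; rewrite E; ring.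
Qed.

(** On the unit circle conjugation is inversion, so off the diagonal both sides are rational in the
    nodes and values once differences of Cayley transforms are put over a common denominator. The
    diagonal case is the definition of the half-plane slopes. *)
Lemma pick_matrix_gram (i j : nat) : (1 <= i <= n)%nat -> (1 <= j <= n)%nat ->
  pick_matrix xi eta rho i j = Cconj (g i) * RtoC (gram x u0 d0 i j) * g j.
Proof.
intros Hi Hj; unfold pick_matrix, gram.
destruct (Nat.eqb_spec i j) as [->|Hij].
- replace (Cconj (g j) * RtoC (d0 j) * g j) with (RtoC (d0 j) * (g j * Cconj (g j))) by ring.
  rewrite <- Cmod2_conj, <- RtoC_mult; f_equal.
  unfold d0, half_plane_slopes; fold g; field.
  intros E; apply (factor_neq0 j Hj), Cmod_eq_0, E.
- pose proof (node_distinct i j Hi Hj Hij) as Hx.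
  assert (Hxi : xi i - xi j <> 0) by (apply Cminus_neq0, hxi_distinct; auto).
  pose proof (tau_xi_neq0 i Hi); pose proof (tau_xi_neq0 j Hj).
  pose proof (sigma_eta_neq0 i Hi); pose proof (sigma_eta_neq0 j Hj).
  pose proof (unit_neq0 _ (hxi i Hi)); pose proof (unit_neq0 _ (hxi j Hj)).
  pose proof (unit_neq0 _ (heta i Hi)); pose proof (unit_neq0 _ htau); pose proof (unit_neq0 _ hsigma).
  simpl (snd (u0 _)); rewrite RtoC_div, RtoC_minus, RtoC_minus by lra.
  rewrite !Rmult_1_r, !Rmult_1_l, <- !value_eq, <- !node_eq, factor_conj by assumption.
  rewrite !unit_conj by auto.
  replace (cayley sigma (eta i) - cayley sigma (eta j)) with
    (2 * Ci * sigma * (eta i - eta j) / ((sigma - eta i) * (sigma - eta j)))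
    by (unfold cayley; field; auto).
  replace (cayley tau (xi i) - cayley tau (xi j)) with
    (2 * Ci * tau * (xi i - xi j) / ((tau - xi i) * (tau - xi j)))
    by (unfold cayley; field; auto).
  unfold g, node_factor; field.
  repeat split; auto using C2_neq0, Ci_neq_0.
Qed.

Lemma half_plane_pos_def : positive_definite n (pick_matrix xi eta rho) ->
  pos_def (gram x u0 d0) 1 n.
Proof.
intros [_ HM] c (i0 & Hi0 & Hc0).
(* Dividing by the factors undoes the congruence and leaves the real quadratic form at [c]. *)
specialize (HM (fun i => RtoC (c i) / g i)); cbv beta in HM.
match type of HM with _ -> (0 < Re ?S)%R =>
  assert (E : S = RtoC (quad_form (gram x u0 d0) 1 n c)) end.
{ apply sum_n_m_RtoC; intros i Hi; apply sum_n_m_RtoC; intros j Hj.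
  rewrite pick_matrix_gram by assumption.
  assert (Hgi : Cconj (g i) <> 0).
  { intros E; apply (factor_neq0 i Hi), Cmod_eq_0; rewrite <- Cmod_conj, E; apply Cmod_0. }
  pose proof (factor_neq0 i Hi); pose proof (factor_neq0 j Hj).
  unfold Cdiv at 1; rewrite Cmult_conj, Cinv_conj, !RtoC_mult by assumption.
  replace (Cconj (RtoC (c i))) with (RtoC (c i)) by (unfold Cconj, RtoC; simpl; f_equal; ring).
  field; auto. }
rewrite E in HM; apply HM.
exists i0; split; [exact Hi0|]; intros E0; apply Hc0, RtoC_inj.
replace (RtoC (c i0)) with (RtoC (c i0) / g i0 * g i0) by (field; apply factor_neq0, Hi0).
rewrite E0; ring.
Qed.

Lemma slope_ratio (j : nat) : (1 <= j <= n)%nat ->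
  RtoC (Cmod (g j) ^ 2) =
  ((sigma - eta j) * (sigma - eta j) * (tau * xi j)) /
  ((tau - xi j) * (tau - xi j) * (sigma * eta j)).
Proof.
intros Hj; rewrite Cmod2_conj, factor_conj by exact Hj; unfold g, node_factor.
field; repeat split; auto using unit_neq0, tau_xi_neq0.
Qed.

(** Keeps the outer Cayley transform finite on the disc. A constant [phi] equal to [sigma] is
    excluded by the first node, where the boundary value differs from [sigma]; this is where n >= 1
    enters. *)
Lemma schur_neq_sigma (phi : C -> C) : boundary_NP_solution n xi eta rho phi ->
  forall z, unit_disc z -> phi z <> sigma.
Proof.
intros [[Hphi Hle] Hb] z0 Hz0 E0.
assert (H1 : (1 <= 1 <= n)%nat) by lia.
destruct (Hb 1%nat H1) as (Phi & (HPhi & r & Hr & HE) & HPx & _).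
pose proof (unit_neq0 _ hsigma) as Hs0.
assert (HPs : Phi (xi 1%nat) - sigma <> 0).
{ rewrite HPx; apply Cminus_neq0; intros E; apply (hsigma_eta 1%nat H1); auto. }
destruct (ccont_neq0 (fun z => Phi z - sigma) (xi 1%nat)) as (r' & Hr' & HPn); [|exact HPs|].
{ apply analytic_ccont, analytic_minus; [exact HPhi | apply analytic_const]. }
set (rr := Rmin r r').
assert (Hrr : (0 < rr)%R) by (apply Rmin_pos; auto).
pose proof (Rmin_l r r'); pose proof (Rmin_r r r').
pose proof (Cmod_ge_0 (z0 - xi 1%nat)) as Hc0.
(* This function has imaginary part 1 - Re (conj(sigma) phi) >= 0 and vanishes exactly where [phi]
   equals [sigma]. *)
apply (segment_nonzero (fun z => Ci * (1 - Cconj sigma * phi z)) z0 (xi 1%nat)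
  (rr / (Cmod (z0 - xi 1%nat) + 1))).
- intros s Hs; pose proof (segment_in_disc z0 (xi 1%nat) s Hz0 (hxi 1%nat H1) Hs) as HD; split.
  + apply analytic_mult; [apply analytic_const|].
    apply analytic_minus; [apply analytic_const|].
    apply analytic_mult; [apply analytic_const | apply Hphi, HD].
  + exists (1 - Cmod (z0 + RtoC s * (xi 1%nat - z0)))%R; split; [unfold unit_disc in HD; lra|].
    intros z Hz; apply disc_open in Hz; specialize (Hle z Hz).
    pose proof (re_le_Cmod (Cconj sigma * phi z)) as B.
    rewrite Cmod_mult, Cmod_conj, hsigma in B; pose proof (Rle_abs (Re (Cconj sigma * phi z))).
    replace (Im (Ci * (1 - Cconj sigma * phi z))) with (1 - Re (Cconj sigma * phi z))%R by
      (generalize (Cconj sigma * phi z); intros []; simpl; ring).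
    lra.
- apply Rdiv_lt_0_compat; lra.
- intros s Hs Hs1 E.
  set (z := z0 + RtoC s * (xi 1%nat - z0)) in *.
  assert (Hz : unit_disc z) by (apply segment_in_disc; auto).
  assert (Hzx : (Cmod (z - xi 1%nat) < rr)%R).
  { replace (z - xi 1%nat) with (RtoC (1 - s) * (z0 - xi 1%nat))
      by (unfold z; rewrite RtoC_minus; ring).
    rewrite Cmod_mult, Cmod_R, Rabs_pos_eq by lra.
    apply Rle_lt_trans with ((1 - s) * (Cmod (z0 - xi 1%nat) + 1))%R;
      [apply Rmult_le_compat_l; lra|].
    apply Rmult_lt_reg_r with (/ (Cmod (z0 - xi 1%nat) + 1))%R; [apply Rinv_0_lt_compat; lra|].
    rewrite Rmult_assoc, Rinv_r by lra; unfold Rdiv in Hs1; lra. }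
  apply (HPn z); [unfold rr in *; lra|].
  rewrite HE by (auto; unfold rr in *; lra).
  rewrite unit_conj in E by exact hsigma.
  replace (phi z - sigma) with (sigma * Ci * (Ci * (1 - / sigma * phi z))).
  + rewrite E; ring.
  + replace (sigma * Ci * (Ci * (1 - / sigma * phi z))) with
      (Ci * Ci * (sigma - phi z)) by (field; exact Hs0).
    replace (Ci * Ci) with (- (1)) by (unfold Ci, Cmult, Copp; simpl; f_equal; ring); ring.
- rewrite E0, unit_conj by exact hsigma; field; exact Hs0.
Qed.

Lemma schur_to_pick (phi : C -> C) : boundary_NP_solution n xi eta rho phi ->
  solves x n 1 u0 d0 (fun w => cayley sigma (phi (cayley_inv tau w))).
Proof.
intros Hsol; pose proof (schur_neq_sigma phi Hsol) as Hns.
destruct Hsol as [[Hphi Hle] Hb].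
pose proof (unit_neq0 _ htau) as Ht0; pose proof (unit_neq0 _ hsigma) as Hs0.
assert (Him : forall w, upper_half_plane w ->
  (0 <= Im (cayley sigma (phi (cayley_inv tau w))))%R).
{ intros w Hw; pose proof (cayley_inv_disc tau w htau Hw) as HD.
  apply Im_cayley_nonneg; auto. }
split; [split; [|exact Him]|].
- intros w Hw; pose proof (cayley_inv_disc tau w htau Hw) as HD.
  assert (Hw0 : w + Ci <> 0) by (apply plus_i_neq0, Rlt_le, Hw).
  apply (analytic_comp (fun z => cayley sigma (phi z)) (cayley_inv tau)).
  + apply (analytic_comp (cayley sigma) phi); [|apply Hphi, HD].
    apply (drv_analytic _ _ _ (drv_cayley sigma _ (Hns _ HD))).
  + apply (drv_analytic _ _ _ (drv_cayley_inv tau w Hw0)).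
- intros j Hj; replace (1 <=? j)%nat with true by (symmetry; apply Nat.leb_le; lia).
  destruct (Hb j Hj) as (Phi & (HPhi & r & Hr & HE) & HPx & Hrho).
  destruct (drv_exists _ _ HPhi) as [p' Hp'].
  unfold phasar_derivative in Hrho; rewrite (drv_C_derive _ _ _ Hp'), HPx in Hrho.
  assert (Hxt : xi j <> tau) by (intros E; apply (htau_xi j Hj); auto).
  assert (Hes : eta j <> sigma) by (intros E; apply (hsigma_eta j Hj); auto).
  pose proof (node_eq j Hj) as Ex.
  assert (Hx0 : RtoC (x j) + Ci <> 0) by (rewrite <- Ex; apply cayley_plus_i_neq0; auto).
  assert (Einv : cayley_inv tau (RtoC (x j)) = xi j) by (rewrite <- Ex; apply cayleyK; auto).
  set (H := fun w => cayley sigma (Phi (cayley_inv tau w))).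
  assert (HH : drv H (RtoC (x j)) ((2 * Ci * sigma / ((sigma - eta j) * (sigma - eta j)) * p') *
    (2 * Ci * tau / ((RtoC (x j) + Ci) * (RtoC (x j) + Ci))))).
  { apply (drv_comp (fun z => cayley sigma (Phi z)) (cayley_inv tau));
      [rewrite Einv | apply drv_cayley_inv, Hx0].
    apply (drv_comp (cayley sigma) Phi); [rewrite HPx; apply drv_cayley; exact Hes | exact Hp']. }
  assert (HHx : H (RtoC (x j)) = RtoC (fst (u0 j))).
  { unfold H; rewrite Einv, HPx; apply value_eq, Hj. }
  assert (HHE : near_upper (RtoC (x j)) (fun w => H w = cayley sigma (phi (cayley_inv tau w)))).
  { pose proof (drv_analytic _ _ _ (drv_cayley_inv tau _ Hx0)) as HA.
    destruct (analytic_ccont _ _ HA r Hr) as (d & Hd & HC).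
    exists d; split; [exact Hd|]; intros w Hw Hwd; specialize (HC w Hwd).
    rewrite Einv in HC; unfold H; rewrite HE; auto; apply cayley_inv_disc; auto. }
  (* The two Cayley derivatives together contribute the factor that turns xi phi' / eta into the
     slope of the transferred function. *)
  assert (HHl : (2 * Ci * sigma / ((sigma - eta j) * (sigma - eta j)) * p') *
    (2 * Ci * tau / ((RtoC (x j) + Ci) * (RtoC (x j) + Ci))) =
    (xi j * p' / eta j) / RtoC (Cmod (g j) ^ 2)).
  { rewrite slope_ratio, <- Ex, cayley_plus_i by auto.
    field; repeat split; auto using unit_neq0, C2_neq0, Ci_neq_0, tau_xi_neq0, sigma_eta_neq0. }
  rewrite HHl in HH.
  assert (Hg1 : Cmod (g j) <> 0%R) by (intros E; apply (factor_neq0 j Hj), Cmod_eq_0, E).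
  assert (Hg2 : (Cmod (g j) ^ 2)%R <> 0%R) by (apply pow_nonzero, Hg1).
  assert (Hg2c : RtoC (Cmod (g j) ^ 2) <> 0) by (intros E; apply RtoC_inj in E; contradiction).
  assert (Hl : xi j * p' / eta j / RtoC (Cmod (g j) ^ 2) = RtoC (d0 j)).
  (* The phasar derivative prescribes only a real part; that the whole derivative is real follows
     from the transferred function mapping into the closed half-plane and being real at the node. *)
  { assert (HI : Im (xi j * p' / eta j / RtoC (Cmod (g j) ^ 2)) = 0%R).
    { apply (real_derivative H (x j) _ HH); [rewrite HHx; reflexivity|].
      revert HHE; apply near_upper_imp; intros w Hw ->; apply Him, Hw. }
    unfold d0, half_plane_slopes; fold g.
    rewrite <- Hrho, RtoC_div by exact Hg2.
    clear - HI Hg1 Hg2; revert HI; generalize (xi j * p' / eta j); intros v HI.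
    replace (Im (v / RtoC (Cmod (g j) ^ 2))) with (Im v / (Cmod (g j) ^ 2))%R in HI.
    - assert (Im v = 0%R) as Hv.
      { replace (Im v) with (Im v / Cmod (g j) ^ 2 * Cmod (g j) ^ 2)%R by (field; exact Hg1).
        rewrite HI; ring. }
      f_equal; destruct v as [a b]; simpl in Hv; subst b; reflexivity.
    - unfold Cdiv, Rdiv; rewrite <- RtoC_inv by exact Hg2.
      generalize (/ Cmod (g j) ^ 2)%R; intros k; destruct v as [a b]; simpl; ring. }
  rewrite Hl in HH.
  exists H, (fun _ => 1); split; [split; [|split; [|split]]|].
  + exact (drv_analytic _ _ _ HH).
  + apply analytic_const.
  + intros [_ E]; apply RtoC_inj in E; lra.
  + revert HHE; apply near_upper_imp; intros w _ ->; split; [|field].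
    intros E; apply RtoC_inj in E; lra.
  + split; [exact HHx | split; [reflexivity|]].
    exists (RtoC (d0 j)), 0; split; [exact HH | split; [apply drv_const|]].
    simpl snd; ring.
Qed.

Lemma pick_to_schur (f phi : C -> C) : solves x n 1 u0 d0 f ->
  (forall z, unit_disc z -> phi z = cayley_inv sigma (f (cayley tau z))) ->
  boundary_NP_solution n xi eta rho phi.
Proof.
intros [[Hf Him] Hb] Ephi.
pose proof (unit_neq0 _ htau) as Ht0; pose proof (unit_neq0 _ hsigma) as Hs0.
split; [split|].
- intros z Hz.
  assert (Hzt : z <> tau) by (intros ->; unfold unit_disc, unit_circle in *; lra).
  apply analytic_ext with (fun z => cayley_inv sigma (f (cayley tau z))) (1 - Cmod z)%R.
  + unfold unit_disc in Hz; lra.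
  + intros w Hw; symmetry; apply Ephi, (disc_open z), Hw.
  + pose proof (cayley_upper tau z htau Hz) as HU.
    apply (analytic_comp (fun w => cayley_inv sigma (f w)) (cayley tau)).
    * apply (analytic_comp (cayley_inv sigma) f); [|apply Hf, HU].
      apply (drv_analytic _ _ _ (drv_cayley_inv sigma _ (plus_i_neq0 _ (Him _ HU)))).
    * apply (drv_analytic _ _ _ (drv_cayley tau z Hzt)).
- intros z Hz; rewrite Ephi by exact Hz; apply Cmod_cayley_inv_le; auto.
  apply Him, cayley_upper; auto.
- intros j Hj; specialize (Hb j Hj).
  replace (1 <=? j)%nat with true in Hb by (symmetry; apply Nat.leb_le; lia).
  destruct Hb as (P & Q & (HP & HQ & _ & HE) & HPx & HQx & P' & Q' & HP' & HQ' & HW).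
  simpl snd in HQx, HW.
  assert (Hxt : xi j <> tau) by (intros E; apply (htau_xi j Hj); auto).
  assert (Hes : eta j <> sigma) by (intros E; apply (hsigma_eta j Hj); auto).
  pose proof (node_eq j Hj) as Ex; pose proof (value_eq j Hj) as Ev.
  assert (HQ0 : Q (RtoC (x j)) <> 0) by (rewrite HQx; intros E; apply RtoC_inj in E; lra).
  set (F := fun w => P w / Q w).
  assert (HFx : F (RtoC (x j)) = RtoC (fst (u0 j))).
  { unfold F; rewrite HPx, HQx; field. }
  assert (HF : drv F (RtoC (x j)) (RtoC (d0 j))).
  (* The second coordinate of the value is 1, so the Wronskian is the derivative of the quotient. *)
  { rewrite <- HW.
    replace (P' * RtoC 1 - RtoC (fst (u0 j)) * Q') with
      ((P' * Q (RtoC (x j)) - P (RtoC (x j)) * Q') / (Q (RtoC (x j)) * Q (RtoC (x j)))).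
    - apply drv_div; auto.
    - rewrite HPx, HQx; field. }
  set (Phi := fun z => cayley_inv sigma (F (cayley tau z))).
  assert (Hv0 : RtoC (fst (u0 j)) + Ci <> 0).
  { rewrite <- Ev; apply cayley_plus_i_neq0; auto. }
  assert (HPhi : drv Phi (xi j)
    ((2 * Ci * sigma / ((RtoC (fst (u0 j)) + Ci) * (RtoC (fst (u0 j)) + Ci)) * RtoC (d0 j)) *
     (2 * Ci * tau / ((tau - xi j) * (tau - xi j))))).
  { apply (drv_comp (fun w => cayley_inv sigma (F w)) (cayley tau));
      [rewrite Ex | apply drv_cayley, Hxt].
    apply (drv_comp (cayley_inv sigma) F); [rewrite HFx; apply drv_cayley_inv, Hv0 | exact HF]. }
  assert (HPhix : Phi (xi j) = eta j).
  { unfold Phi; rewrite Ex, HFx, <- Ev; apply cayleyK; auto. }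
  exists Phi; split; [split; [exact (drv_analytic _ _ _ HPhi)|]|split; [exact HPhix|]].
  + destruct HE as (r & Hr & HE).
    pose proof (drv_analytic _ _ _ (drv_cayley tau _ Hxt)) as HA.
    destruct (analytic_ccont _ _ HA r Hr) as (d & Hd & HC); rewrite Ex in HC.
    exists d; split; [exact Hd|]; intros z Hz Hzd.
    rewrite Ephi by exact Hz; unfold Phi, F; f_equal.
    symmetry; apply HE; auto; apply cayley_upper; auto.
  + unfold phasar_derivative; rewrite (drv_C_derive _ _ _ HPhi), HPhix.
    assert (Hg1 : Cmod (g j) <> 0%R) by (intros E; apply (factor_neq0 j Hj), Cmod_eq_0, E).
    replace (xi j * (2 * Ci * sigma / ((RtoC (fst (u0 j)) + Ci) * (RtoC (fst (u0 j)) + Ci)) *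
      RtoC (d0 j) * (2 * Ci * tau / ((tau - xi j) * (tau - xi j)))) / eta j)
      with (RtoC (Cmod (g j) ^ 2) * RtoC (d0 j)).
    * rewrite <- RtoC_mult; simpl Re; unfold d0, half_plane_slopes; fold g; field; exact Hg1.
    * rewrite slope_ratio, <- Ev, cayley_plus_i by auto.
      field; repeat split; auto using unit_neq0, C2_neq0, Ci_neq_0, tau_xi_neq0, sigma_eta_neq0.
Qed.

End Transfer.

(** * Assembly of the recursion with the transfer to the disc *)

Theorem theorem8p3 (n : nat) (xi eta : nat -> C) (rho : nat -> R) (tau sigma : C)
  (hn : (1 <= n)%nat)
  (hxi : forall j, (1 <= j <= n)%nat -> unit_circle (xi j))
  (hxi_distinct : forall i j, (1 <= i <= n)%nat -> (1 <= j <= n)%nat ->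
     i <> j -> xi i <> xi j)
  (heta : forall j, (1 <= j <= n)%nat -> unit_circle (eta j))
  (hrho : forall j, (1 <= j <= n)%nat -> (0 <= rho j)%R)
  (hM : positive_definite n (pick_matrix xi eta rho))
  (htau : unit_circle tau) (hsigma : unit_circle sigma)
  (htau_xi : forall j, (1 <= j <= n)%nat -> tau <> xi j)
  (hsigma_eta : forall j, (1 <= j <= n)%nat -> sigma <> eta j) :
  exists (s : nat -> option R) (t : nat -> R) (y : nat -> option R),
    let condition1 (g : C -> C) :=
      pick_class g /\
      forall j, (1 <= j <= n)%nat ->
        meromorphic_at upper_half_plane g (cayley tau (xi j)) /\
        ~ has_value_at upper_half_plane g (cayley tau (xi j))
            (option_map RtoC (y j)) in
    let condition2 (f : nat -> C -> C) :=
      forall k, (1 <= k <= n)%nat ->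
        pick_class (f k) /\
        is_augmentation (f (S k)) (cayley tau (xi k)) (s k) (t k) (f k) in
    (forall k, (1 <= k <= n)%nat -> (0 < t k)%R) /\
    (* the recursion can be run from every admissible choice of the last function *)
    (forall g, condition1 g -> exists f, f (S n) = g /\ condition2 f) /\
    (forall phi : C -> C,
       boundary_NP_solution n xi eta rho phi <->
       exists f : nat -> C -> C,
         condition1 (f (S n)) /\ condition2 f /\
         forall z, unit_disc z -> phi z = cayley_inv sigma (f 1%nat (cayley tau z))).
Proof.
set (x := node tau xi).
set (u0 := half_plane_values sigma eta).
set (d0 := half_plane_slopes tau sigma xi eta rho).
assert (Hnode : forall j, (1 <= j <= n)%nat -> cayley tau (xi j) = RtoC (x j)).
{ apply node_eq; assumption. }
assert (Hx : forall i j, (1 <= i <= n)%nat -> (1 <= j <= n)%nat -> i <> j -> x i <> x j).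
{ apply node_distinct; assumption. }
assert (Hu0 : forall j, u0 j <> (0%R, 0%R)).
{ intros j E; injection E as _ E; lra. }
assert (Hpd : pos_def (gram x u0 d0) 1 n).
{ apply half_plane_pos_def; assumption. }
exists (aug_value x u0 d0), (aug_param x u0 d0), (avoid_value x n u0 d0).
intros condition1 condition2.
(* At stage [n] every node has been removed, so only avoidance conditions remain and they are those
   of (1). *)
assert (C1 : forall g, condition1 g <-> stage_solves x n u0 d0 n g).
{ intros g; unfold condition1, stage_solves, solves, avoid_value.
  split; intros [Hg H]; split; auto; intros j Hj; specialize (H j Hj).
  - destruct (Nat.leb_spec (S n) j); [lia|].
    apply avoid_iff; [apply stage_neq0, Hu0|]; rewrite <- Hnode by exact Hj; exact H.
  - rewrite Hnode by exact Hj; apply avoid_iff; [apply stage_neq0, Hu0|].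
    revert H; destruct (Nat.leb_spec (S n) j); [lia | auto]. }
assert (C2 : forall f, (forall i, (i < n)%nat -> stage_aug x u0 d0 i (f (S (S i))) (f (S i))) <->
  (forall k, (1 <= k <= n)%nat ->
     is_augmentation (f (S k)) (cayley tau (xi k)) (aug_value x u0 d0 k) (aug_param x u0 d0 k) (f k))).
{ intros f; split; intros H.
  - intros k Hk; rewrite Hnode by exact Hk; destruct k as [|k]; [lia|]; apply H; lia.
  - intros i Hi; unfold stage_aug; rewrite <- Hnode by lia; apply H; lia. }
split; [|split].
- intros k Hk; apply (aug_param_pos x n u0 d0); assumption.
- intros g Hg; apply C1 in Hg.
  destruct (augmentation_chain x n u0 d0 Hx Hu0 Hpd g n (le_n _) Hg) as (f & E & Hs & Ha).
  rewrite Nat.sub_diag in Hs, Ha.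
  exists f; split; [exact E|]; intros k Hk; split.
  + destruct k as [|k]; [lia|]; apply (Hs k); lia.
  + revert k Hk; apply C2; intros i Hi; apply Ha; lia.
- intros phi; split.
  + intros Hphi.
    destruct (reduction_chain x n u0 d0 Hx Hu0 Hpd
      (fun w => cayley sigma (phi (cayley_inv tau w))) n (le_n _)) as (f & E & Hs & Ha).
    { apply schur_to_pick; assumption. }
    exists f; split; [apply C1, Hs; lia | split].
    * intros k Hk; split; [destruct k as [|k]; [lia|]; apply (Hs k); lia|].
      revert k Hk; apply C2, Ha.
    * intros z Hz; rewrite E.
      (* Both Cayley transforms cancel, the outer one because [phi] omits [sigma] on the disc. *)
      rewrite (cayleyK tau z), (cayleyK sigma (phi z)); auto using unit_neq0.
      -- refine (schur_neq_sigma n xi eta rho sigma _ _ _ _ phi _ z _); assumption.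
      -- intros ->; unfold unit_disc, unit_circle in *; lra.
  + intros (f & H1 & H2 & Ephi).
    apply (pick_to_schur n xi eta rho tau sigma) with (f := f 1%nat); try assumption.
    apply (chain_solves x n u0 d0 Hx Hu0 Hpd f).
    * apply C1, H1.
    * apply C2; intros k Hk; apply H2, Hk.
Qed.
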